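(* For every $d\in\mathbb{N}$ and every $m\in\mathbb{N}$, there is at least one $\beta>0$ for which $c_\beta\rho^m$ is a radial eigenvalue of $A_{\beta,d}$. For $m=0$, the value $c_\beta$ itself is never a radial eigenvalue of $A_{\beta,d}$ (for any $d\in\mathbb{N}$ and $\beta>0$).
   Context: $\mathbb{N}=\{1,2,\dots\}$. For $\beta>0$ and $d\in\mathbb{N}$: $\Omega=\sqrt{1+4\beta^2}$, $q=\frac{\Omega-1}{\Omega+1}\in(0,1)$, $\rho=q^2$, $c_\beta=(1-q)^d$ (all depending on $\beta$). $\mu_\beta$ is the centered Gaussian probability measure on $\mathbb{R}^d$ with covariance matrix $\beta^2I_d$, and $A_{\beta,d}$ is the integral operator $(A_{\beta,d}f)(s)=\int_{\mathbb{R}^d}K(s,t)f(t)\,d\mu_\beta(t)$ on the real Hilbert space $L^2(\mu_\beta)$, with $$K(s,t)=\exp\Big(-\frac{\|s-t\|^2}2\Big)-\Big\{1+s^\top t+\frac{(s^\top t)^2}2\Big\}\exp\Big(-\frac{\|s\|^2+\|t\|^2}2\Big).$$ A radial eigenvalue of $A_{\beta,d}$ is a nonzero eigenvalue of its restriction to the closed invariant subspace of radial functions in $L^2(\mu_\beta)$ when $d\ge2$, and of even functions when $d=1$. *)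

(* Defs.v *)
From HB Require Import structures.
From mathcomp Require Import all_boot all_order all_algebra.
From mathcomp Require Import all_classical all_reals all_analysis.
From mathcomp Require Import measurable_realfun ring lra.

Set Implicit Arguments.
Unset Strict Implicit.
Unset Printing Implicit Defensive.

Import Order.TTheory GRing.Theory Num.Theory.
Import numFieldNormedType.Exports.

Local Open Scope classical_set_scope.
Local Open Scope ring_scope.

(* R^d with its product (= Borel) sigma-algebra; row vectors carry no
   measurable structure in the library, tuples do. *)
Notation euclid R d := (d.-tuple (measurableTypeR R)).

Section euclidean.
Context {R : realType} {d : nat}.
Implicit Types s t : euclid R d.

Definition dot s t : R := \sum_(i < d) (tnth s i : R) * (tnth t i : R).
Definition norm2 s : R := Num.sqrt (dot s s).
Definition tsub s t : euclid R d :=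
  [tuple (tnth s i : R) - (tnth t i : R) | i < d].
Definition topp s : euclid R d := [tuple - (tnth s i : R) | i < d].

Lemma dot_ge0 s : 0 <= dot s s.
Proof. by apply: sumr_ge0 => i _; rewrite -expr2 sqr_ge0. Qed.

Lemma norm2_sqr s : norm2 s ^+ 2 = dot s s.
Proof. by rewrite sqr_sqrtr ?dot_ge0. Qed.

Lemma normr_dot_le s t : `|dot s t| <= (dot s s + dot t t) / 2.
Proof.
rewrite /dot (le_trans (ler_norm_sum _ _ _))// -big_split/= mulr_suml.
apply: ler_sum => i _; rewrite ler_norml.
have : 0 <= ((tnth s i : R) - (tnth t i : R)) ^+ 2 by exact: sqr_ge0.
have : 0 <= ((tnth s i : R) + (tnth t i : R)) ^+ 2 by exact: sqr_ge0.
rewrite !expr2; set x : R := tnth s i; set y : R := tnth t i.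
by move=> h1 h2; apply/andP; split; lra.
Qed.

End euclidean.

Section gaussian.
Context {R : realType}.

Definition tcons (d : nat) (p : measurableTypeR R * euclid R d) :
  euclid R d.+1 := [tuple of p.1 :: p.2].

Lemma measurable_tcons d : measurable_fun setT (@tcons d).
Proof. exact: measurable_cons. Qed.

HB.instance Definition _ d :=
  isMeasurableFun.Build _ _ _ _ (@tcons d) (@measurable_tcons d).

(* N(0, b^2 I_d), i.e. the d-fold product of N(0, b^2): see gauss_rect.
   The second argument of normal_prob is the standard deviation. *)
Fixpoint gauss (b : R) (d : nat) : probability (euclid R d) R :=
  match d with
  | 0 => dirac [tuple]
  | n.+1 => distribution (normal_prob 0 b \x gauss b n)%E (@tcons n)
  end.

Lemma gauss_rect (b : R) (d : nat) (A : 'I_d -> set (measurableTypeR R)) :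
  (forall i, measurable (A i)) ->
  gauss b d [set s | forall i, A i (tnth s i)] =
  (\prod_(i < d) normal_prob 0%R b (A i))%E.
Proof.
elim: d A => [|d IH] A mA /=.
  rewrite big_ord0 diracE mem_set//=; by case.
rewrite big_ord_recl /distribution /pushforward.
rewrite (_ : _ @^-1` _ =
  A ord0 `*` [set s : euclid R d | forall i, A (lift ord0 i) (tnth s i)]).
  rewrite product_measure1E//; first by congr (_ * _)%E; exact: IH.
  rewrite (_ : [set _ | _] =
    \bigcap_(i in [set: 'I_d]) [set s : euclid R d | A (lift ord0 i) (tnth s i)]).
    apply: fin_bigcap_measurable; first exact: finite_finset.
    by move=> i _; rewrite -[X in measurable X]setTI; apply: measurable_tnth.
  by apply/seteqP; split => s /= h i; [move=> _; apply: h | apply: (h i I)].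
apply/seteqP; split=> -[x s] /=.
  move=> h; split; first exact: (h ord0).
  by move=> i; have := h (lift ord0 i); rewrite tnthS.
move=> [h0 h] i; case: (unliftP ord0 i) => [j|] -> //.
by rewrite tnthS.
Qed.

End gaussian.

Section operator.
Context {R : realType} {d : nat}.
Implicit Types (b lambda : R) (s t : euclid R d) (f g : euclid R d -> R).

Definition K s t : R :=
  expR (- (norm2 (tsub s t) ^+ 2 / 2)) -
  (1 + dot s t + dot s t ^+ 2 / 2) *
    expR (- ((norm2 s ^+ 2 + norm2 t ^+ 2) / 2)).

Definition intop b f : euclid R d -> R :=
  fun s => \int[gauss b d]_t (K s t * f t).

Definition radial f := forall s t, norm2 s = norm2 t -> f s = f t.
Definition even_fun f := forall s, f (topp s) = f s.

(* Elements of L^2 are represented by square-integrable functions, up to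
   almost-everywhere equality. *)
Definition radial_L2 b : set (euclid R d -> R) :=
  [set f | f \in Lfun (gauss b d) 2%:E /\
     exists g, [/\ g \in Lfun (gauss b d) 2%:E,
       (if d == 1 then even_fun g else radial g) & f = g %[ae gauss b d]]].

Definition radial_eigenvalue b lambda :=
  lambda != 0 /\
  exists f, [/\ radial_L2 b f, ~ (f = cst 0 %[ae gauss b d]) &
    intop b f = (fun s => lambda * f s) %[ae gauss b d]].

Lemma normr_K_le s t : `|K s t| <= 4.
Proof.
rewrite /K !norm2_sqr.
have := normr_dot_le s t.
set x := dot s t; set y := (_ / 2) => xy.
have y0 : 0 <= y by rewrite (le_trans _ xy).
have E0 : 0 < expR y by exact: expR_gt0.
have E1 : 1 + y <= expR y by exact: expR_ge1Dx.
have E2 : 1 + y ^+ 2 / 2 <= expR y by exact: (expR_ge1Dxn 1 y0).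
have h1 : expR (- (dot (tsub s t) (tsub s t) / 2)) <= 1.
  by rewrite -[leRHS]expR0 ler_expR oppr_le0 mulr_ge0// dot_ge0.
have h0 := expR_ge0 (- (dot (tsub s t) (tsub s t) / 2)).
have h2 : `|(1 + x + x ^+ 2 / 2) * expR (- y)| <= 3.
  have Ei : 0 <= (expR y)^-1 by rewrite invr_ge0 expR_ge0.
  rewrite normrM expRN (ger0_norm Ei).
  rewrite ler_pdivrMr//.
  have x2 : x ^+ 2 <= y ^+ 2 by rewrite -real_normK ?num_real// lerXn2r// nnegrE.
  have x20 := sqr_ge0 x.
  move: xy; rewrite !ler_norml => /andP[? ?].
  by apply/andP; split; lra.
move: h2; rewrite !ler_norml => /andP[? ?].
by apply/andP; split; lra.
Qed.

Lemma measurable_dot d' (T : measurableType d') (u v : T -> euclid R d) :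
  measurable_fun setT u -> measurable_fun setT v ->
  measurable_fun setT (fun x => dot (u x) (v x)).
Proof.
move=> mu mv; apply: measurable_sum => i; apply: measurable_funM.
  by apply: (measurableT_comp (measurable_tnth i)).
by apply: (measurableT_comp (measurable_tnth i)).
Qed.

Lemma measurable_K : measurable_fun setT (fun p => K p.1 p.2).
Proof.
rewrite /K; under eq_fun do rewrite !norm2_sqr.
have m1 := @measurable_dot _ (euclid R d * euclid R d)%type fst snd
  measurable_fst measurable_snd.
have m2 := @measurable_dot _ (euclid R d * euclid R d)%type fst fst
  measurable_fst measurable_fst.
have m3 := @measurable_dot _ (euclid R d * euclid R d)%type snd snd
  measurable_snd measurable_snd.
apply: measurable_funB.
  apply: measurableT_comp => //; apply: measurableT_comp => //.
  apply: measurable_funM => //; apply: measurable_dot.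
    apply/measurable_fun_tnthP => i.
    rewrite (_ : _ \o _ = fun p : euclid R d * euclid R d =>
      (tnth p.1 i : R) - (tnth p.2 i : R)).
      by apply: measurable_funB; apply: (measurableT_comp (measurable_tnth i)).
    by apply/funext => p /=; rewrite tnth_mktuple.
  apply/measurable_fun_tnthP => i.
  rewrite (_ : _ \o _ = fun p : euclid R d * euclid R d =>
      (tnth p.1 i : R) - (tnth p.2 i : R)).
    by apply: measurable_funB; apply: (measurableT_comp (measurable_tnth i)).
  by apply/funext => p /=; rewrite tnth_mktuple.
apply: measurable_funM.
  apply: measurable_funD; first by apply: measurable_funD.
  by apply: measurable_funM => //; apply: measurable_funX.
apply: measurableT_comp => //; apply: measurableT_comp => //.
by apply: measurable_funM => //; apply: measurable_funD.
Qed.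

Lemma integrable_K_mul b f s : f \in Lfun (gauss b d) 2%:E ->
  (gauss b d).-integrable setT (fun t => (K s t * f t)%:E).
Proof.
move=> fL2.
have fin : gauss b d setT \is a fin_num by rewrite probability_setT.
have /Lfun1_integrable fi := Lfun_subset12 fin fL2.
have mf : measurable_fun setT f.
  by move: fL2; rewrite inE => /andP[/[!inE]].
have f4 : (gauss b d).-integrable setT (fun t => (4 * `|f t|)%:E).
  apply: (eq_integrable measurableT (fun t => 4%:E * `|(f t)%:E|)%E) => //.
  exact/integrableZl/integrable_abse.
apply: le_integrable f4 => //.
  apply/measurable_EFinP; apply: measurable_funM => //.
  exact: (measurableT_comp measurable_K (pair1_measurable s)).
move=> t _; rewrite lee_fin normrM [leRHS]ger0_norm ?mulr_ge0//.
by rewrite ler_wpM2r// normr_K_le.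
Qed.

(* The next two lemmas make intop a well-defined operator on L^2. *)
Lemma intop_ae_eq b f g :
  f \in Lfun (gauss b d) 2%:E -> g \in Lfun (gauss b d) 2%:E ->
  f = g %[ae gauss b d] -> intop b f = intop b g.
Proof.
move=> fL2 gL2 fg; apply/funext => s; congr fine; apply: ae_eq_integral => //.
- exact: measurable_int (integrable_K_mul s fL2).
- exact: measurable_int (integrable_K_mul s gL2).
- by apply: filterS fg => t /= h /h ->.
Qed.

Lemma intop_Lfun2 b f :
  f \in Lfun (gauss b d) 2%:E -> intop b f \in Lfun (gauss b d) 2%:E.
Proof.
move=> fL2.
have fin : gauss b d setT \is a fin_num by rewrite probability_setT.
have /Lfun1_integrable fi := Lfun_subset12 fin fL2.
have mf : measurable_fun setT f.
  by move: fL2; rewrite inE => /andP[/[!inE]].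
pose M : R := \int[gauss b d]_t (4 * `|f t|).
have f4 : (gauss b d).-integrable setT (fun t => (4 * `|f t|)%:E).
  apply: (eq_integrable measurableT (fun t => 4%:E * `|(f t)%:E|)%E) => //.
  exact/integrableZl/integrable_abse.
have M0 : 0 <= M by apply: Rintegral_ge0 => t _; rewrite mulr_ge0.
have bnd s : `|intop b f s| <= M.
  rewrite (le_trans (le_normr_Rintegral _ _))//; first exact: integrable_K_mul.
  apply: le_Rintegral => //.
    exact: (integrable_abse (integrable_K_mul s fL2)).
  by move=> t _; rewrite normrM ler_wpM2r// normr_K_le.
have mKf : measurable_fun setT
    (fun p : euclid R d * euclid R d => (K p.1 p.2 * f p.2)%:E).
  apply/measurable_EFinP; apply: measurable_funM; first exact: measurable_K.
  exact: measurableT_comp.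
have iKf : (gauss b d \x gauss b d)%E.-integrable setT
    (fun p : euclid R d * euclid R d => (K p.1 p.2 * f p.2)%:E).
  apply/integrable12ltyP => //=.
  apply: (@le_lt_trans _ _ (\int[gauss b d]_s M%:E)%E); last first.
    by rewrite integral_cst//= (probability_setT (gauss b d)) mule1 ltry.
  apply: ge0_le_integral => //.
  - by move=> s _; apply: integral_ge0.
  - apply: (measurable_fun_fubini_tonelli_F
      (fun p : euclid R d * euclid R d => `|(K p.1 p.2 * f p.2)%:E|%E)) => //.
    exact: measurableT_comp.
  - move=> s _; rewrite /M /Rintegral fineK; last exact: integrable_fin_num.
    apply: ge0_le_integral => //.
    + exact: (measurable_int (gauss b d)
        (integrable_abse (integrable_K_mul s fL2))).
    + exact: (measurable_int (gauss b d) f4).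
    + by move=> t _; rewrite lee_fin normrM ler_wpM2r// normr_K_le.
have mA : measurable_fun setT (intop b f).
  apply: (measurableT_comp (fine_measurable measurableT)).
  exact: (measurable_fubini_F iKf).
rewrite inE; apply/andP; split; rewrite inE//= /finite_norm unlock poweR_lty//.
apply: (@le_lt_trans _ _ (\int[gauss b d]_s (M `^ 2)%:E)%E); last first.
  by rewrite integral_cst//= (probability_setT (gauss b d)) mule1 ltry.
apply: ge0_le_integral => //.
- by move=> s _; rewrite lee_fin powR_ge0.
- apply/measurable_EFinP.
  apply: (measurableT_comp (measurable_powR _)) => //.
  exact: measurableT_comp.
- by move=> s _; rewrite lee_fin ge0_ler_powR// nnegrE.
Qed.

End operator.

Arguments radial_eigenvalue {R} d b lambda.

Definition Omega {R : realType} (b : R) : R := Num.sqrt (1 + 4 * b ^+ 2).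
Definition q {R : realType} (b : R) : R := (Omega b - 1) / (Omega b + 1).
Definition rho {R : realType} (b : R) : R := q b ^+ 2.
Definition c_beta {R : realType} (d : nat) (b : R) : R := (1 - q b) ^+ d.

(* Main.v *)
Require Import Defs.
From HB Require Import structures.
From mathcomp Require Import all_boot all_order all_algebra.
From mathcomp Require Import all_classical all_reals all_analysis.
From mathcomp Require Import measurable_realfun ring lra.

(* Write G for the operator with kernel exp(-|s-t|^2/2), so that A = G - P where
   P >= 0 has the kernel (1 + st + (st)^2/2) exp(-(|s|^2+|t|^2)/2).  By Mehler's
   formula G maps the generating function of the radial (Laguerre)
   eigenfunctions l_n at z to c times the same function at rho z, hence
   G l_n = c rho^n l_n.

   Existence.  Let f = sum_(n <> m) (n-m) rho^n / (rho^n - rho^m) l_n + f_m l_m.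
   Then G f - c rho^m f = c sum_n (n-m) rho^n l_n, which is of the form
   (x + y |s|^2) exp(-|s|^2/2).  As the kernel of A is O(|s|^3), this f is an
   eigenfunction of A as soon as f(s) = O(|s|^4).  The constant f_m achieves
   f(0) = 0, and the Laplacian of f at 0 vanishes if and only if
     sum_(n <> m) p_n (n-m)^2 rho^n / (rho^n - rho^m) = 0, where p_n = (d/2)_n / n!.
   For m > 0 this equation in rho has a root by the intermediate value theorem.

   Nonexistence.  The ground state w of G is positive, so Schur's test gives
   <G f, f> <= c |f|^2, with equality only for multiples of w.  If A f = c f then
   c |f|^2 = <G f, f> - <P f, f> forces f = k w and <f, exp(-|s|^2/2)> = 0, so
   that k = 0. *)

Set Implicit Arguments.
Unset Strict Implicit.
Unset Printing Implicit Defensive.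

Import Order.TTheory GRing.Theory Num.Theory.
Import numFieldNormedType.Exports.
Local Open Scope classical_set_scope.
Local Open Scope ring_scope.

(** The origin of f: up to a constant, exp(-|s|^2/2) is the generating function of the l_n at z =
    rho. Applying z d/dz - m there multiplies it by a polynomial of degree one in |s|^2, and gives
    sum_n (n-m) rho^n l_n. The factor n - m removes the component of degree m, as it must, since G -
    c rho^m annihilates l_m; dividing by rho^n - rho^m degree by degree then yields f up to the free
    f_m. Two conditions at the origin thus meet two parameters, f_m and rho. In the equation for rho
    the terms n < m are positive and the terms n > m negative; for m = 0 only one sign occurs.

    The obstacle is the infinite sum over n > m. Its weights are expanded in geometric series in
    rho^(n-m), and the sum over n is carried out first: what remains is a series over k of truncated
    generating functions at z = rho^(k+1), known in closed form. All analysis then reduces to bounds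
    of the shape z^N times a polynomial in X = ga |s|^2, and to partial sums with errors
    O(rho^N). *)

Section calculus.
Context {R : realType}.
Implicit Types (r C z x h : R) (N n m : nat).

(** The mean value theorem in a form that can be iterated: every integration from 0 of a derivative
    bound gains one power of z. All Taylor remainders below are estimated this way. *)
Lemma is_derive_normr_le (D D' : R -> R) r C N :
  (forall z, 0 <= z <= r -> is_derive z 1 D (D' z)) -> D 0 = 0 ->
  (forall z, 0 <= z <= r -> `|D' z| <= C * z ^+ N) ->
  forall z, 0 <= z <= r -> `|D z| <= C * z ^+ N.+1.
Proof.
move=> dD D0 D'C z /andP[z0 zr].
have [->|zn0] := eqVneq z 0; first by rewrite D0 normr0 expr0n mulr0.
have zgt0 : 0 < z by rewrite lt_neqAle eq_sym zn0.
have dc x : 0 <= x <= z -> is_derive x 1 D (D' x).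
  by move=> /andP[x0 xz]; apply: dD; rewrite x0 (le_trans xz).
have [||c] := @MVT R D D' 0 z zgt0.
- by move=> x; rewrite in_itv/= => /andP[/ltW x0 /ltW xz]; apply: dc; rewrite x0.
- apply: derivable_within_continuous => x; rewrite in_itv/= => xz.
  by have [] := dc _ xz.
rewrite in_itv/= => /andP[c0 cz]; rewrite D0 !subr0 => ->.
rewrite normrM (ger0_norm z0) exprSr mulrA ler_wpM2r//.
have cr : 0 <= c <= r by rewrite (ltW c0) (le_trans (ltW cz)).
have C0 : 0 <= C.
  have := le_trans (normr_ge0 _) (D'C _ cr).
  by rewrite pmulr_lge0// exprn_gt0.
apply: (le_trans (D'C _ cr)).
by rewrite ler_wpM2l// lerXn2r// ?nnegrE ltW.
Qed.

Lemma is_derive_nondecreasing0 (D D' : R -> R) r :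
  (forall z, 0 <= z <= r -> is_derive z 1 D (D' z)) -> D 0 = 0 ->
  (forall z, 0 <= z <= r -> 0 <= D' z) ->
  forall z, 0 <= z <= r -> 0 <= D z.
Proof.
move=> dD D0 D'C z /andP[z0 zr].
have [->|zn0] := eqVneq z 0; first by rewrite D0.
have zgt0 : 0 < z by rewrite lt_neqAle eq_sym zn0.
have dc x : 0 <= x <= z -> is_derive x 1 D (D' x).
  by move=> /andP[x0 xz]; apply: dD; rewrite x0 (le_trans xz).
have [||c] := @MVT R D D' 0 z zgt0.
- by move=> x; rewrite in_itv/= => /andP[/ltW x0 /ltW xz]; apply: dc; rewrite x0.
- apply: derivable_within_continuous => x; rewrite in_itv/= => xz.
  by have [] := dc _ xz.
rewrite in_itv/= => /andP[c0 cz]; rewrite D0 !subr0 => ->.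
have cr : 0 <= c <= r by rewrite (ltW c0) (le_trans (ltW cz)).
by rewrite mulr_ge0// D'C.
Qed.

Lemma normr_le_linear_eq0 (x C h0 : R) : 0 < h0 ->
  (forall h, 0 < h <= h0 -> `|x| <= C * h) -> x = 0.
Proof.
move=> h00 H; apply/eqP; rewrite -normr_eq0 eq_le normr_ge0 andbT.
rewrite leNgt; apply/negP => x0.
have C0 : 0 < C.
  have := lt_le_trans x0 (H h0 _).
  by rewrite h00 lexx pmulr_lgt0//; apply.
have e0 : 0 < Num.min h0 (`|x| / (2 * C)) by rewrite lt_min h00 divr_gt0// mulr_gt0.
have := H (Num.min h0 (`|x| / (2 * C))).
rewrite e0 ge_min lexx /= => /(_ isT) le1.
have : C * Num.min h0 (`|x| / (2 * C)) <= C * (`|x| / (2 * C)).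
  by rewrite ler_wpM2l ?(ltW C0)// ge_min lexx orbT.
have -> : C * (`|x| / (2 * C)) = `|x| / 2 by field; rewrite gt_eqF.
by move=> le2; have := le_trans le1 le2; lra.
Qed.

(** Uniqueness of Taylor coefficients from one side of 0: the constant term is O(h), hence zero, and
    dividing by h lowers the degree. *)
Lemma poly_small_eq0 (h0 : R) N (d : nat -> R) C : 0 < h0 ->
  (forall h, 0 < h <= h0 -> `|\sum_(n < N) d n * h ^+ n| <= C * h ^+ N) ->
  forall n, (n < N)%N -> d n = 0.
Proof.
move=> h00; elim: N d C => [//|N IH] d C H.
have C0 : 0 <= C.
  have := le_trans (normr_ge0 _) (H h0 _).
  by rewrite h00 lexx pmulr_lge0 ?exprn_gt0//; apply.
have d0 : d 0%N = 0.
  apply: (@normr_le_linear_eq0 _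
    (C * h0 ^+ N + \sum_(n < N) `|d n.+1| * h0 ^+ n) _ h00).
  move=> h /andP[hp hh].
  have := H h; rewrite hp hh => /(_ isT); rewrite big_ord_recl expr0 mulr1 => Hh.
  have -> : d 0%N = (d 0%N + \sum_(i < N) d (lift ord0 i) * h ^+ (lift ord0 i)) -
      h * \sum_(n < N) d n.+1 * h ^+ n.
    rewrite mulr_sumr -addrA -sumrB big1 ?addr0// => i _.
    by rewrite /= /bump/= add1n exprS; ring.
  apply: (le_trans (ler_normB _ _)); rewrite mulrDl; apply: lerD.
    apply: (le_trans Hh); rewrite exprSr mulrA ler_wpM2r ?(ltW hp)//.
    by rewrite ler_wpM2l// lerXn2r// nnegrE ltW.
  rewrite normrM (gtr0_norm hp) [leRHS]mulrC ler_wpM2l ?(ltW hp)//.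
  apply: (le_trans (ler_norm_sum _ _ _)); apply: ler_sum => i _.
  rewrite normrM ler_wpM2l// ger0_norm ?exprn_ge0 ?(ltW hp)//.
  by rewrite lerXn2r// nnegrE ltW.
case=> [//|n]; rewrite ltnS => nN.
apply: (IH (fun n => d n.+1) C) => // h /andP[hp hh].
have := H h; rewrite hp hh => /(_ isT).
rewrite big_ord_recl d0 mul0r add0r.
under eq_bigr do rewrite /= /bump/= add1n exprS mulrCA.
rewrite -mulr_sumr exprS mulrCA normrM (gtr0_norm hp).
by rewrite ler_pM2l.
Qed.

(** (e (1 + x))^N / N! is a single term of the series of exp(e (1 + x)); hence the constant N!
    e^(-N) exp(e). *)
Lemma expr1D_le_expR N (e : R) : 0 < e ->
  exists2 C, 0 <= C & forall x, 0 <= x -> (1 + x) ^+ N <= C * expR (e * x).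
Proof.
move=> e0; exists (N`!%:R / e ^+ N * expR e).
  by rewrite !mulr_ge0 ?invr_ge0 ?exprn_ge0 ?expR_ge0// ltW.
move=> x x0; rewrite -[leRHS]mulrA -expRD.
have -> : e + e * x = e * (1 + x) by ring.
set y := 1 + x; have y0 : 0 <= e * y by rewrite mulr_ge0 ?(ltW e0)// addr_ge0.
have := exp_coeff_ge0 N y0; rewrite /exp_coeff /=.
have h : (e * y) ^+ N / N`!%:R <= expR (e * y).
  case: N => [|N]; first by rewrite expr0 fact0 divr1 -expR0 ler_expR.
  by apply: le_trans (expR_ge1Dxn N y0); rewrite lerDr.
move=> _; rewrite mulrAC ler_pdivlMr ?exprn_gt0// mulrC -exprMn.
rewrite -ler_pdivrMl ?ltr0n ?fact_gt0//.
by rewrite mulrC.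
Qed.

End calculus.

(** * Laguerre polynomials *)

Section laguerre.
Context {R : realType}.
Implicit Types (b z X r : R) (N n m : nat).

(* With b = alpha + 1, [lag n b] is the Laguerre polynomial L_n^(alpha) and
   [lagF b z X] = sum_n lag n b X * z^n is its generating function
   (1 - z)^-b exp (- X z / (1 - z)).  The recurrence defining [lag] is read off
   [is_derive_lagF]. *)
Definition lagF b z X : R := expR (- b * ln (1 - z) - X * (z / (1 - z))).

Fixpoint lag n b X : R :=
  if n is n'.+1 then (b * lag n' (b + 1) X - X * lag n' (b + 2) X) / n'.+1%:R
  else 1.

Definition lagF_rem N b z X := lagF b z X - \sum_(n < N) lag n b X * z ^+ n.

(** The z-derivative of [lagF], with the powers of 1/(1 - z) absorbed by raising [b]. The family in
    [b] is thus closed under differentiation, so the estimates are inductions on the order for all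
    [b] at once. *)
Definition lagF' b z X := b * lagF (b + 1) z X - X * lagF (b + 2) z X.

(* The terms of order > m in z of (z d/dz - m) lagF. *)
Definition lagU m b z X :=
  z * lagF' b z X - m%:R * lagF b z X -
  \sum_(n < m) (n%:R - m%:R) * lag n b X * z ^+ n.

Lemma lagF0 b X : lagF b 0 X = 1.
Proof. by rewrite /lagF subr0 ln1 mulr0 mul0r mulr0 subr0 expR0. Qed.

Lemma lagF_gt0 b z X : 0 < lagF b z X.
Proof. exact: expR_gt0. Qed.

Lemma lagFS b z X : z < 1 -> lagF (b + 1) z X = lagF b z X / (1 - z).
Proof.
move=> z1; have z1' : 0 < 1 - z by rewrite subr_gt0.
rewrite /lagF; have -> : - (b + 1) * ln (1 - z) - X * (z / (1 - z)) =
  (- b * ln (1 - z) - X * (z / (1 - z))) - ln (1 - z) by ring.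
by rewrite expRD expRN lnK.
Qed.

Lemma lagFSS b z X : z < 1 -> lagF (b + 2) z X = lagF b z X / (1 - z) ^+ 2.
Proof.
move=> z1; have -> : b + 2 = b + 1 + 1 by ring.
by rewrite !lagFS// expr2 invfM mulrA.
Qed.

Lemma is_derive_lagF b z X : z < 1 -> is_derive z 1 (lagF b ^~ X) (lagF' b z X).
Proof.
move=> z1; have z1' : 0 < 1 - z by rewrite subr_gt0.
have z1'' : 1 - z != 0 by rewrite gt_eqF.
have d1 : is_derive z 1 (fun z : R => 1 - z) (-1).
  by apply: is_derive_eq; rewrite /GRing.scale/=; ring.
have d2 : is_derive z 1 (fun z : R => ln (1 - z)) (- (1 - z)^-1).
  have := @is_derive1_comp R (@ln R) (fun z => 1 - z) z _ _ (is_derive1_ln z1') d1.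
  by move=> h; apply: (is_derive_eq h); rewrite /GRing.scale/=; ring.
have d3 : is_derive z 1 (fun z : R => (1 - z)^-1) ((1 - z) ^- 2).
  have := @is_deriveV R (fun z => 1 - z) z _ _ z1'' d1.
  by move=> h; apply: (is_derive_eq h); rewrite /GRing.scale/=; field.
rewrite /lagF /lagF' lagFS// lagFSS//.
have d4 : is_derive z 1 (fun z : R => - b * ln (1 - z) - X * (z / (1 - z)))
   (b / (1 - z) - X / (1 - z) ^+ 2).
  apply: is_derive_eq; rewrite /GRing.scale/=; field.
  done.
have := @is_derive1_comp R (@expR R) _ z _ _ (is_derive_expR _) d4.
move=> h; apply: (is_derive_eq h).
by rewrite /lagF /GRing.scale/=; ring.
Qed.

Lemma is_derive_lagF_X b z X : z < 1 ->
  is_derive X 1 (lagF b z) (- z * lagF (b + 1) z X).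
Proof.
move=> z1; rewrite lagFS//.
have d4 : is_derive X 1 (fun X : R => - b * ln (1 - z) - X * (z / (1 - z)))
   (- (z / (1 - z))).
  by apply: is_derive_eq; rewrite /GRing.scale/=; ring.
have := @is_derive1_comp R (@expR R) _ X _ _ (is_derive_expR _) d4.
move=> h; apply: (is_derive_eq h).
by rewrite /lagF /GRing.scale/=; ring.
Qed.

Lemma is_derive_sum_expr (c : nat -> R) N z :
  is_derive z 1 (fun z => \sum_(n < N.+1) c n * z ^+ n)
    (\sum_(n < N) n.+1%:R * c n.+1 * z ^+ n).
Proof.
elim: N => [|N IH].
  rewrite big_ord0 (_ : (fun _ => _) = cst (c 0%N)); first exact: is_derive_cst.
  by apply/funext => y; rewrite big_ord1 expr0 mulr1.
rewrite (_ : (fun _ => _) = (fun z => \sum_(n < N.+1) c n * z ^+ n) \+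
  (fun z => c N.+1 * z ^+ N.+1)); last first.
  by apply/funext => y; rewrite big_ord_recr.
rewrite big_ord_recr /=; apply: is_deriveD.
have h := is_deriveZ (c N.+1) (is_deriveX N.+1 (is_derive_id z (1 : R))).
rewrite (_ : (fun _ => _) = c N.+1 \*: (@id R ^+ N.+1)).
  by apply: (is_derive_eq h); rewrite /GRing.scale /=; ring.
by apply/funext => y /=; rewrite exprfctE.
Qed.

Lemma lagS n b X :
  n.+1%:R * lag n.+1 b X = b * lag n (b + 1) X - X * lag n (b + 2) X.
Proof. by rewrite /= mulrC divfK// pnatr_eq0. Qed.

Lemma is_derive_lagF_rem N b z X : z < 1 ->
  is_derive z 1 (lagF_rem N.+1 b ^~ X)
    (b * lagF_rem N (b + 1) z X - X * lagF_rem N (b + 2) z X).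
Proof.
move=> z1; have := is_derive_lagF b X z1.
have := is_derive_sum_expr (fun n => lag n b X) N z => d2 d1.
have := is_deriveB d1 d2; move=> h; apply: (is_derive_eq h).
rewrite /lagF_rem /lagF'; under eq_bigr do rewrite lagS.
rewrite !mulrBr !mulr_sumr opprB.
rewrite [X in _ - X](_ : _ = \sum_(n < N) (b * (lag n (b + 1) X * z ^+ n)) -
  \sum_(n < N) X * (lag n (b + 2) X * z ^+ n)); first by ring.
by rewrite -sumrB; apply: eq_bigr => i _; ring.
Qed.

Lemma lagF_le r b z X : 0 <= b -> r < 1 -> 0 <= z <= r -> 0 <= X ->
  lagF b z X <= lagF b r 0.
Proof.
move=> b0 r1 /andP[z0 zr] X0; rewrite /lagF ler_expR mul0r subr0.
have z1' : 0 < 1 - z by rewrite subr_gt0 (le_lt_trans zr).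
have r1' : 0 < 1 - r by rewrite subr_gt0.
rewrite lerBlDr -[leLHS]addr0 lerD//; last by rewrite mulr_ge0// divr_ge0// ltW.
rewrite !mulNr lerN2 ler_wpM2l// ler_ln ?posrE//.
by rewrite lerD2l lerN2.
Qed.

(** One step of the recurrence costs one power of 1 + X. The factor Z carries a power of z through
    the step. *)
Lemma normr_lag_rec_le (b X C1 C2 Z a1 a2 : R) N : 0 <= b -> 0 <= X -> 0 <= Z -> 0 <= C1 ->
  `|a1| <= C1 * Z * (1 + X) ^+ N -> `|a2| <= C2 * Z * (1 + X) ^+ N ->
  `|b * a1 - X * a2| <= (b * C1 + C2) * Z * (1 + X) ^+ N.+1.
Proof.
move=> b0 X0 Z0 C10 h1 h2; rewrite (le_trans (ler_normB _ _))//.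
rewrite !normrM (ger0_norm b0) (ger0_norm X0).
have X1 : 0 <= (1 + X) ^+ N by rewrite exprn_ge0// addr_ge0.
apply: (@le_trans _ _ (b * (C1 * Z * (1 + X) ^+ N) + X * (C2 * Z * (1 + X) ^+ N))).
  by apply: lerD; apply: ler_wpM2l.
have h3 : 0 <= C2 * Z * (1 + X) ^+ N by rewrite (le_trans _ h2).
rewrite exprS -subr_ge0.
have -> : (b * C1 + C2) * Z * ((1 + X) * (1 + X) ^+ N) -
  (b * (C1 * Z * (1 + X) ^+ N) + X * (C2 * Z * (1 + X) ^+ N)) =
  C2 * Z * (1 + X) ^+ N + b * X * (C1 * Z * (1 + X) ^+ N) by ring.
by rewrite addr_ge0// !mulr_ge0.
Qed.

(** The z-derivative of the remainder of order N + 1 is the recurrence applied to remainders of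
    order N at [b + 1] and [b + 2]; each integration gains a factor z and each recurrence step a
    factor 1 + X. *)
Lemma lagF_rem_le N r b : 0 <= b -> 0 < r < 1 ->
  exists2 C, 0 <= C & forall z X, 0 <= z <= r -> 0 <= X ->
    `|lagF_rem N b z X| <= C * z ^+ N * (1 + X) ^+ N.
Proof.
move=> b0 /andP[r0 r1]; elim: N b b0 => [|N IH] b b0.
  exists (lagF b r 0); first by rewrite ltW ?lagF_gt0.
  move=> z X zr X0; rewrite /lagF_rem big_ord0 subr0 !expr0 !mulr1.
  by rewrite gtr0_norm ?lagF_gt0// lagF_le.
have [C1 C10 h1] := IH (b + 1) (addr_ge0 b0 ler01).
have [C2 C20 h2] := IH (b + 2) (addr_ge0 b0 (ler0n _ 2)).
exists (b * C1 + C2); first by rewrite addr_ge0// mulr_ge0.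
move=> z X zr X0; rewrite mulrAC.
apply: (@is_derive_normr_le _ (lagF_rem N.+1 b ^~ X) (fun z =>
  b * lagF_rem N (b + 1) z X - X * lagF_rem N (b + 2) z X) r _ _ _ _ _ _ zr).
- by move=> y /andP[y0 yr]; apply: is_derive_lagF_rem; apply: le_lt_trans r1.
- rewrite /lagF_rem lagF0 big_ord_recl big1 ?addr0 ?mulr1 ?subrr// => i _.
  by rewrite /= /bump /= add1n expr0n mulr0.
- move=> y yr; rewrite mulrAC; have /andP[y0 _] := yr.
  by apply: normr_lag_rec_le; rewrite ?exprn_ge0//; [apply: h1|apply: h2].
Qed.

Lemma is_derive_lagF' b z X : z < 1 ->
  is_derive z 1 (lagF' b ^~ X)
    (b * lagF' (b + 1) z X - X * lagF' (b + 2) z X).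
Proof.
move=> z1.
have d1 := is_derive_lagF (b + 1) X z1.
have d2 := is_derive_lagF (b + 2) X z1.
by have := is_deriveB (is_deriveZ b d1) (is_deriveZ X d2).
Qed.

(** From d/dz (z d/dz - (m + 1)) = (z d/dz - m) d/dz: differentiation lowers m by one. *)
Lemma is_derive_lagU m b z X : z < 1 ->
  is_derive z 1 (lagU m.+1 b ^~ X)
    (b * lagU m (b + 1) z X - X * lagU m (b + 2) z X).
Proof.
move=> z1; have d1 := is_derive_lagF b X z1.
have d2 := is_derive_lagF' b X z1.
have d3 := is_derive_sum_expr (fun n => (n%:R - m.+1%:R) * lag n b X) m z.
have d4 := is_deriveB (is_deriveB (is_deriveM (is_derive_id z 1) d2)
   (is_deriveZ m.+1%:R d1)) d3.
apply: (is_derive_eq d4); rewrite /GRing.scale /= /lagU.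
under eq_bigr do rewrite mulrCA lagS.
rewrite [X in _ - X](_ : _ =
  b * \sum_(n < m) (n%:R - m%:R) * lag n (b + 1) X * z ^+ n -
  X * \sum_(n < m) (n%:R - m%:R) * lag n (b + 2) X * z ^+ n).
  by rewrite /lagF'; ring.
rewrite !mulr_sumr -sumrB; apply: eq_bigr => i _.
by rewrite -!natr1; ring.
Qed.

Lemma lagU0 m b X : lagU m b 0 X = 0.
Proof.
rewrite /lagU lagF0 mul0r; case: m => [|m]; first by rewrite big_ord0; ring.
rewrite big_ord_recl big1 ?addr0 => [|i _]; first by rewrite /=; ring.
by rewrite /= /bump /= add1n expr0n mulr0.
Qed.

Lemma lagU_le m r b : 0 <= b -> 0 < r < 1 ->
  exists2 C, 0 <= C & forall z X, 0 <= z <= r -> 0 <= X ->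
    `|lagU m b z X| <= C * z ^+ m.+1 * (1 + X) ^+ m.+1.
Proof.
move=> b0 /andP[r0 r1]; elim: m b b0 => [|m IH] b b0.
  exists (b * lagF (b + 1) r 0 + lagF (b + 2) r 0).
    by rewrite addr_ge0// ?mulr_ge0// ltW// lagF_gt0.
  move=> z X zr X0; have /andP[z0 _] := zr.
  rewrite /lagU big_ord0 mul0r !subr0 normrM ger0_norm// mulrAC mulrC.
  rewrite ler_wpM2r// -[X in X * _]mulr1.
  apply: normr_lag_rec_le; rewrite ?expr0 ?mulr1// ?(ltW (lagF_gt0 _ _ _))//.
    by rewrite gtr0_norm ?lagF_gt0// lagF_le// addr_ge0.
  by rewrite gtr0_norm ?lagF_gt0// lagF_le// addr_ge0.
have [C1 C10 h1] := IH (b + 1) (addr_ge0 b0 ler01).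
have [C2 C20 h2] := IH (b + 2) (addr_ge0 b0 (ler0n _ 2)).
exists (b * C1 + C2); first by rewrite addr_ge0// mulr_ge0.
move=> z X zr X0; rewrite mulrAC.
apply: (@is_derive_normr_le _ (lagU m.+1 b ^~ X) (fun z =>
  b * lagU m (b + 1) z X - X * lagU m (b + 2) z X) r _ _ _ _ _ _ zr).
- by move=> y /andP[y0 yr]; apply: is_derive_lagU; apply: le_lt_trans r1.
- exact: lagU0.
- move=> y yr; rewrite mulrAC; have /andP[y0 _] := yr.
  by apply: normr_lag_rec_le; rewrite ?exprn_ge0//; [apply: h1|apply: h2].
Qed.

End laguerre.

(** * First-order expansions in X at the origin *)

Section laguerre_jet.
Context {R : realType}.
Implicit Types (b z X r : R) (N n m : nat).

(** The coefficients of z^(n+1) in (1 - z) [lagF (b + 1)] = [lagF b]. *)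
Lemma lag_pascal n b X : lag n.+1 (b + 1) X = lag n.+1 b X + lag n (b + 1) X.
Proof.
elim: n b => [|n IH] b; first by rewrite /= !divr1; ring.
apply: (mulfI (_ : n.+2%:R != 0 :> R)); first by rewrite pnatr_eq0.
rewrite mulrDr !lagS.
have e2 : b + 1 + 1 = b + 2 by ring.
have e3 : b + 2 + 1 = b + 1 + 2 by ring.
have := IH (b + 2); have := IH (b + 1); rewrite e2 e3 => -> ->.
have := lagS n (b + 1) X; rewrite e2.
set l1 := lag n.+1 (b + 1) X; set m2 := lag n (b + 2) X.
set m3 := lag n (b + 1 + 2) X => h.
rewrite -(natr1 n.+1) (mulrDl _ _ l1) h; ring.
Qed.

(** The X-derivative of [lag], read off d/dX [lagF b] = - z [lagF (b + 1)]. *)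
Definition lag' n b X : R := if n is n'.+1 then - lag n' (b + 1) X else 0.

Lemma is_derive_lag n b X : is_derive X 1 (lag n b) (lag' n b X).
Proof.
elim: n b => [|n IH] b; first exact: is_derive_cst.
have d1 := IH (b + 1); have d2 := IH (b + 2).
have d3 := is_deriveZ (n.+1%:R^-1)
  (is_deriveB (is_deriveZ b d1) (is_deriveM (is_derive_id X 1) d2)).
rewrite (_ : lag n.+1 b = n.+1%:R^-1 \*: ((b \*: lag n (b + 1)) -
  (@id R * lag n (b + 2)))); last first.
  by apply/funext => y /=; rewrite /GRing.scale /= mulrC.
apply: (is_derive_eq d3); rewrite /GRing.scale /=.
apply: (mulfI (_ : n.+1%:R != 0 :> R)); first by rewrite pnatr_eq0.
rewrite mulVKf ?pnatr_eq0//.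
case: n {IH d1 d2 d3} => [|n]; first by rewrite /=; ring.
have e2 : b + 1 + 1 = b + 2 by ring.
have e3 : b + 2 + 1 = b + 1 + 2 by ring.
have := lag_pascal n (b + 1) X; rewrite e2 => h.
have := lagS n (b + 1) X; rewrite e2 => h'.
rewrite /lag' e2 e3 h -(natr1 n.+1) (mulrDl _ _ (- _)) !mulrN h'; ring.
Qed.

Lemma is_derive_lagF'_X b z X : z < 1 ->
  is_derive X 1 (lagF' b z)
   (- z * b * lagF (b + 2) z X - lagF (b + 2) z X + X * z * lagF (b + 2 + 1) z X).
Proof.
move=> z1.
have d1 := is_derive_lagF_X (b + 1) X z1.
have d2 := is_derive_lagF_X (b + 2) X z1.
have d3 := is_deriveB (is_deriveZ b d1) (is_deriveM (is_derive_id X 1) d2).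
have e2 : b + 1 + 1 = b + 2 by ring.
by apply: (is_derive_eq d3); rewrite e2 /GRing.scale /=; ring.
Qed.

Lemma is_derive_sum_lag_X (c : nat -> R) m b z X :
  is_derive X 1 (fun X => \sum_(n < m) c n * lag n b X * z ^+ n)
    (\sum_(n < m) c n * lag' n b X * z ^+ n).
Proof.
elim: m => [|m IH].
  rewrite big_ord0 (_ : (fun _ => _) = cst 0); first exact: is_derive_cst.
  by apply/funext => y; rewrite big_ord0.
rewrite (_ : (fun _ => _) = (fun X => \sum_(n < m) c n * lag n b X * z ^+ n) \+
  ((c m * z ^+ m) \*: lag m b)); last first.
  by apply/funext => y; rewrite big_ord_recr /= /GRing.scale /=; ring.
rewrite big_ord_recr /=; apply: is_deriveD.
have h := is_deriveZ (c m * z ^+ m) (is_derive_lag m b X).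
by apply: (is_derive_eq h); rewrite /GRing.scale /=; ring.
Qed.

(** Differentiation in X brings out a factor - z and raises [b]; then (z d/dz - (m + 1)) z = z (z
    d/dz - m) lowers m. *)
Lemma is_derive_lagU_X m b z X : z < 1 ->
  is_derive X 1 (lagU m.+1 b z) (- z * lagU m (b + 1) z X).
Proof.
move=> z1; have d1 := is_derive_lagF_X b X z1.
have d2 := is_derive_lagF'_X b X z1.
have d3 := is_derive_sum_lag_X (fun n => n%:R - m.+1%:R) m.+1 b z X.
have d4 := is_deriveB (is_deriveB (is_deriveZ z d2)
   (is_deriveZ m.+1%:R d1)) d3.
apply: (is_derive_eq d4); rewrite /GRing.scale /= /lagU big_ord_recl.
rewrite [lag' (ord0 : 'I_m.+1) _ _]/= mulr0 mul0r add0r.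
under eq_bigr do rewrite /= /bump /= add1n.
rewrite [X in _ - X](_ : _ =
  - z * \sum_(n < m) (n%:R - m%:R) * lag n (b + 1) X * z ^+ n); last first.
  by rewrite mulr_sumr; apply: eq_bigr => i _; rewrite exprS -!natr1; ring.
have e2 : b + 1 + 1 = b + 2 by ring.
have e3 : b + 1 + 2 = b + 2 + 1 by ring.
rewrite /lagF' e2 e3 (lagFS (b + 2))// !lagFSS// lagFS//.
set S := \sum_(_ < _) _; rewrite -natr1; field.
by rewrite subr_eq0 gt_eqF.
Qed.

Lemma is_derive_lagU0_X b z X : z < 1 ->
  is_derive X 1 (lagU 0 b z) (z * (- z * b * lagF (b + 2) z X -
    lagF (b + 2) z X + X * z * lagF (b + 2 + 1) z X)).
Proof.
move=> z1; have d2 := is_deriveZ z (is_derive_lagF'_X b X z1).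
rewrite (_ : lagU 0 b z = z \*: lagF' b z)//.
by apply/funext => y; rewrite /lagU big_ord0 mul0r !subr0.
Qed.

Lemma is_derive_sub0 (f : R -> R) (f' c : R) (x : R) :
  is_derive x 1 f f' -> is_derive x 1 (fun x => f x - c) f'.
Proof.
by move=> h; have := is_deriveB h (is_derive_cst c x 1); rewrite subr0.
Qed.

Lemma lagU_lip m r b : 0 <= b -> 0 < r < 1 ->
  exists2 C, 0 <= C & forall z X, 0 <= z <= r -> 0 <= X <= 1 ->
    `|lagU m b z X - lagU m b z 0| <= C * z ^+ m.+1 * X.
Proof.
move=> b0 r01; have /andP[r0 r1] := r01; case: m => [|m].
  exists (b * lagF (b + 2) r 0 + lagF (b + 2) r 0 + lagF (b + 2 + 1) r 0).
    by rewrite !addr_ge0// ?mulr_ge0// ltW// lagF_gt0.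
  move=> z X zr X01; have /andP[z0 zr'] := zr.
  have z1 : z < 1 by apply: le_lt_trans r1.
  rewrite -{2}(expr1 X).
  apply: (@is_derive_normr_le _ (fun X => lagU 0 b z X - lagU 0 b z 0) (fun X =>
   z * (- z * b * lagF (b + 2) z X -
    lagF (b + 2) z X + X * z * lagF (b + 2 + 1) z X)) 1 _ 0%N _ _ _ _ X01).
  - by move=> Y _; apply: is_derive_sub0; apply: is_derive_lagU0_X.
  - by rewrite subrr.
  - move=> Y /andP[Y0 Y1]; rewrite expr0 expr1 mulr1 normrM (ger0_norm z0) mulrC.
    rewrite ler_wpM2r//.
    have h2 := @lagF_le R r (b + 2) z Y (addr_ge0 b0 (ler0n _ 2)) r1 zr Y0.
    have h3 := @lagF_le R r (b + 2 + 1) z Y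
      (addr_ge0 (addr_ge0 b0 (ler0n _ 2)) ler01) r1 zr Y0.
    have g2 := ltW (lagF_gt0 (b + 2) z Y).
    have g3 := ltW (lagF_gt0 (b + 2 + 1) z Y).
    apply: (le_trans (ler_normD _ _)); apply: lerD.
      apply: (le_trans (ler_normB _ _)); apply: lerD.
        rewrite !normrM normrN (ger0_norm z0) (ger0_norm b0) (ger0_norm g2).
        rewrite -mulrA -[leRHS]mul1r; apply: ler_pM; rewrite ?mulr_ge0// ?ler_wpM2l//.
        exact: ltW.
      by rewrite ger0_norm.
    rewrite !normrM (ger0_norm z0) (ger0_norm Y0) (ger0_norm g3).
    rewrite -[leRHS]mul1r; apply: ler_pM; rewrite ?mulr_ge0//.
    by rewrite mulr_ile1// ltW.
have [C C0 H] := lagU_le m (addr_ge0 b0 ler01) r01.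
exists (C * 2 ^+ m.+1); first by rewrite mulr_ge0 ?exprn_ge0.
move=> z X zr X01; have /andP[z0 zr'] := zr.
have z1 : z < 1 by apply: le_lt_trans r1.
rewrite -{2}(expr1 X).
apply: (@is_derive_normr_le _ (fun X => lagU m.+1 b z X - lagU m.+1 b z 0) (fun X =>
   - z * lagU m (b + 1) z X) 1 _ 0%N _ _ _ _ X01).
- by move=> Y _; apply: is_derive_sub0; apply: is_derive_lagU_X.
- by rewrite subrr.
- move=> Y /andP[Y0 Y1]; rewrite expr0 mulr1 normrM normrN (ger0_norm z0).
  rewrite [z ^+ _]exprS mulrCA ler_wpM2l// (le_trans (H _ _ zr Y0))//.
  rewrite mulrAC ler_wpM2r ?exprn_ge0// ler_wpM2l// lerXn2r// ?nnegrE ?addr_ge0//.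
  lra.
Qed.

(** The power z^(m+2) matters: [lagT] divides by z^(m+1) at z = r^(k+1), and the surplus factor z
    makes the errors summable over k. *)
Lemma lagU_jet m r b : 0 <= b -> 0 < r < 1 ->
  exists2 C, 0 <= C & forall z X, 0 <= z <= r -> 0 <= X <= 1 ->
    `|lagU m.+1 b z X - lagU m.+1 b z 0 + X * (z * lagU m (b + 1) z 0)|
      <= C * z ^+ m.+2 * X ^+ 2.
Proof.
move=> b0 r01; have /andP[r0 r1] := r01.
have [C C0 H] := lagU_lip m (addr_ge0 b0 ler01) r01.
exists C => // z X zr X01; have /andP[z0 zr'] := zr.
have z1 : z < 1 by apply: le_lt_trans r1.
apply: (@is_derive_normr_le _ (fun X => lagU m.+1 b z X - lagU m.+1 b z 0 +
    X * (z * lagU m (b + 1) z 0)) (fun X =>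
   - z * (lagU m (b + 1) z X - lagU m (b + 1) z 0)) 1 _ 1%N _ _ _ _ X01).
- move=> Y _.
  have d1 := is_derive_sub0 (lagU m.+1 b z 0) (is_derive_lagU_X m b Y z1).
  have d2 := is_deriveZ (z * lagU m (b + 1) z 0) (is_derive_id Y (1:R)).
  rewrite (_ : (fun _ => _) = (fun X => lagU m.+1 b z X - lagU m.+1 b z 0) \+
     ((z * lagU m (b + 1) z 0) \*: id)); last first.
    by apply/funext => y /=; rewrite /GRing.scale /= [y * _]mulrC.
  have d3 := is_deriveD d1 d2.
  by apply: (is_derive_eq d3); rewrite /GRing.scale /=; ring.
- by rewrite subrr mul0r addr0.
- move=> Y Y01; rewrite expr1 normrM normrN (ger0_norm z0).
  by rewrite [z ^+ _]exprS mulrCA -mulrA ler_wpM2l// H.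
Qed.

Lemma lag_lip n b : exists2 C, 0 <= C & forall X, 0 <= X <= 1 ->
  `|lag n b X - lag n b 0| <= C * X.
Proof.
have bd k c : exists2 C, 0 <= C & forall X, 0 <= X <= 1 -> `|lag k c X| <= C.
  elim: k c => [|k IH] c; first by exists 1 => // X _; rewrite normr1.
  have [C1 C10 H1] := IH (c + 1); have [C2 C20 H2] := IH (c + 2).
  exists ((`|c| * C1 + C2) / k.+1%:R).
    by rewrite divr_ge0 ?addr_ge0 ?mulr_ge0.
  move=> X X01; rewrite /= normrM (ger0_norm (_ : 0 <= k.+1%:R^-1)) ?invr_ge0//.
  rewrite ler_wpM2r ?invr_ge0//; apply: (le_trans (ler_normB _ _)).
  rewrite !normrM; apply: lerD; first by rewrite ler_wpM2l ?H1.
  have /andP[X0 X1] := X01; rewrite -[leRHS]mul1r.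
  by apply: ler_pM; rewrite ?H2// ger0_norm.
case: n => [|n].
  by exists 0 => // X _; rewrite /= subrr normr0 mul0r.
have [C C0 H] := bd n (b + 1).
exists C => // X X01; rewrite -{2}(expr1 X).
apply: (@is_derive_normr_le _ (fun X => lag n.+1 b X - lag n.+1 b 0)
  (lag' n.+1 b) 1 _ 0%N _ _ _ _ X01).
- by move=> Y _; apply: is_derive_sub0; apply: is_derive_lag.
- by rewrite subrr.
- by move=> Y Y01; rewrite expr0 mulr1 normrN H.
Qed.

Lemma lag_jet n b : exists2 C, 0 <= C & forall X, 0 <= X <= 1 ->
  `|lag n b X - lag n b 0 - X * lag' n b 0| <= C * X ^+ 2.
Proof.
have [C C0 H] : exists2 C, 0 <= C & forall X, 0 <= X <= 1 ->
    `|lag' n b X - lag' n b 0| <= C * X.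
  case: n => [|n]; first by exists 0 => // X _; rewrite /= subrr normr0 mul0r.
  have [C C0 H] := lag_lip n (b + 1); exists C => // X X01.
  by rewrite /lag' -opprD normrN H.
exists C => // X X01.
apply: (@is_derive_normr_le _ (fun X => lag n b X - lag n b 0 - X * lag' n b 0)
  (fun X => lag' n b X - lag' n b 0) 1 _ 1%N _ _ _ _ X01).
- move=> Y _.
  have d1 := is_derive_sub0 (lag n b 0) (is_derive_lag n b Y).
  have d2 := is_deriveZ (lag' n b 0) (is_derive_id Y (1:R)).
  rewrite (_ : (fun _ => _) = (fun X => lag n b X - lag n b 0) -
     ((lag' n b 0) \*: id)); last first.
    by apply/funext => y; rewrite /= [y * _]mulrC.
  have d3 := is_deriveB d1 d2.
  by apply: (is_derive_eq d3); rewrite /GRing.scale /=; ring.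
- by rewrite subrr mul0r subr0.
- by move=> Y Y01; rewrite expr1 H.
Qed.

End laguerre_jet.

(** * Solving the secular equation *)

Section geometric_sum.
Context {R : realType}.
Implicit Types (r C : R) (u : nat -> R).

Definition limsum u : R := limn (series u).

Lemma limsum_cvg u C r : 0 < r < 1 -> (forall k, `|u k| <= C * r ^+ k) ->
  cvgn (series u).
Proof.
move=> /andP[r0 r1] uC.
have C0 : 0 <= C by have := le_trans (normr_ge0 _) (uC 0%N); rewrite expr0 mulr1.
apply: normed_cvg; apply: (@series_le_cvg _ _ (geometric C r)).
- by move=> n; exact: normr_ge0.
- by move=> n /=; rewrite mulr_ge0// exprn_ge0// ltW.
- by move=> n; exact: uC.
- by apply: is_cvg_geometric_series; rewrite gtr0_norm.
Qed.

Lemma limsum_ge_head u C r : 0 < r < 1 -> (forall k, `|u k| <= C * r ^+ k) ->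
  (forall k, 0 <= u k) -> u 0%N <= limsum u.
Proof.
move=> r01 uC u0; have := limsum_cvg r01 uC.
have -> : u 0%N = series u 1 by rewrite /series /= big_nat1.
move=> cu; apply: nondecreasing_cvgn_le => //.
exact: nondecreasing_series.
Qed.

Lemma limsum_tail u C r : 0 < r < 1 -> (forall k, `|u k| <= C * r ^+ k) ->
  forall N, `|limsum u - \sum_(k < N) u k| <= C / (1 - r) * r ^+ N.
Proof.
move=> /andP[r0 r1] uC.
have r1' : 0 < 1 - r by rewrite subr_gt0.
have C0 : 0 <= C by have := le_trans (normr_ge0 _) (uC 0%N); rewrite expr0 mulr1.
have cu := limsum_cvg (introT andP (conj r0 r1)) uC.
(* On finite blocks the geometric bound telescopes; the limit j -> oo then costs an arbitrary e. *)
have tail N j : `|\sum_(k < N + j) u k - \sum_(k < N) u k| <=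
    C / (1 - r) * (r ^+ N - r ^+ (N + j)).
  elim: j => [|j IH]; first by rewrite addn0 !subrr normr0 mulr0.
  rewrite addnS big_ord_recr /= addrAC.
  apply: (le_trans (ler_normD _ _)); apply: (le_trans (lerD IH (uC _))).
  rewrite exprS -subr_ge0.
  set x := r ^+ (N + j); set y := r ^+ N.
  by rewrite (_ : _ - _ = 0)//; field; rewrite gt_eqF.
move=> N; apply/ler_addgt0Pr => e e0.
have /cvgrPdist_lt/(_ e e0) [M _ HM] := cu.
have := HM (N + M)%N (leq_addl _ _).
rewrite /series /= big_mkord => lt1.
have := tail N M => le2.
have -> : limsum u - \sum_(k < N) u k = (limsum u - \sum_(k < N + M) u k) +
  (\sum_(k < N + M) u k - \sum_(k < N) u k) by ring.
apply: (le_trans (ler_normD _ _)); rewrite [leRHS]addrC; apply: lerD.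
  exact: ltW.
apply: (le_trans le2); rewrite ler_wpM2l ?divr_ge0 ?(ltW r1')//.
by rewrite gerBl exprn_ge0 ?(ltW r0).
Qed.

(** A uniform limit of continuous functions; the uniformity is that [C * r ^+ N] does not involve
    x. *)
Lemma continuous_geometric_approx (u : nat -> R -> R) (S : R -> R) (a b C r : R) :
  0 < r < 1 -> (forall k, {within `[a, b], continuous (u k)}) ->
  (forall N x, a <= x <= b -> `|S x - \sum_(k < N) u k x| <= C * r ^+ N) ->
  {within `[a, b], continuous S}.
Proof.
move=> /andP[r0 r1] uc SC.
have cs N : {within `[a, b], continuous (fun x => \sum_(k < N) u k x)}.
  elim: N => [|N IH].
    rewrite (_ : (fun _ => _) = cst 0).
      by apply: continuous_subspaceT; exact: cst_continuous.
    by apply/funext => y; rewrite big_ord0.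
  rewrite (_ : (fun _ => _) = (fun x => \sum_(k < N) u k x) \+ u N); last first.
    by apply/funext => y; rewrite big_ord_recr.
  by move=> x; apply: continuousD; [exact: IH|exact: uc].
apply/subspace_continuousP => x /= xab; apply/cvgrPdist_lt => e e0.
have [N HN] : exists N, C * r ^+ N < e / 3.
  have : geometric C r n @[n --> \oo] --> 0.
    by apply: cvg_geometric; rewrite gtr0_norm.
  move=> /cvgrPdist_lt /(_ (e / 3)) []; first by rewrite divr_gt0.
  move=> N _ HN; exists N; have := HN N (leqnn _); rewrite /= sub0r normrN.
  by apply: le_lt_trans; exact: ler_norm.
have /subspace_continuousP /(_ x xab) /cvgrPdist_lt /(_ (e / 3)) := cs N.
rewrite divr_gt0// => /(_ isT) nt; near=> t.
  have tab : t \in `[a, b] by near: t; exact: withinT.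
  have lt1 : `|\sum_(k < N) u k x - \sum_(k < N) u k t| < e / 3.
    by near: t; exact: nt.
  move: xab tab; rewrite !in_itv/= => xab tab.
  have h1 := SC N x xab; have := SC N t tab; rewrite distrC => h2.
  have -> : S x - S t = (S x - \sum_(k < N) u k x) +
    (\sum_(k < N) u k x - \sum_(k < N) u k t) + (\sum_(k < N) u k t - S t) by ring.
  apply: (le_lt_trans (ler_normD _ _)).
  apply: (le_lt_trans (lerD (ler_normD _ _) (lexx _))).
  by lra.
Unshelve. all: by end_near. Qed.

End geometric_sum.

(** * The balance equation for rho and its root *)

Section balance.
Context {R : realType}.
Implicit Types (b z X r : R) (N n m : nat).

Lemma lag0_gt0 n b : 0 < b -> 0 < lag n b 0.
Proof.
elim: n b => [//|n IH] b b0 /=.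
by rewrite mul0r subr0 divr_gt0// mulr_gt0// IH// addr_gt0.
Qed.

(* The terms of order > m in z of (z d/dz - m)^2 (1 - z)^-b. *)
Definition lagE m b z : R :=
  z * (z * (b * (b + 1) * lagF (b + 2) z 0)) +
  (1 - 2 * m%:R) * (z * (b * lagF (b + 1) z 0)) +
  m%:R ^+ 2 * lagF b z 0 - \sum_(n < m) (n%:R - m%:R) ^+ 2 * lag n b 0 * z ^+ n.

Lemma lagE0 m b : lagE m b 0 = 0.
Proof.
rewrite /lagE !lagF0; case: m => [|m]; first by rewrite big_ord0; ring.
rewrite big_ord_recl big1 ?addr0 => [|i _]; first by rewrite /=; ring.
by rewrite /= /bump /= add1n expr0n mulr0.
Qed.

(** As for [lagU], d/dz (z d/dz - (m + 1))^2 = (z d/dz - m)^2 d/dz, and (1 - z)^(-b) has derivative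
    b (1 - z)^(-b - 1). *)
Lemma is_derive_lagE m b z : z < 1 ->
  is_derive z 1 (lagE m.+1 b) (b * lagE m (b + 1) z).
Proof.
move=> z1.
have d0 := is_derive_lagF b 0 z1.
have d1 := is_derive_lagF (b + 1) 0 z1.
have d2 := is_derive_lagF (b + 2) 0 z1.
have d3 := is_derive_sum_expr (fun n => (n%:R - m.+1%:R) ^+ 2 * lag n b 0) m z.
have di := is_derive_id z (1 : R).
have d4 := is_deriveM di (is_deriveM di (is_deriveZ (b * (b + 1)) d2)).
have d5 := is_deriveZ (1 - 2 * m.+1%:R) (is_deriveM di (is_deriveZ b d1)).
have d6 := is_deriveZ (m.+1%:R ^+ 2) d0.
have d7 := is_deriveB (is_deriveD (is_deriveD d4 d5) d6) d3.
apply: (is_derive_eq d7); rewrite /lagE /GRing.scale /=.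
rewrite [X in _ - X](_ : _ =
  b * \sum_(n < m) (n%:R - m%:R) ^+ 2 * lag n (b + 1) 0 * z ^+ n); last first.
  rewrite mulr_sumr; apply: eq_bigr => i _; rewrite mulrCA lagS mul0r subr0 -!natr1.
  by ring.
set S := \sum_(_ < _) _.
have e2 : b + 1 + 1 = b + 2 by ring.
have e3 : b + 1 + 2 = b + 2 + 1 by ring.
rewrite /lagF' !mul0r !subr0 e2 e3 -(natr1 m) {d0 d1 d2 d3 d4 d5 d6 d7}.
rewrite -[(id * _) z]/(z * (b * (b + 1) * lagF (b + 2) z 0)) /GRing.scale /=; ring.
Qed.

(** The Taylor coefficients (n - m)^2 [lag n b 0] are nonnegative. This is exploited by integrating
    [is_derive_lagE] up from m = 0, where each term of the closed form is nonnegative. *)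
Lemma lagE_ge0 m b z : 0 < b -> 0 <= z < 1 -> 0 <= lagE m b z.
Proof.
move=> b0 /andP[z0 z1]; elim: m b b0 z z0 z1 => [|m IH] b b0 z z0 z1.
  rewrite /lagE big_ord0 subr0 mulr0 subr0 mul1r expr0n mul0r addr0.
  have b1 := addr_ge0 (ltW b0) ler01.
  by rewrite addr_ge0// !mulr_ge0// ?(ltW b0)// (ltW (lagF_gt0 _ _ _)).
apply: (@is_derive_nondecreasing0 _ (lagE m.+1 b) (fun z => b * lagE m (b + 1) z) z).
- by move=> y /andP[y0 yz]; apply: is_derive_lagE; apply: le_lt_trans z1.
- exact: lagE0.
- move=> y /andP[y0 yz]; apply: mulr_ge0; first exact: ltW.
  by apply: IH => //; [rewrite addr_gt0|apply: le_lt_trans z1].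
- by rewrite z0 lexx.
Qed.

Lemma lagE_le m r b : 0 < b -> 0 < r < 1 ->
  exists2 C, 0 <= C & forall z, 0 <= z <= r -> `|lagE m b z| <= C * z ^+ m.+1.
Proof.
move=> b0 /andP[r0 r1]; elim: m b b0 => [|m IH] b b0.
  have b1 := addr_ge0 (ltW b0) ler01.
  exists (b * (b + 1) * lagF (b + 2) r 0 + b * lagF (b + 1) r 0).
    by rewrite addr_ge0// !mulr_ge0// ?(ltW b0)// (ltW (lagF_gt0 _ _ _)).
  move=> z zr; have /andP[z0 zr'] := zr.
  rewrite ger0_norm; last by apply: lagE_ge0 => //; rewrite z0 (le_lt_trans zr').
  rewrite /lagE big_ord0 subr0 mulr0 subr0 mul1r expr0n mul0r addr0 expr1 -mulrDr.
  rewrite mulrC ler_wpM2r//; apply: lerD.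
    rewrite -[leRHS]mul1r; apply: ler_pM => //.
    - by rewrite !mulr_ge0// ?(ltW b0)// (ltW (lagF_gt0 _ _ _)).
    - by apply: (le_trans zr'); exact: ltW.
    - by rewrite ler_wpM2l ?mulr_ge0 ?(ltW b0)// lagF_le// addr_ge0// ltW.
  by rewrite ler_wpM2l ?(ltW b0)// lagF_le.
have [C C0 H] := IH (b + 1) (addr_gt0 b0 ltr01).
exists (b * C); first by rewrite mulr_ge0// ltW.
move=> z zr; apply: (@is_derive_normr_le _ (lagE m.+1 b)
  (fun z => b * lagE m (b + 1) z) r _ _ _ _ _ _ zr).
- by move=> y /andP[y0 yz]; apply: is_derive_lagE; apply: le_lt_trans r1.
- exact: lagE0.
- move=> y yr; rewrite normrM (gtr0_norm b0) -mulrA ler_wpM2l ?(ltW b0)//.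
  exact: H.
Qed.

Lemma lagF_ge1 b z : 0 <= b -> 0 <= z < 1 -> 1 <= lagF b z 0.
Proof.
move=> b0 /andP[z0 z1]; rewrite /lagF mul0r subr0 -[leLHS]expR0 ler_expR.
by rewrite mulNr -mulrN mulr_ge0// oppr_ge0 ln_le0// gerBl.
Qed.

(** Near z = 1 the dominant term is b (b + 1) (1 - z)^(-b - 2), still unbounded after multiplication
    by 1 - z. *)
Lemma lagE_blowup m b (M : R) : 0 < b ->
  exists2 z, 0 < z < 1 & M < lagE m b z * (1 - z).
Proof.
move=> b0; pose s := \sum_(n < m) (n%:R - m%:R) ^+ 2 * lag n b 0.
have s0 : 0 <= s.
  by apply: sumr_ge0 => i _; rewrite mulr_ge0 ?sqr_ge0// ltW// lag0_gt0.
(* What the dominant term has to beat: the subtracted polynomial, at most s, the target M, and the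
   negative part 2 m b of the middle term. *)
pose M' := s + `|M| + 2 * m%:R * b + 1.
have M'0 : 0 < M'.
  have : 0 <= m%:R * b by rewrite mulr_ge0// ltW.
  by have := normr_ge0 M; rewrite /M'; lra.
have bb : 0 < b * (b + 1) by rewrite mulr_gt0// addr_gt0.
(* y stands for 1/(1 - z). Since y >= 2 forces z >= 1/2, the factor 4 ensures z^2 b (b + 1) y >=
   M'. *)
pose y := 2 + 4 * M' / (b * (b + 1)).
have y2 : 2 <= y by rewrite /y lerDl divr_ge0// ?(ltW bb)// mulr_ge0// (ltW M'0).
have y0 : 0 < y by lra.
have yi : y^-1 <= 2^-1 by rewrite lef_pV2 ?posrE.
have yi0 : 0 < y^-1 by rewrite invr_gt0.
exists (1 - y^-1); first by lra.
set z := 1 - y^-1; have z0 : 2^-1 <= z by rewrite /z; lra.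
have z1 : z < 1 by rewrite /z; lra.
have zE : 1 - z = y^-1 by rewrite /z; ring.
have F1 : 1 <= lagF b z 0 by apply: lagF_ge1; [exact: ltW|rewrite z1 andbT; lra].
rewrite /lagE lagFSS// lagFS// zE.
set F := lagF b z 0.
have -> : (z * (z * (b * (b + 1) * (F / y^-1 ^+ 2))) +
  (1 - 2 * m%:R) * (z * (b * (F / y^-1))) + m%:R ^+ 2 * F -
  \sum_(n < m) (n%:R - m%:R) ^+ 2 * lag n b 0 * z ^+ n) * y^-1 =
  F * (z * z * (b * (b + 1)) * y + (1 - 2 * m%:R) * z * b) + (m%:R ^+ 2 * F) * y^-1 -
  (\sum_(n < m) (n%:R - m%:R) ^+ 2 * lag n b 0 * z ^+ n) * y^-1.
  by field; rewrite gt_eqF.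
have S1 : (\sum_(n < m) (n%:R - m%:R) ^+ 2 * lag n b 0 * z ^+ n) * y^-1 <= s.
  rewrite -[leRHS]mulr1; apply: ler_pM.
  - apply: sumr_ge0 => i _.
    rewrite mulr_ge0 ?exprn_ge0//; last by lra.
    by rewrite mulr_ge0 ?sqr_ge0// ltW// lag0_gt0.
  - by rewrite ltW.
  - apply: ler_sum => i _; rewrite -[leRHS]mulr1 ler_wpM2l//.
      by rewrite mulr_ge0 ?sqr_ge0// ltW// lag0_gt0.
    by rewrite exprn_ile1// ?ltW//; lra.
  - by lra.
have P1 : M' - 2 * m%:R * b <= z * z * (b * (b + 1)) * y + (1 - 2 * m%:R) * z * b.
  have e1 : M' <= 4^-1 * (b * (b + 1)) * y.
    rewrite /y mulrDr; have -> : 4^-1 * (b * (b + 1)) * (4 * M' / (b * (b + 1))) = M'.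
      by field; rewrite !gt_eqF// addr_gt0.
    by rewrite lerDr mulr_ge0// mulr_ge0 ?invr_ge0// ltW.
  have zz : 4^-1 <= z * z by nra.
  have e2 : 4^-1 * (b * (b + 1)) * y <= z * z * (b * (b + 1)) * y.
    by rewrite !ler_wpM2r// ltW.
  have e3 : - (2 * m%:R * b) <= (1 - 2 * m%:R) * z * b.
    have mb : 0 <= m%:R * b by rewrite mulr_ge0// ltW.
    have -> : (1 - 2 * m%:R) * z * b = z * b - 2 * (m%:R * b) * z by ring.
    have zb : 0 <= z * b by rewrite mulr_ge0 ?(ltW b0)//; lra.
    have : (m%:R * b) * z <= m%:R * b by rewrite ler_piMr// ltW.
    by lra.
  by lra.
have P2 : M' - 2 * m%:R * b <= F * (z * z * (b * (b + 1)) * y + (1 - 2 * m%:R) * z * b).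
  have h0 : 0 <= M' - 2 * m%:R * b.
    have := normr_ge0 M; rewrite /M'; lra.
  rewrite -[leLHS]mul1r; exact: ler_pM.
have P3 : 0 <= (m%:R ^+ 2 * F) * y^-1 by rewrite !mulr_ge0 ?(ltW yi0)// ltW// lagF_gt0.
have := ler_norm M; move: P2 P3 S1; rewrite /M'.
set a1 := F * _; set a2 := m%:R ^+ 2 * F * _; set a3 := _ * y^-1; lra.
Qed.

Lemma exprS_le_self (x : R) n : 0 <= x <= 1 -> x ^+ n.+1 <= x.
Proof. by move=> /andP[x0 x1]; rewrite exprS ler_piMr// exprn_ile1. Qed.

(* As r -> 0 the left side dominates.  As r -> 1 it is O(1 / (1 - r)), which the
   first term of the series on the right, of order (1 - r)^(- b - 2), exceeds. *)
Lemma lag_balance m b : 0 < b ->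
  exists2 r, 0 < r < 1 &
    \sum_(n < m.+1) (n%:R - m.+1%:R) ^+ 2 * lag n b 0 / (1 - r ^+ (m.+1 - n)) =
    limsum (fun k => lagE m.+1 b (r ^+ k.+1) / (r ^+ k.+1) ^+ m.+1).
Proof.
move=> b0; pose th (r : R) k := lagE m.+1 b (r ^+ k.+1) / (r ^+ k.+1) ^+ m.+1.
pose lft (r : R) :=
  \sum_(n < m.+1) (n%:R - m.+1%:R) ^+ 2 * lag n b 0 / (1 - r ^+ (m.+1 - n)).
pose M := \sum_(n < m.+1) (n%:R - m.+1%:R) ^+ 2 * lag n b 0.
have [z1 /andP[z10 z11] Mz1] := lagE_blowup m.+1 M b0.
have z101 : 0 < z1 < 1 by rewrite z10.
have [C C0 H] := lagE_le m.+1 b0 z101.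
have thC (r : R) k : 0 < r <= z1 -> 0 <= th r k <= C * r ^+ k.+1.
  move=> /andP[r0 rz]; have rk0 : 0 < r ^+ k.+1 by rewrite exprn_gt0.
  have rkz : r ^+ k.+1 <= z1.
    apply: (le_trans (exprS_le_self k _) rz).
    by rewrite (ltW r0) (le_trans rz (ltW z11)).
  have e0 : 0 <= lagE m.+1 b (r ^+ k.+1).
    by apply: lagE_ge0 => //; rewrite (ltW rk0) (le_lt_trans rkz).
  apply/andP; split; first by apply: divr_ge0 => //; rewrite exprn_ge0 ?(ltW rk0).
  rewrite /th ler_pdivrMr ?exprn_gt0// -mulrA -exprS.
  rewrite -[leLHS]ger0_norm//; apply: H.
  by rewrite (ltW rk0) rkz.
have thn (r : R) k : 0 < r <= z1 -> `|th r k| <= C * r * r ^+ k.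
  by move=> rz; have /andP[t0 tC] := thC r k rz; rewrite ger0_norm// -mulrA -exprS.
(* With 4 (C + 1) a <= 1 the series at a is at most C a / (1 - a) <= 1, while the term n = 0 of the
   left side is already at least 1. *)
pose a := Num.min z1 (4 * (C + 1))^-1.
have C4 : 0 < 4 * (C + 1) by rewrite mulr_gt0// ltr_wpDl.
have a0 : 0 < a by rewrite lt_min z10 invr_gt0.
have az : a <= z1 by rewrite ge_min lexx.
have aC : a <= (4 * (C + 1))^-1 by rewrite ge_min lexx orbT.
have aC' : a * (4 * (C + 1)) <= 1 by rewrite -ler_pdivlMr// div1r.
have a4 : a * 4 <= 1.
  by apply: le_trans aC'; rewrite ler_wpM2l ?(ltW a0)//; lra.
have dif_a : limsum (th a) - lft a <= 0.
  have a01 : 0 < a < 1 by rewrite a0; lra.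
  have /(_ 0%N) := limsum_tail a01 (fun k => thn a k (introT andP (conj a0 az))).
  rewrite big_ord0 subr0 expr0 mulr1 => h.
  have {h} : limsum (th a) <= 1.
    apply: (le_trans (ler_norm _)); apply: (le_trans h).
    by rewrite ler_pdivrMr; [nra|lra].
  suff : 1 <= lft a by lra.
  rewrite /lft big_ord_recl /= sub0r sqrrN mulr1 subn0.
  rewrite -[leLHS]addr0; apply: lerD.
    have am : 0 <= a ^+ m.+1 < 1.
      by rewrite exprn_ge0 ?(ltW a0)// exprn_ilt1// ?(ltW a0)//; lra.
    rewrite ler_pdivlMr; last by lra.
    rewrite mul1r (@le_trans _ _ 1)//; first by lra.
    by rewrite expr_ge1// ler1n.
  apply: sumr_ge0 => i _.
  have ai : a ^+ (m.+1 - (bump 0 i)) <= 1.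
    by rewrite exprn_ile1 ?(ltW a0)//; lra.
  rewrite mulr_ge0// ?invr_ge0 ?subr_ge0// mulr_ge0 ?sqr_ge0//.
  exact: ltW (lag0_gt0 _.+1 b0).
(* All exponents m + 1 - n are positive, so the left side is at most M / (1 - z1); by the choice of
   z1 the term k = 0 on the right exceeds this. *)
have dif_z : 0 <= limsum (th z1) - lft z1.
  have zz : 0 < z1 <= z1 by rewrite z10 lexx.
  have g1 : th z1 0%N <= limsum (th z1).
    apply: (limsum_ge_head z101 (fun k => thn z1 k zz)) => k.
    by have /andP[] := thC z1 k zz.
  have g2 : lagE m.+1 b z1 <= th z1 0%N.
    rewrite /th expr1 ler_pdivlMr ?exprn_gt0//.
    rewrite ler_piMr// ?exprn_ile1// ?(ltW z10) ?(ltW z11)//.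
    by apply: lagE_ge0 => //; rewrite (ltW z10).
  have g3 : lft z1 <= M / (1 - z1).
    rewrite mulr_suml; apply: ler_sum => i _.
    rewrite ler_wpM2l//; first by rewrite mulr_ge0 ?sqr_ge0// ltW// lag0_gt0.
    have zi : z1 ^+ (m.+1 - i) <= z1.
      have := ltn_ord i; rewrite -subn_gt0; case: (m.+1 - i)%N => // j _.
      by apply: exprS_le_self; rewrite !ltW.
    by rewrite lef_pV2 ?posrE ?subr_gt0 ?(le_lt_trans zi)// lerD2l lerN2.
  have g4 : M / (1 - z1) <= lagE m.+1 b z1.
    by rewrite ler_pdivrMr ?subr_gt0// ltW.
  by lra.
have cS : {within `[a, z1], continuous (fun r => limsum (th r))}.
  apply: (@continuous_geometric_approx _ (fun k r => th r k) _ a z1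
    (C * z1 / (1 - z1)) z1) => //.
    move=> k; apply: continuous_in_subspaceT => x; rewrite inE/= in_itv/= => /andP[ax xz].
    have x0 : 0 < x by exact: lt_le_trans ax.
    have xk : x ^+ k.+1 < 1 by rewrite exprn_ilt1// ?(ltW x0)// (le_lt_trans xz).
    have c1 : {for x, continuous (fun r : R => r ^+ k.+1)} by exact: exprn_continuous.
    apply: cvgM.
      apply: (@continuous_comp _ _ _ (fun r : R => r ^+ k.+1) (lagE m.+1 b) x c1).
      have [d _] := is_derive_lagE m b xk.
      by apply: differentiable_continuous; exact/derivable1_diffP.
    apply: cvgV; first by rewrite !expf_neq0// gt_eqF.
    exact: (@continuous_comp _ _ _ (fun r : R => r ^+ k.+1) (fun r : R => r ^+ m.+1) x c1
      (@exprn_continuous _ _ _)).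
  move=> N x /andP[ax xz]; apply: limsum_tail => // k.
  have x0 : 0 < x by exact: lt_le_trans ax.
  apply: (le_trans (thn x k _)); first by rewrite x0.
  rewrite -!mulrA -!exprS ler_wpM2l// lerXn2r// nnegrE ltW//.
have cL : {within `[a, z1], continuous lft}.
  apply: continuous_in_subspaceT => x; rewrite inE/= in_itv/= => /andP[ax xz].
  have x0 : 0 < x by exact: lt_le_trans ax.
  apply: cvg_big => [|i _]; first exact: add_continuous.
  apply: cvgM; first exact: cvg_cst.
  apply: cvgV.
    rewrite gt_eqF// subr_gt0 exprn_ilt1// ?(ltW x0) ?(le_lt_trans xz)//.
    by rewrite -lt0n subn_gt0.
  by apply: cvgB; [exact: cvg_cst|exact: exprn_continuous].
have [||r] := @IVT _ (fun r => limsum (th r) - lft r) a z1 0 az.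
- by move=> x; apply: continuousB; [exact: cS|exact: cL].
- by rewrite ge_min le_max dif_a dif_z orbT.
rewrite in_itv/= => /andP[ar rz] /eqP; rewrite subr_eq0 => /eqP e.
exists r; last by rewrite -[RHS]/(limsum (th r)) e.
by rewrite (lt_le_trans a0)// (le_lt_trans rz).
Qed.

End balance.

(** * The profile of the eigenfunction *)

Section profile.
Context {R : realType}.
Implicit Types (b z X r : R) (N n m : nat).

(** Serves to pass from partial sums to limits: relations are proved for N terms with an error of
    order r^N. *)
Lemma le_addgeo (x y C r : R) : 0 < r < 1 ->
  (forall N, x <= y + C * r ^+ N) -> x <= y.
Proof.
move=> /andP[r0 r1] H; apply/ler_addgt0Pr => e e0.
have : geometric C r n @[n --> \oo] --> 0.
  by apply: cvg_geometric; rewrite gtr0_norm.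
move=> /cvgrPdist_lt /(_ e e0) [N _ HN].
have := HN N (leqnn _); rewrite /= sub0r normrN => h.
by rewrite (le_trans (H N))// lerD2l (le_trans (ler_norm _))// ltW.
Qed.

(** At X = 0 this is (D - M)^2 = D (D - M) - M (D - M) for D = z d/dz and M = m + 1. By
    [is_derive_lagU_X] the first term is also -b times the X-derivative of [lagU m.+1 b] at 0, which
    ties [lagE] to the slope of the profile. *)
Lemma lagEE m b z : lagE m.+1 b z =
  b * (z * lagU m (b + 1) z 0) - m.+1%:R * lagU m.+1 b z 0.
Proof.
rewrite /lagE /lagU /lagF' !mul0r !subr0.
rewrite big_ord_recl [in RHS]big_ord_recl.
have -> : \sum_(i < m)
    ((lift ord0 i)%:R - m.+1%:R) ^+ 2 * lag (lift ord0 i) b 0 * z ^+ (lift ord0 i) =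
  b * (z * (\sum_(n < m) (n%:R - m%:R) * lag n (b + 1) 0 * z ^+ n)) -
  m.+1%:R * (\sum_(i < m)
    ((lift ord0 i)%:R - m.+1%:R) * lag (lift ord0 i) b 0 * z ^+ (lift ord0 i)).
  rewrite !mulr_sumr -sumrB; apply: eq_bigr => i _.
  have h : b * lag i (b + 1) 0 = i.+1%:R * lag i.+1 b 0.
    by rewrite lagS mul0r subr0.
  rewrite !lift0.
  have -> : b * (z * ((i%:R - m%:R) * lag i (b + 1) 0 * z ^+ i)) =
    (i%:R - m%:R) * (b * lag i (b + 1) 0) * z ^+ i.+1 by rewrite exprS; ring.
  by rewrite h -!natr1; ring.
have e2 : b + 1 + 1 = b + 2 by ring.
rewrite e2 -[nat_of_ord ord0]/0%N [lag 0 b 0]/=.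
set S1 := \sum_(_ < _) _; set S2 := \sum_(_ < _) _.
by rewrite -(natr1 m) expr0; ring.
Qed.

(* [lagh m b r] is the sum over n <> m of (n - m) r^n / (r^n - r^m) * lag n b,
   plus the term [lagw_diag] in degree m.  For n > m the weight is expanded as
   - sum_k (n - m) r^((k + 1) (n - m)), and [lagT m b r X k] is the sum over
   n > m for a fixed k. *)
Definition lagT m b r X k := lagU m b (r ^+ k.+1) X / (r ^+ k.+1) ^+ m.

Definition lagw m r n : R := (n%:R - m%:R) / (1 - r ^+ (m - n)).

Definition lagw_diag m b r : R :=
  (limsum (lagT m b r 0) - \sum_(n < m) lagw m r n * lag n b 0) / lag m b 0.

Definition lagpart m b r N X : R :=
  \sum_(n < m) lagw m r n * lag n b X + lagw_diag m b r * lag m b X -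
  \sum_(k < N) lagT m b r X k.

Definition lagh m b r X : R :=
  \sum_(n < m) lagw m r n * lag n b X + lagw_diag m b r * lag m b X -
  limsum (lagT m b r X).

Lemma exprS_in r k : 0 < r < 1 -> 0 < r ^+ k.+1 <= r.
Proof.
move=> /andP[r0 r1]; rewrite exprn_gt0//= exprS_le_self// ltW//= ltW//.
Qed.

Lemma lagT_le m b r : 0 <= b -> 0 < r < 1 ->
  exists2 C, 0 <= C & forall k X, 0 <= X ->
    `|lagT m b r X k| <= C * (1 + X) ^+ m.+1 * r ^+ k.
Proof.
move=> b0 r01; have [C C0 H] := lagU_le m b0 r01.
have /andP[r0 r1] := r01.
exists C => // k X X0; have /andP[z0 zr] := exprS_in k r01.
rewrite /lagT normrM normfV (gtr0_norm (exprn_gt0 m z0)) ler_pdivrMr ?exprn_gt0//.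
have zr' : 0 <= r ^+ k.+1 <= r by rewrite (ltW z0).
apply: (le_trans (H _ _ zr' X0)).
rewrite (exprS (r ^+ k.+1)).
have -> : C * (r ^+ k.+1 * (r ^+ k.+1) ^+ m) * (1 + X) ^+ m.+1 =
  C * (1 + X) ^+ m.+1 * r ^+ k.+1 * (r ^+ k.+1) ^+ m by ring.
rewrite ler_wpM2r ?exprn_ge0 ?(ltW z0) ?(ltW r0)//  ler_wpM2l//.
  by rewrite mulr_ge0// exprn_ge0// addr_ge0.
by rewrite exprS ler_piMl ?(ltW r1)// exprn_ge0// ltW.
Qed.

Lemma lagh_tail m b r : 0 <= b -> 0 < r < 1 ->
  exists2 C, 0 <= C & forall N X, 0 <= X ->
    `|lagh m b r X - lagpart m b r N X| <= C * (1 + X) ^+ m.+1 * r ^+ N.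
Proof.
move=> b0 r01; have [C C0 H] := lagT_le m b0 r01; have /andP[r0 r1] := r01.
exists (C / (1 - r)); first by rewrite divr_ge0// subr_ge0 ltW.
move=> N X X0; rewrite /lagh /lagpart.
set A := \sum_(_ < _) _ + _.
have -> : A - limsum (lagT m b r X) - (A - \sum_(k < N) lagT m b r X k) =
  - (limsum (lagT m b r X) - \sum_(k < N) lagT m b r X k) by ring.
rewrite normrN [C / _ * _]mulrAC; apply: (limsum_tail r01) => k; exact: H.
Qed.

Lemma lagpart_value0 m b r : 0 < b -> 0 < r < 1 ->
  exists2 C, 0 <= C & forall N, `|lagpart m b r N 0| <= C * r ^+ N.
Proof.
move=> b0 r01; have [C C0 H] := lagT_le m (ltW b0) r01.
have /andP[r0 r1] := r01.
exists (C / (1 - r)); first by rewrite divr_ge0// subr_ge0 ltW.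
move=> N; rewrite /lagpart /lagw_diag divfK ?gt_eqF ?lag0_gt0//.
set A := \sum_(_ < m) _; set S := \sum_(_ < N) _.
have -> : A + (limsum (lagT m b r 0) - A) - S = limsum (lagT m b r 0) - S by ring.
apply: (limsum_tail r01) => k; apply: (le_trans (H k 0 (lexx 0))).
by rewrite addr0 expr1n mulr1.
Qed.

(** The X-derivative of [lagT] at 0, from [is_derive_lagU_X]; because of [m.-1] it has this meaning
    for m > 0. *)
Definition lagT' m b r k : R :=
  - (r ^+ k.+1 * lagU m.-1 (b + 1) (r ^+ k.+1) 0) / (r ^+ k.+1) ^+ m.

Definition lagpart' m b r N : R :=
  \sum_(n < m) lagw m r n * lag' n b 0 + lagw_diag m b r * lag' m b 0 -
  \sum_(k < N) lagT' m b r k.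

(** The equation for rho = r, with [lag n b 0] = (b)_n / n!. The terms n < m stand on the left,
    where r^n / (r^n - r^m) = 1 / (1 - r^(m-n)); those with n > m stand on the right, expanded in
    powers of r^(n-m) and summed over n. *)
Definition balanced m b r :=
  \sum_(n < m) (n%:R - m%:R) ^+ 2 * lag n b 0 / (1 - r ^+ (m - n)) =
    limsum (fun k => lagE m b (r ^+ k.+1) / (r ^+ k.+1) ^+ m).

Lemma mul_lag' n b : - b * lag' n b 0 = n%:R * lag n b 0.
Proof.
case: n => [|n]; first by rewrite /= mulr0 mul0r.
by rewrite lagS mul0r subr0 /lag' mulrNN.
Qed.

(** At X = 0, -b d/dX multiplies the term of degree n by n. So -b times the slope has the factors n
    (n - M), M = m + 1, and subtracting M times the value, which tends to 0, turns them into (n -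
    M)^2: the balance equation. *)
Lemma lagpart'_value0 m b r : 0 < b -> 0 < r < 1 -> balanced m.+1 b r ->
  exists2 C, 0 <= C & forall N, `|lagpart' m.+1 b r N| <= C * r ^+ N.
Proof.
move=> b0 r01 bal; have /andP[r0 r1] := r01.
have [C1 C10 H1] := lagpart_value0 m.+1 b0 r01.
have [C C0 H] := lagE_le m.+1 b0 r01.
have h k : `|lagE m.+1 b (r ^+ k.+1) / (r ^+ k.+1) ^+ m.+1| <= C * r ^+ k.
  have /andP[z0 zr] := exprS_in k r01.
  rewrite normrM normfV (gtr0_norm (exprn_gt0 m.+1 z0)) ler_pdivrMr ?exprn_gt0//.
  have zr' : 0 <= r ^+ k.+1 <= r by rewrite (ltW z0).
  apply: (le_trans (H _ zr')); rewrite (exprS (r ^+ k.+1)) mulrA.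
  rewrite ler_wpM2r ?exprn_ge0 ?(ltW z0) ?(ltW r0)// ler_wpM2l//.
  by rewrite exprS ler_piMl ?(ltW r1)// exprn_ge0// ltW.
have r1' : 0 < 1 - r by rewrite subr_gt0.
exists ((C / (1 - r) + m.+1%:R * C1) / b).
  by rewrite divr_ge0 ?(ltW b0)// addr_ge0 ?divr_ge0 ?mulr_ge0// ltW.
move=> N; rewrite mulrAC ler_pdivlMr// mulrC mulrDl.
rewrite -{1}(gtr0_norm b0) -normrM -normrN -mulNr.
have -> : - b * lagpart' m.+1 b r N =
   (limsum (fun k => lagE m.+1 b (r ^+ k.+1) / (r ^+ k.+1) ^+ m.+1) -
    \sum_(k < N) (lagE m.+1 b (r ^+ k.+1) / (r ^+ k.+1) ^+ m.+1)) +
   m.+1%:R * lagpart m.+1 b r N 0.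
  rewrite -bal /lagpart' /lagpart.
  set S1 := \sum_(n < m.+1) _ * lag' n b 0.
  set S2 := \sum_(k < N) lagT' _ _ _ _.
  set S3 := \sum_(n < m.+1) _ / _.
  set S4 := \sum_(k < N) _ / _.
  set S5 := \sum_(n < m.+1) _ * lag n b 0.
  set S6 := \sum_(k < N) lagT _ _ _ _ _.
  have e1 : - b * S1 = S3 + m.+1%:R * S5.
    rewrite !mulr_sumr -big_split /=; apply: eq_bigr => i _.
    rewrite mulrCA mul_lag' /lagw; ring.
  have e2 : - b * S2 = S4 + m.+1%:R * S6.
    rewrite !mulr_sumr -big_split /=; apply: eq_bigr => i _.
    rewrite /lagT' /lagT lagEE -pred_Sn; ring.
  have := mul_lag' m.+1 b; set l' := lag' m.+1 b 0; set l := lag m.+1 b 0 => e3.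
  have -> : - b * (S1 + lagw_diag m.+1 b r * l' - S2) =
    - b * S1 + lagw_diag m.+1 b r * (- b * l') - (- b * S2) by ring.
  rewrite e1 e2 e3; ring.
apply: (le_trans (ler_normD _ _)); apply: lerD; first exact: (limsum_tail r01 h).
by rewrite normrM ger0_norm// -mulrA ler_wpM2l.
Qed.

(** The constant is uniform in N, so the quadratic bound survives the limit. *)
Lemma lagpart_jet m b r : 0 < b -> 0 < r < 1 ->
  exists2 C, 0 <= C & forall N X, 0 <= X <= 1 ->
    `|lagpart m.+1 b r N X - lagpart m.+1 b r N 0 - X * lagpart' m.+1 b r N|
      <= C * X ^+ 2.
Proof.
move=> b0 r01; have /andP[r0 r1] := r01.
have [C C0 H] := lagU_jet m (ltW b0) r01.
have H' k X : 0 <= X <= 1 ->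
    `|lagT m.+1 b r X k - lagT m.+1 b r 0 k - X * lagT' m.+1 b r k| <= C * X ^+ 2 * r ^+ k.
  move=> X01; have /andP[z0 zr] := exprS_in k r01.
  rewrite /lagT /lagT' -pred_Sn; set z := r ^+ k.+1 in z0 zr *.
  have -> : lagU m.+1 b z X / z ^+ m.+1 - lagU m.+1 b z 0 / z ^+ m.+1 -
    X * (- (z * lagU m (b + 1) z 0) / z ^+ m.+1) =
    (lagU m.+1 b z X - lagU m.+1 b z 0 + X * (z * lagU m (b + 1) z 0)) / z ^+ m.+1.
    by ring.
  rewrite normrM normfV (gtr0_norm (exprn_gt0 m.+1 z0)) ler_pdivrMr ?exprn_gt0//.
  have zr' : 0 <= z <= r by rewrite (ltW z0).
  apply: (le_trans (H _ _ zr' X01)); rewrite (exprS z).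
  have -> : C * (z * z ^+ m.+1) * X ^+ 2 = C * X ^+ 2 * z * z ^+ m.+1 by ring.
  apply: ler_wpM2r; first by rewrite exprn_ge0// ltW.
  apply: ler_wpM2l; first by rewrite mulr_ge0 ?sqr_ge0.
  by rewrite /z exprS ler_piMl ?(ltW r1)// exprn_ge0// ltW.
have [Cl Hl] : exists Cl : nat -> R, forall n, 0 <= Cl n /\ forall X, 0 <= X <= 1 ->
    `|lag n b X - lag n b 0 - X * lag' n b 0| <= Cl n * X ^+ 2.
  have := @lag_jet R ^~ b => hh.
  exists (fun n => projT1 (cid2 (hh n))) => n.
  by case: (cid2 (hh n)) => c /=.
exists (\sum_(n < m.+1) `|lagw m.+1 r n| * Cl n +
  `|lagw_diag m.+1 b r| * Cl m.+1 + C / (1 - r)).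
  rewrite addr_ge0//; last by rewrite divr_ge0// subr_ge0 ltW.
  rewrite addr_ge0//; last by rewrite mulr_ge0//; have [] := Hl m.+1.
  by apply: sumr_ge0 => i _; rewrite mulr_ge0//; have [] := Hl i.
move=> N X X01; rewrite /lagpart /lagpart'.
set w := lagw_diag m.+1 b r.
have -> : (\sum_(n < m.+1) lagw m.+1 r n * lag n b X + w * lag m.+1 b X -
   \sum_(k < N) lagT m.+1 b r X k -
   (\sum_(n < m.+1) lagw m.+1 r n * lag n b 0 + w * lag m.+1 b 0 -
    \sum_(k < N) lagT m.+1 b r 0 k) -
   X *
   (\sum_(n < m.+1) lagw m.+1 r n * lag' n b 0 + w * lag' m.+1 b 0 -
    \sum_(k < N) lagT' m.+1 b r k)) =
  \sum_(n < m.+1) lagw m.+1 r n * (lag n b X - lag n b 0 - X * lag' n b 0) +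
  w * (lag m.+1 b X - lag m.+1 b 0 - X * lag' m.+1 b 0) -
  \sum_(k < N) (lagT m.+1 b r X k - lagT m.+1 b r 0 k - X * lagT' m.+1 b r k).
  have -> : \sum_(n < m.+1) lagw m.+1 r n * (lag n b X - lag n b 0 - X * lag' n b 0) =
    \sum_(n < m.+1) lagw m.+1 r n * lag n b X - \sum_(n < m.+1) lagw m.+1 r n * lag n b 0
    - X * \sum_(n < m.+1) lagw m.+1 r n * lag' n b 0.
    by rewrite mulr_sumr -!sumrB; apply: eq_bigr => i _; ring.
  by rewrite !sumrB -mulr_sumr; ring.
rewrite mulrDl; apply: (le_trans (ler_normB _ _)); apply: lerD; last first.
  apply: (le_trans (ler_norm_sum _ _ _)).
  apply: (@le_trans _ _ (\sum_(k < N) C * X ^+ 2 * r ^+ k)).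
    by apply: ler_sum => i _; apply: H'.
  have CX : 0 <= C * X ^+ 2 by rewrite mulr_ge0 ?sqr_ge0.
  have := @geometric_le_lim R N (C * X ^+ 2) r CX r0.
  rewrite gtr0_norm// => /(_ r1); rewrite /series /= big_mkord => h.
  by apply: (le_trans h); rewrite mulrAC.
rewrite mulrDl; apply: (le_trans (ler_normD _ _)); apply: lerD; last first.
  by rewrite normrM -mulrA ler_wpM2l//; have [_] := Hl m.+1; apply.
apply: (le_trans (ler_norm_sum _ _ _)); rewrite mulr_suml; apply: ler_sum => i _.
by rewrite normrM -mulrA ler_wpM2l//; have [_] := Hl i; apply.
Qed.

(* Killing the 1-jet of the profile at the origin is what [balanced] and the
   choice of [lagw_diag] achieve. *)
Lemma lagh_flat m b r : 0 < b -> 0 < r < 1 -> balanced m.+1 b r ->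
  exists C, forall X, 0 <= X <= 1 -> `|lagh m.+1 b r X| <= C * X ^+ 2.
Proof.
move=> b0 r01 bal.
have [C1 C10 H1] := lagpart_value0 m.+1 b0 r01.
have [C2 C20 H2] := lagpart'_value0 b0 r01 bal.
have [C C0 H] := lagpart_jet m b0 r01.
have [D D0 HD] := lagh_tail m.+1 (ltW b0) r01.
exists C => X X01; have /andP[X0 X1] := X01.
apply: (@le_addgeo _ _ (D * (1 + X) ^+ m.+2 + C1 + C2) r r01) => N.
have -> : lagh m.+1 b r X =
  (lagpart m.+1 b r N X - lagpart m.+1 b r N 0 - X * lagpart' m.+1 b r N) +
  ((lagh m.+1 b r X - lagpart m.+1 b r N X) + lagpart m.+1 b r N 0 +
   X * lagpart' m.+1 b r N).
  by ring.
apply: (le_trans (ler_normD _ _)); apply: lerD; first exact: H.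
rewrite !mulrDl; apply: (le_trans (ler_normD _ _)); apply: lerD.
  by apply: (le_trans (ler_normD _ _)); apply: lerD; [exact: HD|exact: H1].
rewrite normrM ger0_norm// -[leRHS]mul1r; exact: ler_pM.
Qed.

End profile.

(** * Gaussian integrals *)

Section gaussian_integrals.
Context {R : realType}.
Implicit Types (b z r s t : R).

(** The Radon-Nikodym derivative agrees with [normal_pdf] almost everywhere, both having the same
    integral over every measurable set. *)
Lemma ge0_integral_normal_prob (m s : R) (f : R -> \bar R) :
  measurable_fun setT f -> (forall x, 0 <= f x)%E ->
  (\int[normal_prob m s]_x f x =
   \int[lebesgue_measure]_x (f x * (normal_pdf m s x)%:E))%E.
Proof.
move=> mf f0.
have dom := @normal_prob_dominates R m s.
have mpdf : measurable_fun setT (fun x => (normal_pdf m s x)%:E).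
  by apply/measurable_EFinP; exact: measurable_normal_pdf.
rewrite -(Radon_Nikodym_SigmaFinite.change_of_variables dom f0 measurableT mf).
have fi := Radon_Nikodym_SigmaFinite.f_integrable dom.
apply: ae_eq_integral => //.
- by apply: emeasurable_funM => //; exact: measurable_int fi.
- exact: emeasurable_funM.
apply: ae_eqe_mul2l.
apply: integral_ae_eq => // E _ mE.
by rewrite -Radon_Nikodym_SigmaFinite.f_integral.
Qed.

(** Completing the square: with D = 1 + 2 al b^2, integrand times density is a constant times the
    density of mean u b^2 / D and variance b^2 / D. The factor D^(-1/2) is kept as an exponential to
    match [lagF]. *)
Lemma ge0_integral_normal_expR (b u al : R) : 0 < b -> 0 < 1 + 2 * al * b ^+ 2 ->
  (\int[normal_prob 0 b]_t (expR (u * t - al * t ^+ 2))%:E =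
   (expR (- (2^-1) * ln (1 + 2 * al * b ^+ 2) +
     u ^+ 2 * b ^+ 2 / (2 * (1 + 2 * al * b ^+ 2))))%:E)%E.
Proof.
move=> b0 D0; set D := 1 + 2 * al * b ^+ 2.
have b0' : b != 0 by rewrite gt_eqF.
have sD : 0 < Num.sqrt D by rewrite sqrtr_gt0.
have sD' : Num.sqrt D != 0 by rewrite gt_eqF.
have s0 : 0 < b / Num.sqrt D by rewrite divr_gt0.
have D0' : D != 0 by rewrite gt_eqF.
rewrite ge0_integral_normal_prob; last 2 first.
- apply/measurable_EFinP/measurableT_comp => //.
  apply: measurable_funB; apply: measurable_funM => //.
- by move=> t; rewrite lee_fin expR_ge0.
set k := expR _.
transitivity (\int[lebesgue_measure]_t
  (k%:E * (normal_pdf (u * b ^+ 2 / D) (b / Num.sqrt D) t)%:E))%E.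
  apply: eq_integral => t _; rewrite -!EFinM; congr EFin.
  rewrite !normal_pdfE ?gt_eqF// /normal_peak /normal_fun.
  have -> : (b / Num.sqrt D) ^+ 2 = b ^+ 2 / D.
    by rewrite expr_div_n sqr_sqrtr// ltW.
  have -> : Num.sqrt (b ^+ 2 / D * pi *+ 2) = Num.sqrt (b ^+ 2 * pi *+ 2) / Num.sqrt D.
    have -> : b ^+ 2 / D * pi *+ 2 = (b ^+ 2 * pi *+ 2) * D^-1.
      by rewrite -[LHS]mulr_natl -[X in _ = X * _]mulr_natl; field.
    by rewrite sqrtrM ?sqrtrV ?(ltW D0)// mulrn_wge0// mulr_ge0 ?sqr_ge0// pi_ge0.
  rewrite invf_div mulrCA [RHS]mulrCA -!mulrA mulrC.
  rewrite [in RHS](mulrC (_^-1)) !mulrA; congr (_ * _).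
  rewrite -expRD /k.
  have -> : Num.sqrt D = expR (2^-1 * ln D).
    have {1}-> : D = expR (2^-1 * ln D) ^+ 2.
      by rewrite expr2 -expRD -{1}[D](lnK D0); congr expR; field.
    by rewrite sqrtr_sqr ger0_norm ?expR_ge0.
  rewrite [in RHS]mulrC -!expRD; congr expR.
  have alE : al = (D - 1) / (2 * b ^+ 2) by rewrite /D; field.
  rewrite subr0 !mulr2n {1}alE; move: (D) D0' => E E0.
  by field; rewrite b0' E0 /= ?andbT gt_eqF // addr_gt0 // mulr_gt0.
transitivity (k%:E * \int[lebesgue_measure]_t
    (normal_pdf (u * b ^+ 2 / D) (b / Num.sqrt D) t)%:E)%E; last first.
  by rewrite integral_normal_pdf mule1.
apply: ge0_integralZl_EFin => //.
- by move=> t _; rewrite lee_fin normal_pdf_ge0.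
- by apply/measurable_EFinP; exact: measurable_normal_pdf.
- exact: expR_ge0.
Qed.

Lemma measurable_prod_tnth d (g : 'I_d -> R -> R) :
  (forall i, measurable_fun setT (g i)) ->
  measurable_fun setT (fun s : euclid R d => \prod_(i < d) g i (tnth s i)).
Proof.
move=> mg; apply: measurable_prod => i _.
exact: (measurableT_comp (mg i) (measurable_tnth i)).
Qed.

Lemma ge0_integral_gauss_prod b d (g : 'I_d -> R -> R) (c : 'I_d -> R) :
  (forall i, measurable_fun setT (g i)) -> (forall i x, 0 <= g i x) ->
  (forall i, \int[normal_prob 0 b]_x (g i x)%:E = (c i)%:E)%E ->
  (\int[gauss b d]_s (\prod_(i < d) g i (tnth s i))%:E = (\prod_(i < d) c i)%:E)%E.
Proof.
elim: d g c => [|d IH] g c mg g0 gc.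
  rewrite /gauss integral_dirac//=; last first.
    by apply/measurable_EFinP; exact: measurable_prod_tnth.
  by rewrite diracT mul1e !big_ord0.
rewrite [gauss b d.+1]/=.
rewrite ge0_integral_distribution; last 2 first.
- by apply/measurable_EFinP; exact: measurable_prod_tnth.
- by move=> s; rewrite lee_fin prodr_ge0.
rewrite fubini_tonelli1; last 2 first.
- apply/measurable_EFinP.
  exact: (measurableT_comp (measurable_prod_tnth mg) (@measurable_tcons R d)).
- by move=> s; rewrite /= lee_fin prodr_ge0.
rewrite big_ord_recl.
have IHd := IH (fun i => g (lift ord0 i)) (fun i => c (lift ord0 i))
  (fun i => mg _) (fun i => g0 _) (fun i => gc _).
transitivity (\int[normal_prob 0 b]_x
  ((g ord0 x)%:E * (\prod_(i < d) c (lift ord0 i))%:E))%E.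
  apply: eq_integral => x _; rewrite /fubini_F /=.
  rewrite -IHd.
  rewrite -ge0_integralZl_EFin//; last 2 first.
  - by move=> s _; rewrite lee_fin prodr_ge0.
  - apply/measurable_EFinP.
    exact: (@measurable_prod_tnth d (fun i => g (lift ord0 i)) (fun i => mg _)).
  apply: eq_integral => s _; rewrite -EFinM big_ord_recl; congr EFin; congr (_ * _).
  by apply: eq_bigr => i _; rewrite tnthS.
rewrite ge0_integralZr//.
- by rewrite gc EFinM.
- by apply/measurable_EFinP; exact: mg.
- by move=> x _; rewrite lee_fin g0.
- rewrite -IHd.
  by apply: integral_ge0 => s _; rewrite lee_fin prodr_ge0.
Qed.

End gaussian_integrals.

(** * Mehler's formula for the generating function *)

Section mehler.
Context {R : realType}.
Implicit Types (b z r : R).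

Lemma q_gt0_lt1 b : 0 < b -> 0 < q b < 1.
Proof.
move=> b0; have O1 : 1 < Omega b.
  rewrite -[ltLHS]sqrtr1 ltr_sqrt; last by rewrite addr_gt0// mulr_gt0// exprn_gt0.
  by rewrite ltrDl mulr_gt0// exprn_gt0.
rewrite /q; apply/andP; split; first by apply: divr_gt0; lra.
by rewrite ltr_pdivrMr; lra.
Qed.

Lemma sqr_beta b : 0 < b -> b ^+ 2 * (1 - q b) ^+ 2 = q b.
Proof.
move=> b0; have O1 : 1 < Omega b.
  rewrite -[ltLHS]sqrtr1 ltr_sqrt; last by rewrite addr_gt0// mulr_gt0// exprn_gt0.
  by rewrite ltrDl mulr_gt0// exprn_gt0.
have O2 : Omega b ^+ 2 = 1 + 4 * b ^+ 2.
  by rewrite sqr_sqrtr// addr_ge0// mulr_ge0// sqr_ge0.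
have -> : b ^+ 2 = (Omega b ^+ 2 - 1) / 4 by rewrite O2; field.
rewrite /q; field; lra.
Qed.

Lemma q_surj (r : R) : 0 < r < 1 -> exists2 b, 0 < b & q b = r.
Proof.
move=> /andP[r0 r1]; have r1' : 0 < 1 - r by rewrite subr_gt0.
(* Solves b^2 (1 - r)^2 = r, so that Omega = (1 + r) / (1 - r). *)
exists (Num.sqrt r / (1 - r)); first by rewrite divr_gt0// sqrtr_gt0.
rewrite /q /Omega expr_div_n sqr_sqrtr ?(ltW r0)//.
have -> : 1 + 4 * (r / (1 - r) ^+ 2) = ((1 + r) / (1 - r)) ^+ 2.
  by field; rewrite gt_eqF.
rewrite sqrtr_sqr ger0_norm; last by rewrite divr_ge0 ?(ltW r1')// addr_ge0// ltW.
by field; rewrite gt_eqF//= ; lra.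
Qed.

(* The radial eigenfunctions of the Gaussian kernel are
   exp (- ka |t|^2) * L_n^(d/2 - 1) (ga |t|^2), with eigenvalues (1 - q)^d q^(2n). *)
Definition ka b : R := (1 - q b) / 2.
Definition ga b : R := (1 - q b ^+ 2) / (2 * q b).

Lemma ka_gt0 b : 0 < b -> 0 < ka b.
Proof. by move=> /q_gt0_lt1 /andP[q0 q1]; rewrite /ka; lra. Qed.

Lemma ga_gt0 b : 0 < b -> 0 < ga b.
Proof.
move=> /q_gt0_lt1 /andP[q0 q1]; rewrite /ga; apply: divr_gt0; last exact: mulr_gt0.
by rewrite subr_gt0 expr_lt1// ltW.
Qed.

Definition gker d (s t : euclid R d) : R :=
  expR (dot s t - (dot s s + dot t t) / 2).

Definition gprof d b (h : R -> R) (t : euclid R d) : R :=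
  expR (- ka b * dot t t) * h (ga b * dot t t).

Lemma mehler1 b z (s : R) : 0 < b -> 0 <= z < 1 ->
  (\int[normal_prob 0 b]_t (expR (s * t - (s ^+ 2 + t ^+ 2) / 2) *
     (expR (- ka b * t ^+ 2) * lagF (2^-1) z (ga b * t ^+ 2)))%:E =
   ((1 - q b) * (expR (- ka b * s ^+ 2) *
     lagF (2^-1) (q b ^+ 2 * z) (ga b * s ^+ 2)))%:E)%E.
Proof.
move=> b0 /andP[z0 z1]; have /andP[q0 q1] := q_gt0_lt1 b0.
have bq := sqr_beta b0.
set Q := q b in q0 q1 bq *; have q1' : 0 < 1 - Q by rewrite subr_gt0.
have z1' : 0 < 1 - z by rewrite subr_gt0.
have Q21 : Q ^+ 2 < 1 by rewrite expr_lt1// ltW.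
have rz : 0 < 1 - Q ^+ 2 * z.
  by rewrite subr_gt0 mulr_ilt1// sqr_ge0.
have bE : b ^+ 2 = Q / (1 - Q) ^+ 2.
  by rewrite -[X in X / _]bq mulfK// expf_neq0 // gt_eqF.
pose al := 2^-1 + ka b + ga b * (z / (1 - z)).
(* What [ka] and [ga] are made for: the factor 1 - z cancels against that of [lagF], and 1 - q^2 z,
   which belongs to the generating function at q^2 z, takes its place. *)
have DE : 1 + 2 * al * b ^+ 2 = (1 - Q ^+ 2 * z) / ((1 - Q) ^+ 2 * (1 - z)).
  by rewrite bE /al /ka /ga -/Q; field; rewrite !gt_eqF.
have D0 : 0 < 1 + 2 * al * b ^+ 2 by rewrite DE divr_gt0// mulr_gt0// exprn_gt0.
pose c := - (2^-1) * ln (1 - z) - s ^+ 2 / 2.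
transitivity (\int[normal_prob 0 b]_t ((expR c)%:E * (expR (s * t - al * t ^+ 2))%:E))%E.
  apply: eq_integral => t _; rewrite -EFinM /lagF -!expRD; congr EFin; congr expR.
  by rewrite /c /al; field; rewrite gt_eqF.
transitivity ((expR c)%:E * \int[normal_prob 0 b]_t (expR (s * t - al * t ^+ 2))%:E)%E.
  apply: ge0_integralZl_EFin => //.
  apply/measurable_EFinP/measurableT_comp => //.
  by apply: measurable_funB; apply: measurable_funM.
have lnD : ln (1 + 2 * al * b ^+ 2) =
    ln (1 - Q ^+ 2 * z) - (2 * ln (1 - Q) + ln (1 - z)).
  rewrite DE lnM ?posrE ?invr_gt0 ?mulr_gt0 ?exprn_gt0//.
  rewrite lnV ?posrE ?mulr_gt0 ?exprn_gt0//.
  by rewrite lnM ?posrE ?exprn_gt0// lnXn// mulr2n; ring.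
rewrite ge0_integral_normal_expR// -EFinM lnD; congr EFin.
rewrite -[X in _ = X * _](@lnK _ (1 - Q)) ?posrE//.
rewrite /lagF -!expRD; congr expR.
rewrite DE /c bE /ka /ga -/Q.
move: (ln _) (ln _) (ln _) => l1 l2 l3.
by field; rewrite !gt_eqF//.
Qed.

(** The generating function is multiplicative in the pair (b, X). This reduces dimension d, with b =
    d/2, to one dimension, with b = 1/2. *)
Lemma lagF_prod d z (x : 'I_d -> R) (g : R) :
  lagF (d%:R / 2) z (g * \sum_i x i) = \prod_i lagF (2^-1) z (g * x i).
Proof.
rewrite /lagF -expR_sum; congr expR; rewrite sumrB sumr_const card_ord.
by rewrite -mulr_natl mulr_sumr mulr_suml; ring.
Qed.

Lemma dot_self d (s : euclid R d) : dot s s = \sum_(i < d) (tnth s i : R) ^+ 2.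
Proof. by apply: eq_bigr => i _; rewrite expr2. Qed.

Lemma ge0_integral_gker d b z (s : euclid R d) : 0 < b -> 0 <= z < 1 ->
  (\int[gauss b d]_t (gker s t * gprof b (lagF (d%:R / 2) z) t)%:E =
   ((1 - q b) ^+ d * gprof b (lagF (d%:R / 2) (q b ^+ 2 * z)) s)%:E)%E.
Proof.
move=> b0 z01; pose g (i : 'I_d) (t : R) : R :=
   expR ((tnth s i : R) * t - ((tnth s i : R) ^+ 2 + t ^+ 2) / 2) *
     (expR (- ka b * t ^+ 2) * lagF (2^-1) z (ga b * t ^+ 2)).
have mg i : measurable_fun setT (g i).
  rewrite /g /lagF.
  apply: measurable_funM.
    apply: measurableT_comp => //; apply: measurable_funB; apply: measurable_funM => //.
    by apply: measurable_funD.
  apply: measurable_funM; apply: measurableT_comp => //; first exact: measurable_funM.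
  apply: measurable_funB => //; apply: measurable_funM => //; exact: measurable_funM.
transitivity (\int[gauss b d]_t (\prod_(i < d) g i (tnth t i))%:E)%E.
  apply: eq_integral => t _; congr EFin.
  rewrite /g /gprof /gker !big_split /= -!expR_sum !dot_self lagF_prod.
  congr (_ * (_ * _)).
  - by congr expR; rewrite sumrB -mulr_suml big_split.
  - by congr expR; rewrite mulr_sumr.
  - by rewrite expR_sum.
rewrite (@ge0_integral_gauss_prod _ b d g (fun i =>
  (1 - q b) * (expR (- ka b * (tnth s i : R) ^+ 2) *
    lagF (2^-1) (q b ^+ 2 * z) (ga b * (tnth s i : R) ^+ 2))))//.
- rewrite /gprof !big_split /= prodr_const card_ord -expR_sum dot_self.
  by rewrite lagF_prod mulr_sumr.
- by move=> i x; rewrite /g !mulr_ge0 ?expR_ge0.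
- by move=> i; apply: mehler1.
Qed.

End mehler.

(** * The Gaussian kernel operator on radial functions *)

Section gker.
Context {R : realType} {d : nat}.
Implicit Types (b : R) (s t : euclid R d).

Lemma gker_gt0 s t : 0 < gker s t.
Proof. exact: expR_gt0. Qed.

Lemma gker_le1 s t : gker s t <= 1.
Proof.
rewrite /gker -[leRHS]expR0 ler_expR subr_le0.
by rewrite (le_trans (ler_norm _))// normr_dot_le.
Qed.

Lemma measurable_dotl s : measurable_fun setT (fun t : euclid R d => dot s t).
Proof. by apply: measurable_dot => //; exact: measurable_cst. Qed.

Lemma measurable_dotself : measurable_fun setT (fun t : euclid R d => dot t t).
Proof. by apply: measurable_dot. Qed.

Lemma measurable_gker s : measurable_fun setT (gker s).
Proof.
apply: measurableT_comp => //; apply: measurable_funB; first exact: measurable_dotl.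
apply: measurable_funM => //; apply: measurable_funD => //.
exact: measurable_dotself.
Qed.

Lemma measurable_gprof b (h : R -> R) : measurable_fun setT h ->
  measurable_fun setT (gprof b h : euclid R d -> R).
Proof.
move=> mh; apply: measurable_funM.
  apply: measurableT_comp => //; apply: measurable_funM => //.
  exact: measurable_dotself.
apply: (measurableT_comp mh); apply: measurable_funM => //; exact: measurable_dotself.
Qed.

Lemma integrable_bounded b (f : euclid R d -> R) (C : R) :
  measurable_fun setT f -> (forall t, `|f t| <= C) ->
  (gauss b d).-integrable setT (EFin \o f).
Proof.
move=> mf fC; apply: measurable_bounded_integrable => //.
  exact: (le_lt_trans (probability_le1 (gauss b d) measurableT) (ltry 1)).
exists C; split; first exact: num_real.
by move=> M CM t _; apply: (le_trans (fC t)); exact: ltW.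
Qed.

Lemma integrable_boundedM b (g f : euclid R d -> R) (C : R) :
  measurable_fun setT g -> (forall t, `|g t| <= C) ->
  (gauss b d).-integrable setT (EFin \o f) ->
  (gauss b d).-integrable setT (EFin \o (fun t => g t * f t)).
Proof.
move=> mg gC fi.
have mf : measurable_fun setT f by apply/measurable_EFinP; exact: measurable_int fi.
apply: (le_integrable measurableT _ _ (integrableZl measurableT C (integrable_abse fi))).
  by apply/measurable_EFinP; exact: measurable_funM.
move=> t _ /=; rewrite lee_fin normrM [leRHS]normrM normr_id ler_wpM2r//.
by apply: (le_trans (gC t)); exact: ler_norm.
Qed.

Lemma normr_Rintegral_le b (f : euclid R d -> R) (C : R) :
  measurable_fun setT f -> (forall t, `|f t| <= C) ->
  `|\int[gauss b d]_t f t| <= C.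
Proof.
move=> mf fC; have fi := integrable_bounded b mf fC.
apply: (le_trans (le_normr_Rintegral _ fi)) => //.
apply: (@le_trans _ _ (\int[gauss b d]_t (cst C t))).
  apply: le_Rintegral => //.
  - by apply: (integrable_abse fi).
  - apply: (@integrable_bounded b (cst C) `|C|) => //.
by rewrite Rintegral_cst//= (probability_setT (gauss b d)) mulr1.
Qed.

End gker.

(** * Profiles of admissible growth *)

Section tame.
Context {R : realType}.
Implicit Types (e C X : R) (h : R -> R) (N : nat).

(* Up to the change of variable X = ga b * |t|^2, being tame of rate
   ka b / ga b means that gprof b h is bounded. *)
Definition tame e h := measurable_fun setT h /\
  exists C, forall X, 0 <= X -> `|h X| <= C * expR (e * X).

Lemma tameZ e c h : tame e h -> tame e (fun X => c * h X).
Proof.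
move=> [mh [C H]]; split; first exact: measurable_funM.
exists (`|c| * C) => X X0; rewrite normrM -mulrA ler_wpM2l//; exact: H.
Qed.

Lemma tameD e h1 h2 : tame e h1 -> tame e h2 -> tame e (fun X => h1 X + h2 X).
Proof.
move=> [mh1 [C1 H1]] [mh2 [C2 H2]]; split; first exact: measurable_funD.
exists (C1 + C2) => X X0; apply: (le_trans (ler_normD _ _)).
by rewrite mulrDl; apply: lerD; [exact: H1|exact: H2].
Qed.

Lemma tameB e h1 h2 : tame e h1 -> tame e h2 -> tame e (fun X => h1 X - h2 X).
Proof.
move=> t1 /(tameZ (-1)) t2; have := tameD t1 t2.
by congr tame; apply/funext => X; rewrite mulN1r.
Qed.

Lemma tame0 e : tame e (fun=> 0).
Proof. by split => //; exists 0 => X _; rewrite normr0 mul0r. Qed.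

Lemma tame_sum e n (h : nat -> R -> R) : (forall i, tame e (h i)) ->
  tame e (fun X => \sum_(i < n) h i X).
Proof.
move=> th; elim: n => [|n IH].
  by have := tame0 e; congr tame; apply/funext => X; rewrite big_ord0.
have := tameD IH (th n); congr tame; apply/funext => X.
by rewrite big_ord_recr.
Qed.

Lemma tame_poly e h C N : 0 < e -> measurable_fun setT h ->
  (forall X, 0 <= X -> `|h X| <= C * (1 + X) ^+ N) -> tame e h.
Proof.
move=> e0 mh H; split => //; have [D D0 HD] := expr1D_le_expR N e0.
have C0 : 0 <= C.
  by have := le_trans (normr_ge0 _) (H 0 (lexx 0)); rewrite addr0 expr1n mulr1.
exists (C * D) => X X0; apply: (le_trans (H X X0)).
by rewrite -mulrA ler_wpM2l// HD.
Qed.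

Lemma measurable_lagF b z : measurable_fun setT (lagF b z : R -> R).
Proof.
apply: measurableT_comp => //; apply: measurable_funB => //.
exact: measurable_funM.
Qed.

Lemma measurable_lag n b : measurable_fun setT (lag n b : R -> R).
Proof.
elim: n b => [|n IH] b; first exact: measurable_cst.
by apply: measurable_funM => //; apply: measurable_funB; apply: measurable_funM.
Qed.

Lemma tame_lagF e b z : 0 < e -> 0 <= b -> 0 <= z < 1 -> tame e (lagF b z).
Proof.
move=> e0 b0 /andP[z0 z1].
apply: (@tame_poly e _ (lagF b z 0) 0) => //; first exact: measurable_lagF.
move=> X X0; rewrite expr0 mulr1 gtr0_norm ?lagF_gt0// lagF_le//.
by rewrite z0 lexx.
Qed.

Lemma tame_mulX e h : 0 < e -> measurable_fun setT h ->
  (exists C, forall X, 0 <= X -> `|h X| <= C) -> tame e (fun X => X * h X).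
Proof.
move=> e0 mh [C H]; apply: (@tame_poly e _ C 1) => //.
  exact: measurable_funM.
move=> X X0; rewrite normrM ger0_norm// expr1 mulrC.
have C0 : 0 <= C by apply: le_trans (H 0 (lexx 0)).
by apply: ler_pM => //; [exact: H|rewrite lerDr].
Qed.

Lemma tame_lagF' e b z : 0 < e -> 0 <= b -> 0 <= z < 1 -> tame e (lagF' b z).
Proof.
move=> e0 b0 z01; have /andP[z0 z1] := z01; apply: tameB.
  by apply: tameZ; apply: tame_lagF => //; rewrite addr_ge0.
apply: tame_mulX => //; first exact: measurable_lagF.
exists (lagF (b + 2) z 0) => X X0; rewrite gtr0_norm ?lagF_gt0//.
by rewrite lagF_le// ?addr_ge0// z0 lexx.
Qed.

Lemma tame_lag e n b : 0 < e -> tame e (lag n b).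
Proof.
move=> e0; have [C [N H]] : exists C N, forall X, 0 <= X ->
    `|lag n b X| <= C * (1 + X) ^+ N.
  suff : exists2 C, 0 <= C & forall X, 0 <= X -> `|lag n b X| <= C * 1 * (1 + X) ^+ n.
    by move=> [C _ H]; exists (C * 1), n.
  elim: n b => [|n IH] b.
    by exists 1 => // X _; rewrite /= normr1 expr0 !mulr1.
  have [C1 C10 H1] := IH (b + 1); have [C2 C20 H2] := IH (b + 2).
  exists (`|b| * C1 + C2); first by rewrite addr_ge0 ?mulr_ge0.
  move=> X X0; have h : `|b * lag n (b + 1) X - X * lag n (b + 2) X| <=
      (`|b| * C1 + C2) * 1 * (1 + X) ^+ n.+1.
    (* [normr_lag_rec_le] wants a nonnegative coefficient, so the sign of b is moved into its first
       argument. *)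
    have -> : `|b * lag n (b + 1) X - X * lag n (b + 2) X| =
       `| `|b| * (Num.sg b * lag n (b + 1) X) - X * lag n (b + 2) X|.
      by rewrite mulrA [`|b| * _]mulrC -numEsg.
    apply: normr_lag_rec_le => //; last exact: H2.
    rewrite normrM; apply: (le_trans _ (H1 X X0)).
    by rewrite ler_piMl// normr_sg; case: (b != 0).
  rewrite /= normrM (ger0_norm (_ : 0 <= n.+1%:R^-1)) ?invr_ge0//.
  apply: (le_trans _ h); rewrite ler_piMr//.
  by rewrite invf_le1 ?ler1n.
by apply: (tame_poly e0 (measurable_lag n b) H).
Qed.

Lemma tame_lagU e m b z : 0 < e -> 0 <= b -> 0 <= z < 1 -> tame e (lagU m b z).
Proof.
move=> e0 b0 z01; apply: tameB.
  by apply: tameB; apply: tameZ; [exact: tame_lagF'|exact: tame_lagF].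
apply: (@tame_sum e m (fun n X => (n%:R - m%:R) * lag n b X * z ^+ n)) => n.
have := tameZ ((n%:R - m%:R) * z ^+ n) (tame_lag n b e0).
by congr tame; apply/funext => X; ring.
Qed.

End tame.

(** * Boundedness and linearity of G on tame profiles *)

Section operator_profile.
Context {R : realType} {d : nat} (b : R) (b0 : 0 < b).
Implicit Types (s t : euclid R d) (h : R -> R) (X z C : R).

Let e := ka b / ga b.
Let e0 : 0 < e. Proof. by rewrite divr_gt0// ?ka_gt0// ga_gt0. Qed.

Lemma normr_gprof_le h C t : (forall X, 0 <= X -> `|h X| <= C * expR (e * X)) ->
  `|gprof b h t| <= C.
Proof.
move=> H; rewrite /gprof normrM ger0_norm ?expR_ge0// mulrC.
have g0 := ga_gt0 b0.
have X0 : 0 <= ga b * dot t t by rewrite mulr_ge0 ?(ltW g0)// dot_ge0.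
rewrite mulNr expRN ler_pdivrMr ?expR_gt0//.
have := H _ X0; congr (_ <= _ * expR _).
by rewrite /e; field; rewrite gt_eqF.
Qed.

Definition gker_op s h : R := \int[gauss b d]_t (gker s t * gprof b h t).

Lemma integrable_gker_op s h : tame e h ->
  (gauss b d).-integrable setT (EFin \o (fun t => gker s t * gprof b h t)).
Proof.
move=> [mh [C H]]; apply: (@integrable_bounded _ _ _ _ C).
  by apply: measurable_funM; [exact: measurable_gker|exact: measurable_gprof].
move=> t; rewrite normrM ger0_norm ?(ltW (gker_gt0 _ _))//.
rewrite -[leRHS]mul1r; apply: ler_pM => //; first exact: ltW (gker_gt0 _ _).
  exact: gker_le1.
exact: normr_gprof_le.
Qed.

Lemma gker_op_le s h C : measurable_fun setT h ->
  (forall X, 0 <= X -> `|h X| <= C * expR (e * X)) -> `|gker_op s h| <= C.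
Proof.
move=> mh H; apply: normr_Rintegral_le.
  by apply: measurable_funM; [exact: measurable_gker|exact: measurable_gprof].
move=> t; rewrite normrM ger0_norm ?(ltW (gker_gt0 _ _))//.
rewrite -[leRHS]mul1r; apply: ler_pM => //; first exact: ltW (gker_gt0 _ _).
  exact: gker_le1.
exact: normr_gprof_le.
Qed.

Lemma gker_opZ s c h : tame e h -> gker_op s (fun X => c * h X) = c * gker_op s h.
Proof.
move=> th; rewrite /gker_op -RintegralZl//; last exact: integrable_gker_op.
by apply: eq_Rintegral => t _; rewrite /gprof; ring.
Qed.

Lemma gker_opD s h1 h2 : tame e h1 -> tame e h2 ->
  gker_op s (fun X => h1 X + h2 X) = gker_op s h1 + gker_op s h2.
Proof.
move=> t1 t2; rewrite /gker_op -RintegralD//; [|exact: integrable_gker_op..].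
by apply: eq_Rintegral => t _; rewrite /gprof; ring.
Qed.

Lemma gker_opB s h1 h2 : tame e h1 -> tame e h2 ->
  gker_op s (fun X => h1 X - h2 X) = gker_op s h1 - gker_op s h2.
Proof.
move=> t1 t2; have -> : (fun X => h1 X - h2 X) = (fun X => h1 X + (-1) * h2 X).
  by apply/funext => X; rewrite mulN1r.
by rewrite gker_opD// ?gker_opZ ?mulN1r//; exact: tameZ.
Qed.

Lemma gker_op_sum s n (h : nat -> R -> R) : (forall i, tame e (h i)) ->
  gker_op s (fun X => \sum_(i < n) h i X) = \sum_(i < n) gker_op s (h i).
Proof.
move=> th; elim: n => [|n IH].
  rewrite big_ord0 -[RHS](mul0r (gker_op s (h 0%N))) -gker_opZ//.
  by congr gker_op; apply/funext => X; rewrite big_ord0 mul0r.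
rewrite big_ord_recr -IH /= -gker_opD//; last exact: tame_sum.
by congr gker_op; apply/funext => X; rewrite big_ord_recr.
Qed.

Let a : R := d%:R / 2.
Let a0 : 0 <= a. Proof. by rewrite divr_ge0. Qed.

Lemma gker_op_lagF s z : 0 <= z < 1 ->
  gker_op s (lagF a z) = (1 - q b) ^+ d * gprof b (lagF a (q b ^+ 2 * z)) s.
Proof. by move=> z01; rewrite /gker_op /Rintegral ge0_integral_gker. Qed.

End operator_profile.

(** * Second-order expansion of the generating function in z *)

Section taylor.
Context {R : realType}.
Implicit Types (b z r X C : R).

Lemma lagF'_le b r : 0 <= b -> 0 < r < 1 -> exists2 C, 0 <= C &
  forall z X, 0 <= z <= r -> 0 <= X -> `|lagF' b z X| <= C * (1 + X).
Proof.
move=> b0 /andP[r0 r1].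
exists (b * lagF (b + 1) r 0 + lagF (b + 2) r 0).
  by rewrite addr_ge0// ?mulr_ge0// ltW// lagF_gt0.
move=> z X zr X0; rewrite -[X in _ <= X * _]mulr1 -[1 + X]expr1 /lagF'.
apply: normr_lag_rec_le; rewrite ?expr0 ?mulr1// ?(ltW (lagF_gt0 _ _ _))//.
  by rewrite gtr0_norm ?lagF_gt0// lagF_le// addr_ge0.
by rewrite gtr0_norm ?lagF_gt0// lagF_le// addr_ge0.
Qed.

Lemma is_derive_shift (f : R -> R) (df z h : R) :
  is_derive (z + h) 1 f df -> is_derive h 1 (fun h => f (z + h)) df.
Proof.
move=> d1; have d2 : is_derive h 1 (fun h : R => z + h) 1.
  by apply: is_derive_eq; rewrite /GRing.scale/=; ring.
have := @is_derive1_comp R f (fun h => z + h) h _ _ d1 d2.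
by move=> d3; apply: (is_derive_eq d3); rewrite /GRing.scale /= mulr1.
Qed.

Lemma lagF_taylor2 b z : 0 <= b -> 0 <= z < 1 -> exists2 C, 0 <= C &
  forall h X, 0 <= h <= (1 - z) / 2 -> 0 <= X ->
    `|lagF b (z + h) X - lagF b z X - h * lagF' b z X| <= C * (1 + X) ^+ 2 * h ^+ 2.
Proof.
move=> b0 /andP[z0 z1]; pose r := (1 + z) / 2.
have r01 : 0 < r < 1 by rewrite /r; apply/andP; split; lra.
have [C1 C10 H1] := lagF'_le (addr_ge0 b0 ler01) r01.
have [C2 C20 H2] := lagF'_le (addr_ge0 b0 (ler0n _ 2)) r01.
exists (b * C1 + C2); first by rewrite addr_ge0// mulr_ge0.
move=> h X hz X0.
have zh y : 0 <= y <= (1 - z) / 2 -> z + y < 1 by move=> /andP[y0 y1]; lra.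
have H3 y : 0 <= y <= (1 - z) / 2 -> `|lagF' b (z + y) X - lagF' b z X| <=
    (b * C1 + C2) * (1 + X) ^+ 2 * y ^+ 1.
  move=> yz; apply: (@is_derive_normr_le _ (fun y => lagF' b (z + y) X - lagF' b z X)
    (fun y => b * lagF' (b + 1) (z + y) X - X * lagF' (b + 2) (z + y) X)
    ((1 - z) / 2) _ 0 _ _ _ _ yz).
  - move=> x xz; apply: is_derive_sub0.
    by apply: (@is_derive_shift (lagF' b ^~ X)); apply: is_derive_lagF'; exact: zh.
  - by rewrite addr0 subrr.
  - move=> x /andP[x0 xz]; rewrite expr0 mulr1 -[b * C1 + C2]mulr1.
    have xr : 0 <= z + x <= r by rewrite /r; apply/andP; split; lra.
    by apply: normr_lag_rec_le => //; rewrite mulr1 expr1; [exact: H1|exact: H2].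
apply: (@is_derive_normr_le _ (fun h => lagF b (z + h) X - lagF b z X - h * lagF' b z X)
    (fun y => lagF' b (z + y) X - lagF' b z X) ((1 - z) / 2) _ 1 _ _ _ _ hz).
- move=> x xz.
  have d1 : is_derive x 1 (fun y => lagF b (z + y) X - lagF b z X) (lagF' b (z + x) X).
    apply: is_derive_sub0.
    by apply: (@is_derive_shift (lagF b ^~ X)); apply: is_derive_lagF; exact: zh.
  have d2 := is_deriveZ (lagF' b z X) (is_derive_id x (1:R)).
  rewrite (_ : (fun _ => _) = (fun y => lagF b (z + y) X - lagF b z X) -
     ((lagF' b z X) \*: id)); last first.
    by apply/funext => y; rewrite /= [y * _]mulrC.
  have d3 := is_deriveB d1 d2.
  by apply: (is_derive_eq d3); rewrite /GRing.scale /=; ring.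
- by rewrite addr0 subrr mul0r subr0.
- exact: H3.
Qed.

End taylor.

(** * Action of G on Laguerre functions and on truncated generating functions *)

Section gker_profile.
Context {R : realType} {d : nat} (b : R) (b0 : 0 < b).
Implicit Types (s t : euclid R d) (h : R -> R) (X z C : R).

Let e := ka b / ga b.
Let e0 : 0 < e. Proof. by rewrite divr_gt0// ?ka_gt0// ga_gt0. Qed.
Let a : R := d%:R / 2.
Let a0 : 0 <= a. Proof. by rewrite divr_ge0. Qed.
Let c : R := (1 - q b) ^+ d.
Let r : R := q b ^+ 2.

Lemma rho_in : 0 < r < 1.
Proof.
have /andP[q0 q1] := q_gt0_lt1 b0.
by rewrite /r exprn_gt0//= expr_lt1// ltW.
Qed.

Let c_ge0 : 0 <= c.
Proof. by have /andP[q0 q1] := q_gt0_lt1 b0; rewrite exprn_ge0// subr_ge0 ltW. Qed.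

(** D is chosen before h and C, so powers of z, of the increment or of r contained in C survive the
    passage through G. *)
Lemma poly_exp_bound N : exists2 D, 0 <= D & forall h C, 0 <= C ->
  (forall X, 0 <= X -> `|h X| <= C * (1 + X) ^+ N) ->
  forall X, 0 <= X -> `|h X| <= C * D * expR (e * X).
Proof.
have [D D0 HD] := expr1D_le_expR N e0; exists D => // h C C0 H X X0.
by apply: (le_trans (H X X0)); rewrite -mulrA ler_wpM2l// HD.
Qed.

Lemma gprofZ (k : R) h s : gprof b (fun X => k * h X) s = k * gprof b h s.
Proof. by rewrite /gprof; ring. Qed.

Lemma gprofD h1 h2 s : gprof b (fun X => h1 X + h2 X) s = gprof b h1 s + gprof b h2 s.
Proof. by rewrite /gprof; ring. Qed.

Lemma gprof_sum n (h : nat -> R -> R) s :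
  gprof b (fun X => \sum_(i < n) h i X) s = \sum_(i < n) gprof b (h i) s.
Proof. by rewrite /gprof mulr_sumr. Qed.

Let rz z : 0 <= z < 1 -> 0 <= r * z < 1.
Proof.
have /andP[r0 r1] := rho_in; move=> /andP[z0 z1].
by rewrite mulr_ge0 ?(ltW r0)//= mulr_ilt1// ltW.
Qed.

(* Compare the Taylor coefficients at z = 0 in [gker_op_lagF]. *)
Lemma gker_op_lag s n : gker_op b s (lag n a) = c * r ^+ n * gprof b (lag n a) s.
Proof.
apply/eqP; rewrite -subr_eq0; apply/eqP.
have /andP[r0 r1] := rho_in.
have [C C0 H] := lagF_rem_le n.+1 a0 rho_in.
have [D D0 HD] := poly_exp_bound n.+1.
pose dd n := gker_op b s (lag n a) - c * r ^+ n * gprof b (lag n a) s.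
apply: (@poly_small_eq0 _ r n.+1 dd ((1 + c) * (C * D)) r0 _ n (ltnSn n)).
move=> z /andP[z0 zr].
have z01 : 0 <= z < 1 by rewrite (ltW z0) (le_lt_trans zr).
have trem y : 0 <= y < 1 -> tame e (lagF_rem n.+1 a y).
  move=> y01; apply: tameB; first exact: tame_lagF.
  apply: (@tame_sum _ e n.+1 (fun n X => lag n a X * y ^+ n)) => k.
  have := tameZ (y ^+ k) (tame_lag k a e0).
  by congr tame; apply/funext => X; rewrite mulrC.
have remB y : 0 <= y <= z -> forall X, 0 <= X ->
    `|lagF_rem n.+1 a y X| <= C * D * z ^+ n.+1 * expR (e * X).
  move=> /andP[y0 yz] X X0.
  have yr : 0 <= y <= r by rewrite y0 (le_trans yz).
  rewrite [C * D * _]mulrAC; apply: HD X0.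
    by rewrite mulr_ge0// exprn_ge0// ltW.
  move=> Y Y0; apply: (le_trans (H _ _ yr Y0)).
  rewrite ler_wpM2r ?exprn_ge0 ?addr_ge0// ler_wpM2l// lerXn2r// nnegrE// (le_trans y0)//.
have FE y : lagF a y =
    (fun X => \sum_(k < n.+1) y ^+ k * lag k a X + lagF_rem n.+1 a y X).
  apply/funext => X; rewrite /lagF_rem.
  under eq_bigr do rewrite mulrC.
  by ring.
have tlz y k : tame e (fun X => y ^+ k * lag k a X) by apply: tameZ; exact: tame_lag.
have := @gker_op_lagF R d b b0 s z z01.
rewrite -/a -/c -/r (FE z) (FE (r * z)) gker_opD//; last 2 first.
- exact: (@tame_sum _ e n.+1 (fun k X => z ^+ k * lag k a X)).
- exact: trem.
rewrite (gker_op_sum b0 s n.+1 (tlz z)) gprofD.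
rewrite (gprof_sum n.+1 (fun k X => (r * z) ^+ k * lag k a X)) => E.
(* By Mehler's formula the discrepancies in degrees up to n are compensated by the two remainders,
   which are O(z^(n+1)). *)
have -> : \sum_(k < n.+1) dd k * z ^+ k =
   c * gprof b (lagF_rem n.+1 a (r * z)) s - gker_op b s (lagF_rem n.+1 a z).
  have E1 : \sum_(k < n.+1) dd k * z ^+ k =
     \sum_(k < n.+1) gker_op b s (fun X => z ^+ k * lag k a X) -
     c * \sum_(k < n.+1) gprof b (fun X => (r * z) ^+ k * lag k a X) s.
    rewrite mulr_sumr -sumrB; apply: eq_bigr => k _.
    rewrite gker_opZ//; last exact: tame_lag.
    by rewrite gprofZ /dd (exprMn k r z); ring.
  by rewrite E1; move: E; rewrite mulrDr; lra.
rewrite [_ - _]addrC mulrDl mul1r mulrDl.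
apply: (le_trans (ler_normD _ _)); apply: lerD.
  rewrite normrN; apply: gker_op_le => //; first by have [] := trem z z01.
  by apply: remB; rewrite (ltW z0) lexx.
rewrite normrM ger0_norm// -[c * (C * D) * _]mulrA ler_wpM2l//.
apply: (normr_gprof_le b0); apply: remB.
by rewrite mulr_ge0 ?(ltW r0) ?(ltW z0)//= ler_piMl ?(ltW z0)// ltW.
Qed.

(* Differentiate [gker_op_lagF] in z. *)
Lemma gker_op_lagF' s z : 0 <= z < 1 ->
  gker_op b s (lagF' a z) = c * r * gprof b (lagF' a (r * z)) s.
Proof.
move=> z01; have /andP[z0 z1] := z01.
apply/eqP; rewrite -subr_eq0; apply/eqP.
have /andP[r0 r1] := rho_in.
have rz01 := rz z01; have /andP[rz0 rz1] := rz01.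
have [C C0 H] := lagF_taylor2 a0 z01.
have [C' C'0 H'] := lagF_taylor2 a0 rz01.
have [D D0 HD] := poly_exp_bound 2.
pose h0 := (1 - z) / 2.
have h00 : 0 < h0 by rewrite /h0; lra.
apply: (@normr_le_linear_eq0 _ _ (C * D + c * (C' * D)) h0 h00) => h /andP[hp hh].
have zh01 : 0 <= z + h < 1 by rewrite /h0 in hh; apply/andP; split; lra.
have rh : 0 <= r * h <= (1 - r * z) / 2.
  rewrite mulr_ge0 ?(ltW r0) ?(ltW hp)//=.
  have : r * h <= h by rewrite ler_piMl ?(ltW hp)// ltW.
  have : r * z <= z by rewrite ler_piMl// ltW.
  by rewrite /h0 in hh; lra.
pose R2 (z h X : R) := lagF a (z + h) X - lagF a z X - h * lagF' a z X.
have tR2 : tame e (R2 z h).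
  apply: tameB; first by apply: tameB; exact: tame_lagF.
  by apply: tameZ; exact: tame_lagF'.
have LR : gker_op b s (R2 z h) =
    gker_op b s (lagF a (z + h)) - gker_op b s (lagF a z) - h * gker_op b s (lagF' a z).
  rewrite gker_opB//.
  - by rewrite gker_opB ?gker_opZ//; [exact: tame_lagF'|exact: tame_lagF|exact: tame_lagF].
  - by apply: tameB; exact: tame_lagF.
  - by apply: tameZ; exact: tame_lagF'.
have GR : gprof b (R2 (r * z) (r * h)) s = gprof b (lagF a (r * (z + h))) s -
   gprof b (lagF a (r * z)) s - r * h * gprof b (lagF' a (r * z)) s.
  rewrite /gprof /R2 [r * (z + h)]mulrDr; ring.
have E1 := @gker_op_lagF R d b b0 s z z01.
have E2 := @gker_op_lagF R d b b0 s _ zh01.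
move: E1 E2; rewrite -/a -/c -/r => E1 E2.
(* Mehler's formula at z and z + h cancels the increments; second-order remainders are left, so the
   defect is O(h). *)
have EE : h * (gker_op b s (lagF' a z) - c * r * gprof b (lagF' a (r * z)) s) =
   c * gprof b (R2 (r * z) (r * h)) s - gker_op b s (R2 z h).
  by rewrite LR GR E1 E2; ring.
have B1 : `|gker_op b s (R2 z h)| <= C * h ^+ 2 * D.
  apply: gker_op_le => //; first by have [] := tR2.
  apply: HD; first by rewrite mulr_ge0// sqr_ge0.
  by move=> X X0; rewrite mulrAC; apply: H => //; rewrite (ltW hp).
have B2 : `|gprof b (R2 (r * z) (r * h)) s| <= C' * h ^+ 2 * D.
  apply: (normr_gprof_le b0).
  apply: HD; first by rewrite mulr_ge0// sqr_ge0.
  move=> X X0; have hX := H' _ _ rh X0; rewrite -/(R2 (r * z) (r * h) X) in hX.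
  apply: (le_trans hX); rewrite [leRHS]mulrAC; apply: ler_wpM2l.
    by rewrite mulr_ge0// exprn_ge0// addr_ge0.
  rewrite (exprMn 2 r h); apply: ler_piMl; first exact: sqr_ge0.
  by rewrite exprn_ile1// ltW.
rewrite -(ler_pM2l hp) -{1}(gtr0_norm hp) -normrM EE.
apply: (le_trans (ler_normB _ _)); rewrite normrM (ger0_norm c_ge0).
apply: (le_trans (lerD (ler_wpM2l c_ge0 B2) B1)).
by rewrite le_eqVlt; apply/orP; left; apply/eqP; ring.
Qed.

(** z d/dz commutes with the dilation z -> r z, and the subtracted terms are eigenfunctions; so
    [lagU] transforms as [lagF] does. *)
Lemma gker_op_lagU s m z : 0 <= z < 1 ->
  gker_op b s (lagU m a z) = c * gprof b (lagU m a (r * z)) s.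
Proof.
move=> z01.
have t1 : tame e (lagF a z) by exact: tame_lagF.
have t2 : tame e (lagF' a z) by exact: tame_lagF'.
have t3 k : tame e (fun X => (k%:R - m%:R) * z ^+ k * lag k a X).
  by apply: tameZ; exact: tame_lag.
have UE y : lagU m a y = (fun X => y * lagF' a y X - m%:R * lagF a y X -
    \sum_(k < m) ((k%:R - m%:R) * y ^+ k * lag k a X)).
  apply/funext => X; rewrite /lagU; congr (_ - _).
  by apply: eq_bigr => k _; ring.
rewrite UE gker_opB//; last 2 first.
- by apply: tameB; exact: tameZ.
- exact: (@tame_sum _ e m (fun k X => (k%:R - m%:R) * z ^+ k * lag k a X)).
rewrite gker_opB//; [|exact: tameZ..].
rewrite !gker_opZ// gker_op_lagF' // gker_op_lagF// -/a -/c -/r (gker_op_sum b0 s m t3).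
have -> : gprof b (lagU m a (r * z)) s = r * z * gprof b (lagF' a (r * z)) s -
    m%:R * gprof b (lagF a (r * z)) s -
    \sum_(k < m) gprof b (fun X => (k%:R - m%:R) * (r * z) ^+ k * lag k a X) s.
  by rewrite UE /gprof -mulr_sumr; ring.
have -> : \sum_(k < m) gker_op b s (fun X => (k%:R - m%:R) * z ^+ k * lag k a X) =
  c * \sum_(k < m) gprof b (fun X => (k%:R - m%:R) * (r * z) ^+ k * lag k a X) s.
  rewrite mulr_sumr; apply: eq_bigr => k _.
  rewrite gker_opZ//; last exact: tame_lag.
  by rewrite gprofZ gker_op_lag (exprMn k r z); ring.
by ring.
Qed.

End gker_profile.

Section shifted_profile.
Context {R : realType}.
Implicit Types (b z r X C : R).

(* [lagpart] after multiplying the term of degree n by r^n. *)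
Definition lagshift m b r N X : R :=
  \sum_(n < m) lagw m r n * r ^+ n * lag n b X +
  lagw_diag m b r * r ^+ m * lag m b X -
  \sum_(k < N) lagU m b (r * r ^+ k.+1) X / (r ^+ k.+1) ^+ m.

(** For n < m, (r^n - r^m) [lagw m r n] = (n - m) r^n, and the diagonal terms cancel. The k-th term
    of the shifted sum is r^m times [lagT] at k + 1, so the sums telescope to [lagU m b r X] minus
    the term of index N. Together these rebuild z d/dz - m of [lagF] at z = r. *)
Lemma lagshiftE m b r N X : 0 < r < 1 ->
  lagshift m b r N X - r ^+ m * lagpart m b r N X =
  r * lagF' b r X - m%:R * lagF b r X - r ^+ m * lagT m b r X N.
Proof.
move=> /andP[r0 r1]; have r0' : r != 0 by rewrite gt_eqF.
elim: N => [|N IH].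
  rewrite /lagshift /lagpart /lagT !big_ord0 !subr0 expr1.
  have -> : r ^+ m * (lagU m b r X / r ^+ m) = lagU m b r X.
    by rewrite mulrC divfK// expf_neq0.
  rewrite /lagU mulrDr mulr_sumr.
  have -> : \sum_(i < m) r ^+ m * (lagw m r i * lag i b X) =
    \sum_(n < m) lagw m r n * r ^+ n * lag n b X -
    \sum_(n < m) (n%:R - m%:R) * lag n b X * r ^+ n.
    rewrite -sumrB; apply: eq_bigr => i _.
    have im := ltn_ord i; have mi : r ^+ m = r ^+ (m - i) * r ^+ i.
      by rewrite -exprD subnK// ltnW.
    have ri : r ^+ (m - i) < 1.
      by rewrite exprn_ilt1 ?(ltW r0)// -lt0n subn_gt0.
    by rewrite /lagw mi; field; rewrite subr_eq0 gt_eqF.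
  ring.
move: IH; rewrite /lagshift /lagpart !big_ord_recr /=.
set S1 := \sum_(_ < _) _; set S2 := \sum_(_ < _) _.
set S3 := \sum_(_ < _) _; set S4 := \sum_(_ < _) _.
rewrite /lagT -!exprS (exprS r N.+1) => IH.
have e : r ^+ m * (lagU m b (r * r ^+ N.+1) X / (r * r ^+ N.+1) ^+ m) =
  lagU m b (r * r ^+ N.+1) X / (r ^+ N.+1) ^+ m.
  by rewrite (exprMn m r); field; rewrite !expf_neq0.
rewrite e; move: IH.
set A := _ / _; set B := _ / _; lra.
Qed.

End shifted_profile.

(** * The equation for G satisfied by the profile *)

Section profile_operator.
Context {R : realType} {d : nat} (b : R) (b0 : 0 < b) (d0 : (0 < d)%N).
Implicit Types (s t : euclid R d) (X z C : R).

Let e := ka b / ga b.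
Let e0 : 0 < e. Proof. by rewrite divr_gt0// ?ka_gt0// ga_gt0. Qed.
Let a : R := d%:R / 2.
Let a0 : 0 < a. Proof. by rewrite divr_gt0// ltr0n. Qed.
Let c : R := (1 - q b) ^+ d.
Let r : R := q b ^+ 2.
Let r01 : 0 < r < 1. Proof. exact: rho_in. Qed.
Let c_ge0 : 0 <= c.
Proof. by have /andP[q0 q1] := q_gt0_lt1 b0; rewrite exprn_ge0// subr_ge0 ltW. Qed.

(* The absolute value only matters for measurability on the negative axis,
   where the series defining [lagh] need not converge. *)
Definition eigprof m X := lagh m (d%:R / 2) (q b ^+ 2) `|X|.

Lemma tame_lagpart m N : tame e (lagpart m a r N).
Proof.
apply: tameB.
  apply: tameD; last by apply: tameZ; exact: tame_lag.
  apply: (@tame_sum _ e m (fun n X => lagw m r n * lag n a X)) => n.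
  by apply: tameZ; exact: tame_lag.
apply: (@tame_sum _ e N (fun k X => lagT m a r X k)) => k.
have /andP[z0 zr] := exprS_in k r01; have /andP[r0 r1] := r01.
have z01 : 0 <= r ^+ k.+1 < 1 by rewrite (ltW z0) (le_lt_trans zr).
have := tameZ ((r ^+ k.+1) ^- m) (tame_lagU m e0 (ltW a0) z01).
by congr tame; apply/funext => X; rewrite mulrC.
Qed.

Lemma measurable_eigprof m : measurable_fun setT (eigprof m).
Proof.
have [C C0 H] := lagh_tail m (ltW a0) r01.
apply: (measurable_fun_cvg (h := fun N X => lagpart m a r N `|X|)).
  move=> N; apply: (measurableT_comp (proj1 (tame_lagpart m N))).
  exact: normr_measurable.
move=> X _; apply/cvgrPdist_le => eps eps0.
have : geometric (C * (1 + `|X|) ^+ m.+1) r n @[n --> \oo] --> 0.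
  by apply: cvg_geometric; have /andP[r0 r1] := r01; rewrite gtr0_norm.
move=> /cvgrPdist_lt /(_ eps eps0); apply: filterS => N /=.
rewrite sub0r normrN => h; apply: (le_trans (H N `|X| (normr_ge0 _))).
by apply: (le_trans (ler_norm _)); exact: ltW.
Qed.

Lemma eigprof_tail m : exists2 C, 0 <= C & forall N X, 0 <= X ->
  `|eigprof m X - lagpart m a r N X| <= C * r ^+ N * expR (e * X).
Proof.
have [C C0 H] := lagh_tail m (ltW a0) r01.
have [D D0 HD] := poly_exp_bound b0 m.+1.
exists (C * D); first by rewrite mulr_ge0.
move=> N X X0; have /andP[r0 r1] := r01.
rewrite [C * D * _]mulrAC.
apply: (HD (fun X => eigprof m X - lagpart m a r N X)) X0.
  by rewrite mulr_ge0// exprn_ge0// ltW.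
move=> Y Y0 /=; rewrite /eigprof (ger0_norm Y0).
by apply: (le_trans (H N Y Y0)); rewrite mulrAC.
Qed.

Lemma tame_eigprof m : tame e (eigprof m).
Proof.
split; first exact: measurable_eigprof.
have [C C0 H] := eigprof_tail m; have [_ [C' H']] := tame_lagpart m 0.
exists (C + C') => X X0.
rewrite -(subrK (lagpart m a r 0 X) (eigprof m X)) mulrDl.
apply: (le_trans (ler_normD _ _)); apply: lerD; last exact: H'.
by have := H 0%N X X0; rewrite expr0 mulr1.
Qed.

Lemma gker_op_lagpart s m N :
  gker_op b s (lagpart m a r N) = c * gprof b (lagshift m a r N) s.
Proof.
have t1 n : tame e (fun X => lagw m r n * lag n a X).
  by apply: tameZ; exact: tame_lag.
have t2 : tame e (fun X => lagw_diag m a r * lag m a X).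
  by apply: tameZ; exact: tame_lag.
have zk k : 0 <= r ^+ k.+1 < 1.
  have /andP[z0 zr] := exprS_in k r01; have /andP[r0 r1] := r01.
  by rewrite (ltW z0) (le_lt_trans zr).
have t3 k : tame e (fun X => lagT m a r X k).
  have := tameZ ((r ^+ k.+1) ^- m) (tame_lagU m e0 (ltW a0) (zk k)).
  by congr tame; apply/funext => X; rewrite mulrC.
have t1' := @tame_sum _ e m _ t1.
have t3' := @tame_sum _ e N _ t3.
rewrite (@gker_opB _ d b b0 s _ _ (tameD t1' t2) t3') (@gker_opD _ d b b0 s _ _ t1' t2).
rewrite (gker_op_sum b0 s m t1) (gker_op_sum b0 s N t3).
have -> : \sum_(i < N) gker_op b s (fun X => lagT m a r X i) =
  c * \sum_(k < N) (gprof b (lagU m a (r * r ^+ k.+1)) s / (r ^+ k.+1) ^+ m).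
  rewrite mulr_sumr; apply: eq_bigr => k _; rewrite /lagT.
  rewrite (_ : (fun _ => _) =
    (fun X => (r ^+ k.+1) ^- m * lagU m a (r ^+ k.+1) X)); last first.
    by apply/funext => X; rewrite mulrC.
  rewrite gker_opZ//; last exact: (tame_lagU m e0 (ltW a0) (zk k)).
  by rewrite gker_op_lagU// -/a -/c -/r mulrC mulrA.
have -> : \sum_(i < m) gker_op b s (fun X => lagw m r i * lag i a X) =
  c * \sum_(n < m) lagw m r n * r ^+ n * gprof b (lag n a) s.
  rewrite mulr_sumr; apply: eq_bigr => n _.
  rewrite gker_opZ//; last exact: tame_lag.
  by rewrite gker_op_lag// -/a -/c -/r; ring.
rewrite gker_opZ//; last exact: tame_lag.
have -> : gprof b (lagshift m a r N) s =
    \sum_(n < m) lagw m r n * r ^+ n * gprof b (lag n a) s +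
    lagw_diag m a r * r ^+ m * gprof b (lag m a) s -
    \sum_(k < N) (gprof b (lagU m a (r * r ^+ k.+1)) s / (r ^+ k.+1) ^+ m).
  rewrite /lagshift /gprof mulrBr mulrDr !mulr_sumr; congr (_ + _ - _).
  - by apply: eq_bigr => n _; ring.
  - by ring.
  - by apply: eq_bigr => n _; ring.
by rewrite gker_op_lag// -/a -/c -/r; ring.
Qed.

Lemma gker_op_eigprof s m :
  gker_op b s (eigprof m) = c * r ^+ m * gprof b (eigprof m) s +
  c * gprof b (fun X => r * lagF' a r X - m%:R * lagF a r X) s.
Proof.
have /andP[r0 r1] := r01.
have [C C0 H] := eigprof_tail m.
have [D D0 HD] := lagT_le m (ltW a0) r01.
apply/eqP; rewrite -subr_eq0 -normr_le0.
pose Xs := ga b * dot s s.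
have Xs0 : 0 <= Xs by rewrite mulr_ge0 ?(ltW (ga_gt0 b0))// dot_ge0.
pose k := expR (- ka b * dot s s).
pose E := c * r ^+ m * (k * (D * (1 + Xs) ^+ m.+1)).
(* The three errors: G of the tail, c r^m times the tail itself, and the last telescoped term in
   [lagshiftE]. *)
apply: (@le_addgeo _ _ 0 (C + c * r ^+ m * C + E) r r01) => N; rewrite add0r.
have tl := tame_lagpart m N.
have L1 : gker_op b s (eigprof m) = gker_op b s (lagpart m a r N) +
    gker_op b s (fun X => eigprof m X - lagpart m a r N X).
  by rewrite (@gker_opB _ d b b0 s _ _ (tame_eigprof m) tl); ring.
have G1 : gprof b (eigprof m) s = gprof b (lagpart m a r N) s +
    gprof b (fun X => eigprof m X - lagpart m a r N X) s.
  by rewrite /gprof; ring.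
have S1 : gprof b (lagshift m a r N) s - r ^+ m * gprof b (lagpart m a r N) s =
   gprof b (fun X => r * lagF' a r X - m%:R * lagF a r X) s -
   r ^+ m * (k * lagT m a r Xs N).
  have := @lagshiftE R m a r N Xs r01; rewrite /gprof -/Xs -/k => h.
  have -> : k * lagshift m a r N Xs - r ^+ m * (k * lagpart m a r N Xs) =
    k * (lagshift m a r N Xs - r ^+ m * lagpart m a r N Xs) by ring.
  by rewrite h; ring.
rewrite L1 G1 gker_op_lagpart.
have -> : c * gprof b (lagshift m a r N) s +
   gker_op b s (fun X => eigprof m X - lagpart m a r N X) -
   (c * r ^+ m * (gprof b (lagpart m a r N) s +
     gprof b (fun X => eigprof m X - lagpart m a r N X) s) +
    c * gprof b (fun X => r * lagF' a r X - m%:R * lagF a r X) s) =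
   gker_op b s (fun X => eigprof m X - lagpart m a r N X) -
   c * r ^+ m * gprof b (fun X => eigprof m X - lagpart m a r N X) s -
   c * r ^+ m * (k * lagT m a r Xs N).
  move: S1; set p1 := gprof b (lagshift _ _ _ _) s; set p2 := gprof b (lagpart _ _ _ _) s.
  set p3 := gprof b (fun X => r * _ - _) s; set p4 := gprof b _ s.
  move=> S1; have -> : p1 = (p3 - r ^+ m * (k * lagT m a r Xs N)) + r ^+ m * p2.
    by rewrite -S1; ring.
  by ring.
rewrite !mulrDl.
have rm0 : 0 <= r ^+ m by rewrite exprn_ge0// ltW.
apply: (le_trans (ler_normB _ _)); apply: lerD.
  apply: (le_trans (ler_normB _ _)); apply: lerD.
    apply: (gker_op_le b0) => [|X X0]; last exact: H.
    by have [] := tameB (tame_eigprof m) tl.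
  rewrite normrM ger0_norm ?mulr_ge0// -[leRHS]mulrA ler_wpM2l ?mulr_ge0//.
  by apply: (normr_gprof_le b0) => X X0; exact: H.
rewrite /E normrM ger0_norm ?mulr_ge0// -[leRHS]mulrA ler_wpM2l ?mulr_ge0//.
rewrite normrM ger0_norm ?expR_ge0// -[leRHS]mulrA ler_wpM2l ?expR_ge0//.
exact: HD.
Qed.

End profile_operator.

(** * The truncated kernel *)

Section kernel_expansion.
Context {R : realType} {d : nat}.
Implicit Types (s t : euclid R d) (h C : R).

Definition gw0 s : R := expR (- (dot s s / 2)).

Definition scl h s : euclid R d := [tuple h * (tnth s i : R) | i < d].

Lemma dot_sclr h s t : dot (scl h s) t = h * dot s t.
Proof.
by rewrite /dot mulr_sumr; apply: eq_bigr => i _; rewrite tnth_mktuple mulrA.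
Qed.

Lemma dot_scl2 h s : dot (scl h s) (scl h s) = h ^+ 2 * dot s s.
Proof.
by rewrite /dot mulr_sumr; apply: eq_bigr => i _; rewrite !tnth_mktuple; ring.
Qed.

Lemma dot_tsub s t : dot (tsub s t) (tsub s t) = dot s s - 2 * dot s t + dot t t.
Proof.
rewrite /dot mulr_sumr -sumrB -big_split /=; apply: eq_bigr => i _.
by rewrite !tnth_mktuple; ring.
Qed.

Lemma gkerE s t : gker s t = expR (dot s t) * (gw0 s * gw0 t).
Proof. by rewrite /gker /gw0 -!expRD; congr expR; field. Qed.

Lemma K_gker s t : K s t = gker s t -
  (1 + dot s t + dot s t ^+ 2 / 2) * (gw0 s * gw0 t).
Proof.
rewrite /K !norm2_sqr dot_tsub /gker /gw0 -!expRD; congr (_ - _ * _).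
  by congr expR; field.
by congr expR; field.
Qed.

Lemma exp_taylor3 (u : R) h : 0 <= h <= 1 ->
  `|expR (h * u) - 1 - h * u - (h * u) ^+ 2 / 2| <= `|u| ^+ 3 * expR `|u| * h ^+ 3.
Proof.
move=> h01.
have dE (x : R) : is_derive x 1 (fun h : R => expR (h * u)) (u * expR (x * u)).
  have d1 : is_derive x 1 (fun h : R => h * u) u.
    by apply: is_derive_eq; rewrite /GRing.scale /=; ring.
  have := @is_derive1_comp R (@expR R) _ x _ _ (is_derive_expR _) d1.
  by move=> d2; apply: (is_derive_eq d2); rewrite /GRing.scale /= mulrC.
have dL (v x : R) : is_derive x 1 (fun h : R => h * v) v.
  by apply: is_derive_eq; rewrite /GRing.scale /=; ring.
have E0 (x : R) : 0 <= x <= 1 -> `|expR (x * u)| <= expR `|u|.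
  move=> /andP[x0 x1]; rewrite ger0_norm ?expR_ge0// ler_expR.
  by rewrite (le_trans (ler_norm _))// normrM ger0_norm// ler_piMl.
have H1 (x : R) : 0 <= x <= 1 -> `|expR (x * u) - 1| <= `|u| * expR `|u| * x ^+ 1.
  apply: (@is_derive_normr_le _ (fun x => expR (x * u) - 1) (fun x => u * expR (x * u)) 1 _ 0).
  - by move=> y _; apply: is_derive_sub0.
  - by rewrite mul0r expR0 subrr.
  - by move=> y y01; rewrite expr0 mulr1 normrM ler_wpM2l// E0.
have H2 (x : R) : 0 <= x <= 1 ->
    `|expR (x * u) - 1 - x * u| <= `|u| ^+ 2 * expR `|u| * x ^+ 2.
  apply: (@is_derive_normr_le _ (fun x => expR (x * u) - 1 - x * u)
    (fun x => u * (expR (x * u) - 1)) 1 _ 1).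
  - move=> y _; have := is_deriveB (is_derive_sub0 1 (dE y)) (dL u y).
    by move=> d3; apply: (is_derive_eq d3); ring.
  - by rewrite !mul0r expR0 !subrr.
  - move=> y y01; rewrite normrM exprS -!mulrA ler_wpM2l// !mulrA; exact: H1.
apply: (@is_derive_normr_le _ (fun x => expR (x * u) - 1 - x * u - (x * u) ^+ 2 / 2)
   (fun x => u * (expR (x * u) - 1 - x * u)) 1 _ 2 _ _ _ _ h01).
- move=> y _.
  have d4 : is_derive y 1 (fun x : R => (x * u) ^+ 2 / 2) (y * u ^+ 2).
    by apply: is_derive_eq; rewrite /GRing.scale /=; field.
  have := is_deriveB (is_deriveB (is_derive_sub0 1 (dE y)) (dL u y)) d4.
  by move=> d3; apply: (is_derive_eq d3); ring.
- by rewrite !mul0r expR0 !subrr expr0n /= mul0r subr0.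
- move=> y y01; rewrite normrM; have := ler_wpM2l (normr_ge0 u) (H2 y y01).
  by congr (_ <= _); ring.
Qed.

Lemma gw0_gt0 s : 0 < gw0 s. Proof. exact: expR_gt0. Qed.

Lemma gw0_le1 s : gw0 s <= 1.
Proof. by rewrite /gw0 -[leRHS]expR0 ler_expR oppr_le0 divr_ge0// dot_ge0. Qed.

(** 2 |s.t| <= 2 |s|^2 + |t|^2 / 2, and [gw0 t] absorbs the last term. The factor 2 leaves one
    exponential for a power of s.t and one for exp |s.t| itself. *)
Lemma exp2_dot_gw0 s t : expR (2 * `|dot s t|) * gw0 t <= expR (2 * dot s s).
Proof.
rewrite /gw0 -expRD ler_expR.
have := normr_dot_le (scl 2 s) t; rewrite dot_sclr dot_scl2 normrM.
by rewrite (ger0_norm (ler0n _ 2)); lra.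
Qed.

Lemma pow_le_expR k (x : R) : 0 <= x -> x ^+ k <= k`!%:R * expR x.
Proof.
case: k => [|k] x0.
  by rewrite expr0 fact0 mul1r -expR0 ler_expR.
rewrite mulrC -ler_pdivrMr ?ltr0n ?fact_gt0//.
by apply: le_trans (expR_ge1Dxn k x0); rewrite lerDr.
Qed.

Lemma dotX_gw0_le k s t : `|dot s t ^+ k * gw0 t| <= k`!%:R * expR (2 * dot s s).
Proof.
rewrite normrM normrX [`|gw0 t|]ger0_norm ?(ltW (gw0_gt0 t))//.
have h := @pow_le_expR k _ (normr_ge0 (dot s t)).
apply: (le_trans (ler_wpM2r (ltW (gw0_gt0 t)) h)).
rewrite -mulrA ler_wpM2l//; apply: le_trans (exp2_dot_gw0 s t).
by rewrite ler_wpM2r ?(ltW (gw0_gt0 t))// ler_expR ler_peMl// ler1n.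
Qed.

(** K (h s, t) is the third-order Taylor remainder of exp(h s.t) times two Gaussian factors, of
    which [gw0 t] makes the bound uniform in t. *)
Lemma K_scl_le s : exists2 C, 0 <= C & forall h t, 0 <= h <= 1 ->
  `|K (scl h s) t| <= C * h ^+ 3.
Proof.
exists (3`!%:R * expR (2 * dot s s)); first by rewrite mulr_ge0// expR_ge0.
move=> h t h01; rewrite K_gker gkerE dot_sclr.
set u := dot s t.
have -> : expR (h * u) * (gw0 (scl h s) * gw0 t) - (1 + h * u + (h * u) ^+ 2 / 2) *
    (gw0 (scl h s) * gw0 t) =
  gw0 (scl h s) * ((expR (h * u) - 1 - h * u - (h * u) ^+ 2 / 2) * gw0 t) by ring.
rewrite normrM ger0_norm ?(ltW (gw0_gt0 _))// -[leRHS]mul1r.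
apply: ler_pM => //; [exact: ltW (gw0_gt0 _)|exact: gw0_le1|].
rewrite normrM [`|gw0 t|]ger0_norm ?(ltW (gw0_gt0 t))//.
apply: (le_trans (ler_wpM2r (ltW (gw0_gt0 t)) (exp_taylor3 u h01))).
rewrite [leLHS]mulrAC; have /andP[h0 h1] := h01; rewrite ler_wpM2r ?exprn_ge0//.
have h3 := @pow_le_expR 3 _ (normr_ge0 u).
apply: (@le_trans _ _ (3`!%:R * expR `|u| * expR `|u| * gw0 t)).
  by rewrite ler_wpM2r ?(ltW (gw0_gt0 t))// ler_wpM2r ?expR_ge0.
rewrite -!mulrA ler_wpM2l//; apply: le_trans (exp2_dot_gw0 s t).
by rewrite mulrA -expRD [2 * _]mulr_natl mulr2n.
Qed.

Lemma measurable_gw0 : measurable_fun setT gw0.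
Proof.
apply: measurableT_comp => //; apply: measurableT_comp => //.
by apply: measurable_funM => //; exact: measurable_dotself.
Qed.

Variable b : R.

(** Homogeneous of degree k in s, so that scaling s separates the three parts of P f. *)
Definition moment k (f : euclid R d -> R) s : R :=
  \int[gauss b d]_t (dot s t ^+ k * gw0 t * f t).

Lemma integrable_moment k (f : euclid R d -> R) s :
  (gauss b d).-integrable setT (EFin \o f) ->
  (gauss b d).-integrable setT (EFin \o (fun t => dot s t ^+ k * gw0 t * f t)).
Proof.
apply: integrable_boundedM; last by move=> t; exact: dotX_gw0_le.
apply: measurable_funM; last exact: measurable_gw0.
by apply: measurable_funX; exact: measurable_dotl.
Qed.

Lemma moment_scl k (f : euclid R d -> R) h s :
  (gauss b d).-integrable setT (EFin \o f) ->
  moment k f (scl h s) = h ^+ k * moment k f s.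
Proof.
move=> fi; rewrite /moment -RintegralZl//; last exact: integrable_moment.
by apply: eq_Rintegral => t _; rewrite dot_sclr exprMn; ring.
Qed.

Lemma integrable_gkerM (f : euclid R d -> R) s :
  (gauss b d).-integrable setT (EFin \o f) ->
  (gauss b d).-integrable setT (EFin \o (fun t => gker s t * f t)).
Proof.
apply: (@integrable_boundedM _ _ _ _ _ 1); first exact: measurable_gker.
by move=> t; rewrite ger0_norm ?(ltW (gker_gt0 _ _))// gker_le1.
Qed.

Lemma intopE (f : euclid R d -> R) s :
  (gauss b d).-integrable setT (EFin \o f) ->
  intop b f s = \int[gauss b d]_t (gker s t * f t) -
    gw0 s * (moment 0 f s + moment 1 f s + moment 2 f s / 2).
Proof.
move=> fi.
have i0 := integrable_moment 0 s fi.
have i1 := integrable_moment 1 s fi.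
have i2 := integrable_moment 2 s fi.
have ig := integrable_gkerM s fi.
rewrite /moment.
have i01 : (gauss b d).-integrable setT (EFin \o (fun t =>
  dot s t ^+ 0 * gw0 t * f t + dot s t ^+ 1 * gw0 t * f t)).
  exact: (integrableD measurableT i0 i1).
have i2' : (gauss b d).-integrable setT
    (EFin \o (fun t => 2^-1 * (dot s t ^+ 2 * gw0 t * f t))).
  exact: (integrableZl measurableT 2^-1 i2).
have i012 : (gauss b d).-integrable setT (EFin \o (fun t =>
  dot s t ^+ 0 * gw0 t * f t + dot s t ^+ 1 * gw0 t * f t +
  2^-1 * (dot s t ^+ 2 * gw0 t * f t))).
  exact: (integrableD measurableT i01 i2').
have iz : (gauss b d).-integrable setT (EFin \o (fun t => gw0 s * (
  dot s t ^+ 0 * gw0 t * f t + dot s t ^+ 1 * gw0 t * f t +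
  2^-1 * (dot s t ^+ 2 * gw0 t * f t)))).
  exact: (integrableZl measurableT (gw0 s) i012).
rewrite [_ / 2]mulrC -RintegralZl// -RintegralD// -RintegralD// -RintegralZl// -RintegralB//.
by apply: eq_Rintegral => t _; rewrite K_gker expr0 expr1; ring.
Qed.

Lemma normr_intop_scl_le (f : euclid R d -> R) s (C : R) :
  measurable_fun setT f -> (forall t, `|f t| <= C) ->
  exists2 D, 0 <= D & forall h, 0 <= h <= 1 -> `|intop b f (scl h s)| <= D * h ^+ 3.
Proof.
move=> mf fC; have [D D0 HD] := K_scl_le s.
have C0 : 0 <= C by apply: le_trans (fC [tuple 0 | i < d]).
exists (D * C); first by rewrite mulr_ge0.
move=> h h01; apply: normr_Rintegral_le.
  apply: measurable_funM => //.
  exact: (measurableT_comp measurable_K (pair1_measurable (scl h s))).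
move=> t; rewrite normrM mulrAC; apply: ler_pM => //; exact: HD.
Qed.

End kernel_expansion.

(** * Construction of the eigenfunction *)

Section existence.
Context {R : realType} {d : nat} (b : R) (b0 : 0 < b) (d0 : (0 < d)%N).
Implicit Types (s t : euclid R d) (X z C : R).

Let e := ka b / ga b.
Let a : R := d%:R / 2.
Let a0 : 0 < a. Proof. by rewrite divr_gt0// ltr0n. Qed.
Let c : R := (1 - q b) ^+ d.
Let r : R := q b ^+ 2.
Let r01 : 0 < r < 1. Proof. exact: rho_in. Qed.

(** Because [ka] + [ga] rho / (1 - rho) = (1 - q)/2 + q/2 = 1/2, the generating function at z = rho
    is a constant times [gw0]; the derivative adds only a factor affine in |s|^2. *)
Lemma gprof_source (M : R) s :
  gprof b (fun X => r * lagF' a r X - M * lagF a r X) s =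
  gw0 s * (lagF a r 0 * (r * a / (1 - r) - M) +
    - (lagF a r 0 * r * ga b / (1 - r) ^+ 2) * dot s s).
Proof.
have /andP[r0 r1] := r01.
have FX X : lagF a r X = lagF a r 0 * expR (- (X * (r / (1 - r)))).
  by rewrite /lagF -expRD; congr expR; ring.
rewrite /gprof /lagF' lagFS// lagFSS// FX.
have -> : gw0 s = expR (- ka b * dot s s) * expR (- (ga b * dot s s * (r / (1 - r)))).
  rewrite /gw0 -expRD; congr expR.
  have /andP[q0 q1] := q_gt0_lt1 b0.
  have r1' : 1 - q b ^+ 2 != 0 by rewrite gt_eqF// subr_gt0.
  by rewrite /r /ka /ga; field; rewrite r1' gt_eqF.
set E1 := expR _; set E2 := expR _; set F0 := lagF a r 0.
by field; rewrite gt_eqF// subr_gt0.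
Qed.

Variable m : nat.
Hypothesis bal : balanced m.+1 a r.

Let f : euclid R d -> R := gprof b (eigprof (d := d) b m.+1).

Lemma measurable_eigfun : measurable_fun setT f.
Proof. by apply: measurable_gprof; exact: measurable_eigprof. Qed.

Lemma eigfun_bounded : exists C, forall t, `|f t| <= C.
Proof.
have [_ [C H]] := tame_eigprof b0 d0 m.+1.
by exists C => t; exact: (normr_gprof_le b0).
Qed.

Lemma eigfun_flat : exists2 C, 0 <= C & forall s,
  ga b * dot s s <= 1 -> `|f s| <= C * (ga b * dot s s) ^+ 2.
Proof.
have [C H] := lagh_flat a0 r01 bal.
exists `|C| => // s s1.
have X0 : 0 <= ga b * dot s s by rewrite mulr_ge0 ?(ltW (ga_gt0 b0))// dot_ge0.
rewrite /f /gprof normrM ger0_norm ?expR_ge0// -[leRHS]mul1r.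
apply: ler_pM; rewrite ?expR_ge0//.
  by rewrite -expR0 ler_expR mulNr oppr_le0 mulr_ge0 ?(ltW (ka_gt0 b0))// dot_ge0.
rewrite /eigprof (ger0_norm X0).
apply: (le_trans (H _ _)); first by rewrite X0.
by rewrite ler_wpM2r ?sqr_ge0// ler_norm.
Qed.

(* Since K (h s) = O(h^3) and f (h s) = O(h^4), comparing the powers of h in
   G f (h s) = lambda f (h s) + source (h s) identifies the three moments. *)
Lemma eigfun_moments s :
  [/\ moment b 0 f s = c * (lagF a r 0 * (r * a / (1 - r) - m.+1%:R)),
      moment b 1 f s = 0 &
      moment b 2 f s / 2 = c * (- (lagF a r 0 * r * ga b / (1 - r) ^+ 2) * dot s s)].
Proof.
have mf := measurable_eigfun; have [C HC] := eigfun_bounded.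
have [D D0 HD] := normr_intop_scl_le b s mf HC.
have [E E0 HE] := eigfun_flat.
have g0 := ga_gt0 b0; have /andP[r0 r1] := r01.
set x0 := lagF a r 0 * _; set y0 := - _.
pose dd k : R := match k with
  | 0 => c * x0 - moment b 0 f s
  | 1 => - moment b 1 f s
  | _ => c * (y0 * dot s s) - moment b 2 f s / 2 end.
(* Keeps ga |h s|^2 <= 1 for h <= h0, the range of [eigfun_flat]. *)
pose h0 := (1 + ga b * dot s s)^-1.
have xs0 : 0 <= ga b * dot s s by rewrite mulr_ge0 ?(ltW g0)// dot_ge0.
have h00 : 0 < h0 by rewrite invr_gt0 ltr_pwDl.
have h01 : h0 <= 1 by rewrite invf_le1 ?ltr_pwDl// lerDl.
have c0 : 0 <= c.
  by have /andP[q0 q1] := q_gt0_lt1 b0; rewrite exprn_ge0// subr_ge0 ltW.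
have lam0 : 0 <= c * r ^+ m.+1 by rewrite mulr_ge0// exprn_ge0// ltW.
suff ddE : forall k, (k < 3)%N -> dd k = 0.
  have := ddE 0%N isT; have := ddE 1%N isT; have := ddE 2%N isT.
  rewrite /dd => /eqP + /eqP + /eqP.
  by rewrite !subr_eq0 oppr_eq0 => /eqP <- /eqP -> /eqP <-.
(* Dividing the constant by [gw0 s] pays for the factor [gw0 (scl h s)] >= [gw0 s] in front of the
   polynomial. *)
apply: (@poly_small_eq0 _ h0 3 dd
  ((D + c * r ^+ m.+1 * (E * (ga b * dot s s) ^+ 2)) / gw0 s) h00) => h /andP[hp hh].
have hle1 : h <= 1 by exact: le_trans h01.
have hin : 0 <= h <= 1 by rewrite (ltW hp).
have small : ga b * dot (scl h s) (scl h s) <= 1.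
  rewrite dot_scl2 mulrCA.
  apply: (@le_trans _ _ (h0 * (ga b * dot s s))).
    rewrite ler_wpM2r// expr2 -[leRHS]mulr1; apply: ler_pM => //; exact: ltW.
  by rewrite mulrC ler_pdivrMr ?ltr_pwDl// mul1r lerDr.
have key : gw0 (scl h s) * \sum_(n < 3) dd n * h ^+ n =
    intop b f (scl h s) - c * r ^+ m.+1 * f (scl h s).
  rewrite (intopE _ (integrable_bounded b mf HC)).
  have -> : \int[gauss b d]_t (gker (scl h s) t * f t) =
    gker_op b (scl h s) (eigprof (d := d) b m.+1) by [].
  rewrite (gker_op_eigprof b0 d0) -/a -/c -/r gprof_source -/x0 -/y0.
  rewrite !(moment_scl _ _ _ (integrable_bounded b mf HC)) dot_scl2 -/f.
  rewrite 3!big_ord_recl big_ord0 /= expr0 /bump /= !expr1 /dd /=.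
  by ring.
rewrite -(ler_pM2l (gw0_gt0 (scl h s))) -{1}(gtr0_norm (gw0_gt0 (scl h s))) -normrM key.
apply: (@le_trans _ _ ((D + c * r ^+ m.+1 * (E * (ga b * dot s s) ^+ 2)) * h ^+ 3)).
  rewrite mulrDl; apply: (le_trans (ler_normB _ _)); apply: lerD; first exact: HD.
  rewrite normrM (ger0_norm lam0) -[leRHS]mulrA; apply: ler_wpM2l => //.
  apply: (le_trans (HE _ small)); rewrite dot_scl2 -[leRHS]mulrA ler_wpM2l//.
  have -> : (ga b * (h ^+ 2 * dot s s)) ^+ 2 =
    (ga b * dot s s) ^+ 2 * (h * h ^+ 3) by ring.
  by rewrite ler_wpM2l ?sqr_ge0// ler_piMl// exprn_ge0// ltW.
have A0 : 0 <= D + c * r ^+ m.+1 * (E * (ga b * dot s s) ^+ 2).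
  by rewrite addr_ge0// (mulr_ge0 lam0)// mulr_ge0// exprn_ge0.
set A := D + _ in A0 *.
have -> : gw0 (scl h s) * (A / gw0 s * h ^+ 3) =
  (A * h ^+ 3) * (gw0 (scl h s) / gw0 s) by ring.
rewrite ler_peMr//; first by rewrite mulr_ge0// exprn_ge0// ltW.
rewrite ler_pdivlMr ?gw0_gt0// mul1r /gw0 ler_expR lerN2 ler_wpM2r//.
by rewrite dot_scl2 ler_piMl ?dot_ge0// exprn_ile1// ltW.
Qed.

Lemma eigfun_eq s : intop b f s = c * r ^+ m.+1 * f s.
Proof.
have mf := measurable_eigfun; have [C HC] := eigfun_bounded.
have [M0 M1 M2] := eigfun_moments s.
rewrite (intopE _ (integrable_bounded b mf HC)) M0 M1 M2.
have -> : \int[gauss b d]_t (gker s t * f t) = gker_op b s (eigprof (d := d) b m.+1) by [].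
rewrite (gker_op_eigprof b0 d0) -/a -/c -/r gprof_source -/f; ring.
Qed.

Lemma eigfun_Lfun2 : f \in Lfun (gauss b d) 2%:E.
Proof.
have mf := measurable_eigfun; have [C HC] := eigfun_bounded.
rewrite inE; apply/andP; split; rewrite inE//= /finite_norm unlock poweR_lty//.
apply: (@le_lt_trans _ _ (\int[gauss b d]_s (C `^ 2)%:E)%E); last first.
  by rewrite integral_cst//= (probability_setT (gauss b d)) mule1 ltry.
have C0 : 0 <= C by apply: le_trans (HC [tuple 0 | i < d]).
apply: ge0_le_integral => //.
- by move=> s _; rewrite lee_fin powR_ge0.
- apply/measurable_EFinP.
  apply: (measurableT_comp (measurable_powR _)) => //.
  exact: measurableT_comp.
- by move=> s _; rewrite lee_fin ge0_ler_powR// nnegrE.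
Qed.

Lemma eigfun_dot s t : dot s s = dot t t -> f s = f t.
Proof. by rewrite /f /gprof => ->. Qed.

(** If f vanished almost everywhere so would its moments, but the second one is a nonzero multiple
    of |s|^2, tested at s = (1, ..., 1). *)
Lemma eigfun_neq0 : ~ (f = cst 0 %[ae gauss b d]).
Proof.
move=> f0; pose s : euclid R d := [tuple 1 | i < d].
have [_ _ M2] := eigfun_moments s.
have : moment b 2 f s = 0.
  rewrite /moment /Rintegral (_ : (\int[_]_t _)%E = 0)//.
  rewrite -(integral0 (gauss b d) setT); apply: ae_eq_integral => //.
    have mf := measurable_eigfun; have [C HC] := eigfun_bounded.
    exact: measurable_int (integrable_moment 2 s (integrable_bounded b mf HC)).
  by apply: filterS f0 => t /= h /h ->; rewrite mulr0.
move=> M20; move: M2; rewrite M20 mul0r => /esym/eqP.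
have /andP[r0 r1] := r01; have g0 := ga_gt0 b0.
have /andP[q0 q1] := q_gt0_lt1 b0.
apply/negP; apply: mulf_neq0; last apply: mulf_neq0.
- by rewrite expf_neq0// gt_eqF// subr_gt0.
- rewrite oppr_eq0; apply: mulf_neq0.
    by rewrite (mulf_neq0 (mulf_neq0 _ _))// gt_eqF// lagF_gt0.
  by rewrite invr_eq0 expf_neq0// gt_eqF// subr_gt0.
- rewrite /dot gt_eqF//.
  under eq_bigr do rewrite !tnth_mktuple mulr1.
  by rewrite sumr_const card_ord ltr0n.
Qed.

Lemma balanced_radial_eigenvalue :
  radial_eigenvalue d b (c_beta d b * rho b ^+ m.+1).
Proof.
have /andP[r0 r1] := r01; have /andP[q0 q1] := q_gt0_lt1 b0.
split.
  by rewrite mulf_neq0// expf_neq0// gt_eqF// subr_gt0.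
exists f; split.
- split; first exact: eigfun_Lfun2.
  exists f; split; first exact: eigfun_Lfun2.
    case: ifP => _.
      move=> s; apply: eigfun_dot; rewrite /dot; apply: eq_bigr => i _.
      by rewrite !tnth_mktuple mulrNN.
    move=> s t st; apply: eigfun_dot.
    by rewrite -!norm2_sqr st.
  exact: aeW.
- exact: eigfun_neq0.
- by apply: aeW => s _ /=; exact: eigfun_eq.
Qed.

End existence.

Lemma radial_eigenvalue_exists (R : realType) d m : (0 < d)%N ->
  exists2 b : R, 0 < b & radial_eigenvalue d b (c_beta d b * rho b ^+ m.+1).
Proof.
move=> d0; have a0 : 0 < d%:R / 2 :> R by rewrite divr_gt0// ltr0n.
have [r /andP[r0 r1] bal] := lag_balance m a0.
have [|b b0 qb] := @q_surj R (Num.sqrt r).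
  by rewrite sqrtr_gt0 r0 -[ltRHS]sqrtr1 ltr_sqrt.
exists b => //; apply: balanced_radial_eigenvalue => //.
by rewrite qb sqr_sqrtr ?(ltW r0).
Qed.

(** * The top eigenvalue *)

Section ground_state.
Context {R : realType} {d : nat} (b : R) (b0 : 0 < b).
Implicit Types (s t : euclid R d).

Let mu := gauss b d.
Let c : R := (1 - q b) ^+ d.
Let w t : R := expR (- ka b * dot t t).

Let c_gt0 : 0 < c.
Proof. by have /andP[q0 q1] := q_gt0_lt1 b0; rewrite exprn_gt0// subr_gt0. Qed.

Let w_gt0 t : 0 < w t. Proof. exact: expR_gt0. Qed.

Let w_neq0 t : w t != 0. Proof. by rewrite gt_eqF. Qed.

Let measurable_w : measurable_fun setT w.
Proof.
by apply: measurableT_comp => //; apply: measurable_funM => //; exact: measurable_dotself.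
Qed.

Let w_le1 t : `|w t| <= 1.
Proof.
rewrite ger0_norm ?(ltW (w_gt0 t))// -[leRHS]expR0 ler_expR mulNr oppr_le0.
by rewrite mulr_ge0 ?(ltW (ka_gt0 b0))// dot_ge0.
Qed.

Lemma gkerC s t : gker s t = gker t s.
Proof.
rewrite /gker [dot t t + _]addrC (_ : dot s t = dot t s)//.
by apply: eq_bigr => i _; rewrite mulrC.
Qed.

Lemma ge0_integral_gker_ground s :
  (\int[mu]_t (gker s t * w t)%:E = (c * w s)%:E)%E.
Proof.
have z01 : 0 <= (0 : R) < 1 by rewrite ltr01 andbT.
have := ge0_integral_gker s b0 z01; rewrite mulr0 /gprof.
rewrite lagF0 mulr1 => <-.
by apply: eq_integral => t _; rewrite lagF0 mulr1.
Qed.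

(** The equation G w = c w at s = 0, where the kernel is [gw0 t] and w = 1. *)
Lemma integral_gw0_ground : \int[mu]_t (gw0 t * w t) = c.
Proof.
pose z : euclid R d := [tuple 0 | i < d].
have z0 t : dot z t = 0.
  by rewrite /dot big1// => i _; rewrite tnth_mktuple mul0r.
have := ge0_integral_gker_ground z.
rewrite {2}/w z0 mulr0 expR0 mulr1 /Rintegral => h.
rewrite -[RHS]/(fine c%:E) -h; congr fine; apply: eq_integral => t _.
by rewrite gkerE !z0 expR0 mul1r /gw0 z0 mul0r oppr0 expR0 mul1r.
Qed.

Lemma Rintegral_sum (I : Type) (r : seq I) (g : I -> euclid R d -> R) :
  (forall i, mu.-integrable setT (EFin \o g i)) ->
  mu.-integrable setT (EFin \o (fun t => \sum_(i <- r) g i t)) /\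
  \int[mu]_t (\sum_(i <- r) g i t) = \sum_(i <- r) \int[mu]_t g i t.
Proof.
move=> gi; elim: r => [|i r [h1 h2]].
  rewrite big_nil (_ : (fun _ => _) = cst 0); last by apply/funext => t; rewrite big_nil.
  split; last by rewrite Rintegral_cst//= mul0r.
  by apply: (@integrable_bounded _ _ _ _ 0) => // t; rewrite normr0.
rewrite (_ : (fun _ => _) = (fun t => g i t + \sum_(i <- r) g i t)).
  split; first exact: (integrableD measurableT (gi i) h1).
  by rewrite RintegralD// h2 big_cons.
by apply/funext => t; rewrite big_cons.
Qed.

(** * P as a sum of squares *)

Section feature_sums.
Variables (I : finType) (phi : I -> euclid R d -> R).
Hypothesis mphi : forall i, measurable_fun setT (phi i).
Hypothesis phi_le : forall i t, `|phi i t| <= 1 + dot t t.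

Let phi_gw0_le i t : `|phi i t * gw0 t| <= 3.
Proof.
rewrite normrM [`|gw0 t|]ger0_norm ?(ltW (gw0_gt0 t))//.
apply: (le_trans (ler_wpM2r (ltW (gw0_gt0 t)) (phi_le i t))).
rewrite /gw0 expRN ler_pdivrMr ?expR_gt0//.
have := expR_ge1Dx (dot t t / 2); have := dot_ge0 t; lra.
Qed.

Variable f : euclid R d -> R.
Hypothesis fi : mu.-integrable setT (EFin \o f).

(** s.t and (s.t)^2 are sums of phi_i(s) phi_i(t), with phi_i the coordinates and the products of
    two coordinates; so <P f, f> is a combination of squares of such coefficients. *)
Definition feature i : R := \int[mu]_t (phi i t * gw0 t * f t).

Lemma integrable_feature i :
  mu.-integrable setT (EFin \o (fun t => phi i t * gw0 t * f t)).
Proof.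
apply: (@integrable_boundedM _ _ _ _ _ 3) => //.
by apply: measurable_funM => //; exact: measurable_gw0.
Qed.

Lemma featuresP :
  mu.-integrable setT (EFin \o (fun t => \sum_i feature i * (phi i t * gw0 t * f t))) /\
  \int[mu]_t (\sum_i feature i * (phi i t * gw0 t * f t)) = \sum_i feature i ^+ 2.
Proof.
have gi i := integrableZl measurableT (feature i) (integrable_feature i).
have [h1 h2] := Rintegral_sum (index_enum I) gi; split => //.
rewrite h2; apply: eq_bigr => i _; rewrite RintegralZl//.
exact: integrable_feature.
Qed.

Lemma feature_integralE s :
  \int[mu]_t ((\sum_i phi i s * phi i t) * gw0 t * f t) = \sum_i feature i * phi i s.
Proof.
have gi i := integrableZl measurableT (phi i s) (integrable_feature i).
have [h1 h2] := Rintegral_sum (index_enum I) gi.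
transitivity (\int[mu]_t (\sum_i (phi i s * (phi i t * gw0 t * f t)))).
  apply: eq_Rintegral => t _; rewrite !mulr_suml; apply: eq_bigr => i _; ring.
rewrite h2; apply: eq_bigr => i _; rewrite RintegralZl//.
  by rewrite mulrC.
exact: integrable_feature.
Qed.

End feature_sums.

Lemma sqr_tnth_le_dot t (i : 'I_d) : (tnth t i : R) ^+ 2 <= dot t t.
Proof.
rewrite /dot (bigD1 i)//= -expr2 lerDl sumr_ge0// => j _.
by rewrite -expr2 sqr_ge0.
Qed.

Lemma normr_tnth_le t (i : 'I_d) : `|tnth t i : R| <= 1 + dot t t.
Proof.
have := sqr_tnth_le_dot t i; set x : R := tnth t i => h.
have := sqr_ge0 (`|x| - 1); rewrite sqrrB real_normK ?num_real// expr1n mulr1.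
by have := normr_ge0 x; have := dot_ge0 t; lra.
Qed.

Lemma normr_tnthM_le t (i j : 'I_d) :
  `|(tnth t i : R) * (tnth t j : R)| <= 1 + dot t t.
Proof.
have := sqr_tnth_le_dot t i; have := sqr_tnth_le_dot t j.
set x : R := tnth t i; set y : R := tnth t j => h1 h2.
rewrite normrM; have := sqr_ge0 (`|x| - `|y|).
rewrite sqrrB !real_normK ?num_real//; lra.
Qed.

Lemma measurable_tnthR (i : 'I_d) :
  measurable_fun setT (fun t : euclid R d => tnth t i : R).
Proof. exact: measurable_tnth. Qed.

Variable f : euclid R d -> R.
Hypothesis fi : mu.-integrable setT (EFin \o f).

Definition taylor_part s : R :=
  gw0 s * (moment b 0 f s + moment b 1 f s + moment b 2 f s / 2).

Lemma moment0E s : moment b 0 f s = \int[mu]_t (gw0 t * f t).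
Proof. by apply: eq_Rintegral => t _; rewrite expr0 mul1r. Qed.

(** The square of the zeroth moment is kept as a lower bound for <P f, f>, since this moment is what
    has to vanish. *)
Lemma taylor_part_ge0 :
  mu.-integrable setT (EFin \o (fun s => f s * taylor_part s)) /\
  (\int[mu]_t (gw0 t * f t)) ^+ 2 <= \int[mu]_s (f s * taylor_part s).
Proof.
pose p1 (i : 'I_d) t : R := tnth t i.
pose p2 (p : 'I_d * 'I_d) t : R := (tnth t p.1 : R) * (tnth t p.2 : R).
have mp1 i : measurable_fun setT (p1 i) by exact: measurable_tnthR.
have mp2 p : measurable_fun setT (p2 p) by apply: measurable_funM; exact: measurable_tnthR.
have bp1 i t : `|p1 i t| <= 1 + dot t t by exact: normr_tnth_le.
have bp2 p t : `|p2 p t| <= 1 + dot t t by exact: normr_tnthM_le.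
pose M0 := \int[mu]_t (gw0 t * f t).
have M1 s : moment b 1 f s = \sum_i feature p1 f i * p1 i s.
  by rewrite -(feature_integralE mp1 bp1 fi).
have M2 s : moment b 2 f s = \sum_i feature p2 f i * p2 i s.
  rewrite -(feature_integralE mp2 bp2 fi); apply: eq_Rintegral => t _.
  congr (_ * _ * _); rewrite /dot expr2 big_distrlr /= pair_big /=.
  by apply: eq_bigr => i _; rewrite /p2; ring.
have [i1 e1] := featuresP mp1 bp1 fi; have [i2 e2] := featuresP mp2 bp2 fi.
have ig : mu.-integrable setT (EFin \o (fun t => gw0 t * f t)).
  apply: (@integrable_boundedM _ _ _ _ _ 1) => //; first exact: measurable_gw0.
  by move=> t; rewrite ger0_norm ?gw0_le1// ltW// gw0_gt0.
have i0 := integrableZl measurableT M0 ig.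
have i2' := integrableZl measurableT (2^-1) i2.
have i01 := integrableD measurableT i0 i1.
have i012 := integrableD measurableT i01 i2'.
have E : (fun s => f s * taylor_part s) = (fun s => M0 * (gw0 s * f s) +
   \sum_i feature p1 f i * (p1 i s * gw0 s * f s) +
   2^-1 * \sum_i feature p2 f i * (p2 i s * gw0 s * f s)).
  apply/funext => s; rewrite /taylor_part moment0E -/M0 M1 M2.
  have -> : \sum_i feature p1 f i * (p1 i s * gw0 s * f s) =
     (\sum_i feature p1 f i * p1 i s) * (gw0 s * f s).
    by rewrite mulr_suml; apply: eq_bigr => i _; ring.
  have -> : \sum_i feature p2 f i * (p2 i s * gw0 s * f s) =
     (\sum_i feature p2 f i * p2 i s) * (gw0 s * f s).
    by rewrite mulr_suml; apply: eq_bigr => i _; ring.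
  by field.
rewrite E; split; first exact: i012.
rewrite RintegralD// RintegralD// RintegralZl// RintegralZl// e1 e2 -/M0.
rewrite -expr2 -addrA lerDl addr_ge0 ?mulr_ge0 ?sumr_ge0// => i _; exact: sqr_ge0.
Qed.

Hypothesis f2i : mu.-integrable setT (EFin \o (fun t => f t ^+ 2)).

Let mf : measurable_fun setT f.
Proof. by apply/measurable_EFinP; exact: measurable_int fi. Qed.

Definition Gop s : R := \int[mu]_t (gker s t * f t).

Let gkerw_ge0 s t : 0 <= gker s t * w t.
Proof. exact: (mulr_ge0 (ltW (gker_gt0 _ _)) (ltW (w_gt0 _))). Qed.

Let V_integrand_ge0 s t : 0 <= gker s t / w t * f t ^+ 2.
Proof.
apply: mulr_ge0; last exact: sqr_ge0.
by apply: divr_ge0; apply: ltW; [exact: gker_gt0|exact: w_gt0].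
Qed.

Let J_integrand_ge0 s t :
  0 <= gker s t * w s * w t * (f s / w s - f t / w t) ^+ 2.
Proof.
apply: mulr_ge0; last exact: sqr_ge0.
apply: mulr_ge0; last exact: ltW (w_gt0 _).
by apply: mulr_ge0; apply: ltW; [exact: gker_gt0|exact: w_gt0].
Qed.

(** Half of Schur's bound 2 f(s) f(t) <= f(s)^2 w(t)/w(s) + f(t)^2 w(s)/w(t): the last term
    integrates over t to w(s) V(s). *)
Let V s : R := \int[mu]_t (gker s t / w t * f t ^+ 2).

Lemma measurable_gker2 : measurable_fun setT
  (fun p : euclid R d * euclid R d => gker p.1 p.2).
Proof.
have m1 := @measurable_dot R d _ (euclid R d * euclid R d)%type fst snd
  measurable_fst measurable_snd.
have m2 := @measurable_dot R d _ (euclid R d * euclid R d)%type fst fst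
  measurable_fst measurable_fst.
have m3 := @measurable_dot R d _ (euclid R d * euclid R d)%type snd snd
  measurable_snd measurable_snd.
apply: measurableT_comp => //; apply: measurable_funB => //.
by apply: measurable_funM => //; exact: measurable_funD.
Qed.

Lemma measurable_winv : measurable_fun setT (fun t => (w t)^-1).
Proof.
rewrite (_ : (fun _ => _) = (fun t => expR (ka b * dot t t))).
  apply: measurableT_comp => //; apply: measurable_funM => //.
  exact: measurable_dotself.
by apply/funext => t; rewrite /w mulNr expRN invrK.
Qed.

(** Dividing by w leaves -q |t|^2 / 2 in the exponent, exactly what s.t <= |s|^2 / (2 q) + q |t|^2 /
    2 consumes. *)
Lemma gker_divw_le s : exists C, forall t, `|gker s t / w t| <= C.
Proof.
have /andP[q0 q1] := q_gt0_lt1 b0.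
exists (expR ((q b)^-1 * dot s s / 2)) => t.
rewrite ger0_norm; last by rewrite divr_ge0// ltW// gker_gt0.
rewrite /gker /w mulNr expRN invrK -expRD ler_expR.
have := normr_dot_le (scl (q b)^-1 s) t; rewrite dot_sclr dot_scl2 => h.
have {h} h : dot s t <= q b * (((q b)^-1 ^+ 2 * dot s s + dot t t) / 2).
  rewrite -ler_pdivrMl//; apply: le_trans h; exact: ler_norm.
have e : q b * (((q b)^-1 ^+ 2 * dot s s + dot t t) / 2) =
   (q b)^-1 * dot s s / 2 + q b * dot t t / 2 by field; rewrite gt_eqF.
rewrite e in h; have := dot_ge0 s; rewrite /ka; move: h.
set x := dot s t; set y := _ / 2; set z := dot t t; set u := dot s s.
by move=> h u0; lra.
Qed.

Lemma integrable_V s :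
  mu.-integrable setT (EFin \o (fun t => gker s t / w t * f t ^+ 2)).
Proof.
have [C HC] := gker_divw_le s.
apply: (@integrable_boundedM _ _ _ _ _ C) => //.
apply: measurable_funM; first exact: measurable_gker.
exact: measurable_winv.
Qed.

(** By Tonelli one may integrate over s first; symmetry of the kernel and G w = c w then give c
    f(t)^2. *)
Lemma integrable_wV : mu.-integrable setT (EFin \o (fun s => w s * V s)) /\
  \int[mu]_s (w s * V s) = c * \int[mu]_t f t ^+ 2.
Proof.
pose H (p : euclid R d * euclid R d) : R := w p.1 * (gker p.1 p.2 / w p.2 * f p.2 ^+ 2).
have mH : measurable_fun setT H.
  apply: measurable_funM; first exact: (measurableT_comp measurable_w measurable_fst).
  apply: measurable_funM.
    apply: measurable_funM; first exact: measurable_gker2.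
    exact: (measurableT_comp measurable_winv measurable_snd).
  apply: measurable_funX; exact: (measurableT_comp mf measurable_snd).
have mHe : measurable_fun setT (EFin \o H) by apply/measurable_EFinP.
have H0 p : 0 <= H p.
  by rewrite /H mulr_ge0 ?V_integrand_ge0 ?(ltW (w_gt0 _)).
have H0e p : (0 <= (EFin \o H) p)%E by rewrite /= lee_fin.
have inner s : (\int[mu]_t (H (s, t))%:E = (w s * V s)%:E)%E.
  rewrite /H /=; have iV := integrable_V s.
  under eq_integral do rewrite EFinM.
  rewrite integralZl//.
  rewrite EFinM /V /Rintegral fineK//; exact: integrable_fin_num.
have outer t : (\int[mu]_s (H (s, t))%:E = (c * f t ^+ 2)%:E)%E.
  rewrite /H /=.
  transitivity (\int[mu]_s ((f t ^+ 2 / w t)%:E * (gker t s * w s)%:E))%E.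
    by apply: eq_integral => s _; rewrite -EFinM gkerC; congr EFin; ring.
  transitivity ((f t ^+ 2 / w t)%:E * \int[mu]_s (gker t s * w s)%:E)%E.
    apply: ge0_integralZl_EFin => //.
    - by move=> s _; rewrite lee_fin gkerw_ge0.
    - apply/measurable_EFinP; apply: measurable_funM => //; exact: measurable_gker.
    - by rewrite divr_ge0 ?sqr_ge0// ltW.
  rewrite ge0_integral_gker_ground -EFinM; congr EFin.
  by rewrite -/c -/(w t); field.
have tot : (\int[mu]_s (w s * V s)%:E = (c * \int[mu]_t f t ^+ 2)%:E)%E.
  transitivity (\int[mu]_s \int[mu]_t (H (s, t))%:E)%E.
    by apply: eq_integral => s _; rewrite inner.
  rewrite (fubini_tonelli _ mHe H0e).
  under eq_integral do rewrite outer EFinM.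
  rewrite integralZl// EFinM /Rintegral fineK//; exact: integrable_fin_num.
have mwV : measurable_fun setT (fun s => (w s * V s)%:E).
  have := @measurable_fun_fubini_tonelli_F _ _ _ _ _ mu (EFin \o H) mHe H0e.
  rewrite /fubini_F (_ : (fun _ => _) = (fun s => (w s * V s)%:E))//.
  by apply/funext => s; rewrite -inner.
have wV0 s : 0 <= w s * V s.
  apply: mulr_ge0; first exact: ltW (w_gt0 s).
  apply: Rintegral_ge0 => t _.
  exact: V_integrand_ge0.
split; last by rewrite /Rintegral tot.
apply/integrableP; split; first exact: mwV.
rewrite (_ : (\int[_]_x _)%E = (c * \int[mu]_t f t ^+ 2)%:E) ?ltry//.
rewrite -tot; apply: eq_integral => s _ /=.
by rewrite ger0_norm.
Qed.

(* The integral of J is 2 (c |f|^2 - <G f, f>), the defect in Schur's test for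
   the ground state w. *)
Let J s : R := \int[mu]_t (gker s t * w s * w t * (f s / w s - f t / w t) ^+ 2).

Lemma integrable_Jt s : mu.-integrable setT
   (EFin \o (fun t => gker s t * w s * w t * (f s / w s - f t / w t) ^+ 2)) /\
  J s = c * f s ^+ 2 - 2 * (f s * Gop s) + w s * V s.
Proof.
have ikw : mu.-integrable setT (EFin \o (fun t => gker s t * w t)).
  apply: integrable_gkerM; exact: (@integrable_bounded _ _ _ _ 1).
have ikf := integrable_gkerM s fi.
have iV := integrable_V s.
have i1 := integrableZl measurableT (f s ^+ 2 / w s) ikw.
have i2 := integrableZl measurableT (2 * f s) ikf.
have i3 := integrableZl measurableT (w s) iV.
have i12 := integrableB measurableT i1 i2.
have i123 := integrableD measurableT i12 i3.
have E : (fun t => gker s t * w s * w t * (f s / w s - f t / w t) ^+ 2) =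
  (fun t => (f s ^+ 2 / w s) * (gker s t * w t) - (2 * f s) * (gker s t * f t) +
    w s * (gker s t / w t * f t ^+ 2)).
  by apply/funext => t; field; rewrite !w_neq0.
rewrite /J E; split; first exact: i123.
rewrite RintegralD// RintegralB// !RintegralZl//.
have -> : \int[mu]_t (gker s t * w t) = c * w s.
  by rewrite /Rintegral ge0_integral_gker_ground.
by rewrite -/(Gop s) -/(V s); field.
Qed.

Hypothesis fE : intop b f = (fun s => c * f s) %[ae mu].

Let GopE s : Gop s = intop b f s + taylor_part s.
Proof. by rewrite (intopE s fi) /Gop /taylor_part; ring. Qed.

Lemma ae_feq : {ae mu, forall s, f s * Gop s = c * f s ^+ 2 + f s * taylor_part s}.
Proof. by apply: filterS fE => s /= /(_ I) h; rewrite GopE h; ring. Qed.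

Lemma ground_state_ae : exists k, f = (fun t => k * w t) %[ae mu] /\
  \int[mu]_t (gw0 t * f t) = 0.
Proof.
have [iT T0] := taylor_part_ge0; have [iV eV] := integrable_wV.
(* J with G f eliminated by the eigenvalue equation: equal to J only almost everywhere, but visibly
   integrable, with integral - 2 <P f, f>. *)
pose J' s := c * f s ^+ 2 - 2 * (c * f s ^+ 2 + f s * taylor_part s) + w s * V s.
have i1 := integrableZl measurableT c f2i.
have i2 := integrableZl measurableT 2 (integrableD measurableT i1 iT).
have i12 := integrableB measurableT i1 i2.
have iJ' : mu.-integrable setT (EFin \o J') by exact: (integrableD measurableT i12 iV).
have eJ' : \int[mu]_s J' s = - 2 * \int[mu]_s (f s * taylor_part s).
  rewrite /J' RintegralD// RintegralB// RintegralZl// RintegralZl//; last first.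
    exact: (integrableD measurableT i1 iT).
  by rewrite RintegralD// RintegralZl// eV; ring.
have J0 s : 0 <= J s.
  apply: Rintegral_ge0 => t _.
  exact: J_integrand_ge0.
have JJ' : {ae mu, forall s, J' s = J s}.
  by apply: filterS ae_feq => s h; have [_ ->] := integrable_Jt s; rewrite h.
have J'0 : {ae mu, forall s, 0 <= J' s} by apply: filterS JJ' => s ->.
have mJ' : measurable_fun setT (EFin \o J') by exact: measurable_int iJ'.
have intabs : (\int[mu]_s `|(J' s)%:E| = (\int[mu]_s J' s)%:E)%E.
  rewrite /Rintegral fineK; last exact: integrable_fin_num.
  apply: ae_eq_integral => //; first exact: measurableT_comp.
  by apply: filterS J'0 => s s0 _; rewrite /= ger0_norm.
have Jge0 : 0 <= \int[mu]_s J' s.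
  by rewrite -lee_fin -intabs; apply: integral_ge0 => s _; exact: abse_ge0.
have M00 : \int[mu]_t (gw0 t * f t) = 0.
  apply/eqP; rewrite -sqrf_eq0 eq_le sqr_ge0 andbT.
  by rewrite eJ' in Jge0; lra.
have Jint0 : \int[mu]_s J' s = 0.
  apply/eqP; rewrite eq_le Jge0 andbT eJ'.
  by move: T0; rewrite M00 expr0n /=; lra.
have aeJ' : {ae mu, forall s, J' s = 0}.
  have := (ae_eq_integral_abs mu measurableT mJ').1.
  rewrite intabs Jint0 => /(_ erefl); apply: filterS => s /= /(_ I) h.
  by have := congr1 fine h.
(* Since mu has mass 1, J vanishes at some point s. Its integrand in t is a positive weight times a
   square, so f / w equals the constant f s / w s almost everywhere. *)
have [s Js] : exists s, J s = 0.
  apply: contrapT => /forallNP nJ.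
  have : {ae mu, forall s : euclid R d, False}.
    by apply: filterS2 aeJ' JJ' => s h1 h2; apply: (nJ s); rewrite -h2.
  move=> [N [mN N0 sN]].
  have NT : N = setT by apply/seteqP; split => // x _; apply: sN.
  by move: N0; rewrite NT (probability_setT (gauss b d)) => /eqP; rewrite onee_eq0.
exists (f s / w s); split => //.
have [iJt _] := integrable_Jt s.
have mJt := measurable_int _ iJt.
have nn := J_integrand_ge0 s.
have := (ae_eq_integral_abs mu measurableT mJt).1.
rewrite (_ : (\int[_]_x _)%E = 0%E); last first.
  rewrite -[RHS]/(0%:E) -Js /J /Rintegral fineK; last exact: integrable_fin_num.
  by apply: eq_integral => t _ /=; rewrite ger0_norm.
move=> /(_ erefl); apply: filterS => t /= h /h /(congr1 fine) /= /eqP.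
have kww : 0 < gker s t * w s * w t by rewrite !mulr_gt0// gker_gt0.
rewrite mulf_eq0 (gt_eqF kww) /= sqrf_eq0 subr_eq0 => /eqP ->.
by rewrite divfK.
Qed.

Lemma ground_state_eq0 : f = cst 0 %[ae mu].
Proof.
have [k [fk M0]] := ground_state_ae.
have k0 : k = 0.
  have : \int[mu]_t (gw0 t * f t) = k * c.
    rewrite -integral_gw0_ground -RintegralZl//; last first.
      apply: (@integrable_boundedM _ _ _ _ _ 1); first exact: measurable_gw0.
        by move=> t; rewrite ger0_norm ?gw0_le1// ltW// gw0_gt0.
      exact: (@integrable_bounded _ _ _ _ 1).
    rewrite /Rintegral; congr fine; apply: ae_eq_integral => //.
    - apply/measurable_EFinP; apply: measurable_funM => //; exact: measurable_gw0.
    - apply/measurable_EFinP; apply: measurable_funM => //.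
      by apply: measurable_funM => //; exact: measurable_gw0.
    - apply: filterS fk => t /= h /h ->; congr EFin; rewrite -/(w t); ring.
  by rewrite M0 => /esym/eqP; rewrite mulf_eq0 [c == 0]gt_eqF// orbF => /eqP.
by apply: filterS fk => t /= h /h ->; rewrite k0 mul0r.
Qed.

End ground_state.

Lemma top_not_eigenvalue (R : realType) d (b : R) (f : euclid R d -> R) :
  0 < b -> f \in Lfun (gauss b d) 2%:E -> ~ (f = cst 0 %[ae gauss b d]) ->
  ~ (intop b f = (fun s => c_beta d b * f s) %[ae gauss b d]).
Proof.
move=> b0 fL2 f0 fE; apply: f0.
have fin : gauss b d setT \is a fin_num by rewrite probability_setT.
have /Lfun1_integrable fi := Lfun_subset12 fin fL2.
have f2i := Lfun2_integrable_sqr fL2.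
exact: (ground_state_eq0 b0 fi f2i fE).
Qed.

Theorem corollary4p6 (R : realType) :
  (forall d m : nat, (0 < d)%N -> (0 < m)%N ->
     exists2 b : R, 0 < b & radial_eigenvalue d b (c_beta d b * rho b ^+ m))
  /\
  (forall (d : nat) (b : R), (0 < d)%N -> 0 < b ->
     ~ radial_eigenvalue d b (c_beta d b)).
Proof.
split; first by move=> d [//|m] d0 _; exact: radial_eigenvalue_exists.
by move=> d b _ b0 [_ [f [[fL2 _] f0 fE]]]; exact: (top_not_eigenvalue b0 fL2 f0 fE).
Qed.
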